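(* Let $(\mathfrak g,\mathfrak g_+,\mathfrak g_-)$ be a Manin pair with dual bases $x_i$ of $\mathfrak g_+$ and $x^i$ of $\mathfrak g_-$, structure constants $c_{ij}^k,f_k^{ij},\phi^{ijk}$, and $\rho=[x_i,x^i]$. Let $\mathcal E$ be a highest weight representation of the affine Kac-Moody algebra $\widehat{\mathfrak g}$ whose currents $X(z)$, $X\in\mathfrak g$, satisfy $$X(z)\cdot Y(w)\sim\frac{(X,Y)-\frac12\langle X,Y\rangle}{(z-w)^2}+\frac{[X,Y](w)}{z-w},$$ where $\langle-,-\rangle$ is the Killing form of $\mathfrak g$; write $J_i,J^i$ for the currents of $x_i,x^i$. Let $a_i(z),a^i(z)$ be free fermions with $a_i(z)\cdot a^j(w)\sim\delta_i^j/(z-w)$ and $a_i(z)\cdot a_j(w)\sim a^i(z)\cdot a^j(w)\sim 0$. Let $\alpha=p^ix_i+q_ix^i\in\mathfrak g_0$, where $\mathfrak g_0$ is the intersection of the orthogonal complements of $[\mathfrak g_+,\mathfrak g_+]$ and $[\mathfrak g_-,\mathfrak g_-]$. Define $$\begin{aligned} \mathsf G^+&=J_ia^i-\tfrac12c_{ij}^ka^ia^ja_k+q_i\partial a^i,\\ \mathsf G^-&=J^ia_i-\tfrac12f_k^{ij}a_ia_ja^k+p^i\partial a_i,\\ \Phi&=\tfrac16\phi^{ijk}a_ia_ja_k,\\ \mathsf J&=a^ia_i+(\rho+\bar\alpha,I),\\ \mathsf T&=\tfrac12\bigl(J_iJ^i+J^iJ_i+\partial a^ia_i-a^i\partial a_i+(\alpha,\partial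 I)\bigr),\\ \mathsf F&=\tfrac12\phi^{ijk}(J_i-c_{il}^ma^la_m)a_ja_k+\tfrac12c_{kl}^i\phi^{jkl}\partial a_ia_j. \end{aligned}$$ Then these fields, acting on the tensor product of $\mathcal E$ with the fermionic Fock space of the polarized inner product space $\mathfrak g$, satisfy the operator products of the $N=1\frac12$ superconformal algebra with central charge $$d=\tfrac12\dim\mathfrak g-(\rho,\rho)-(\alpha,\alpha).$$ If moreover $\mathfrak g_-$ is a Lie subalgebra (i.e. $(\mathfrak g,\mathfrak g_+,\mathfrak g_-)$ is a Manin triple), then $\Phi=\mathsf F=0$ and one obtains an action of the $N=2$ superconformal algebra.
   Context: Summation convention throughout. Products of fields are normally ordered; $A(z)\cdot B(w)\sim\sum_{n>0}[AB]_n(w)/(z-w)^n$ denotes the singular part of the operator product expansion. Manin pair: $\mathfrak g$ is a finite-dimensional reductive complex Lie algebra with invariant inner product (nondegenerate symmetric bilinear form) $(-,-)$, and $\mathfrak g=\mathfrak g_+\oplus\mathfrak g_-$ is a decomposition into transverse isotropic subspaces such that $\mathfrak g_+$ is a Lie subalgebra. For a basis $x_i$ of $\mathfrak g_+$ and the dual basis $x^i$ of $\mathfrak g_-$, $(x_i,x^j)=\delta_i^j$, the structure constants are defined by $$[x_i,x_j]=c_{ij}^kx_k,\quad [x_i,x^j]=f_i^{jk}x_k+c_{ki}^jx^k,\quad [x^i,x^j]=f_k^{ij}x^k-\phi^{ijk}x_k.$$ One has $\rho=[x_i,x^i]=f_j^{ji}x_i+c_{ij}^jx^i$. For $x=x_++x_-$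 with $x_\pm\in\mathfrak g_\pm$, $\bar x=x_+-x_-$. Composite currents: $I_i=J_i-c_{ij}^ka^ja_k-\frac12f_i^{jk}a_ja_k$ and $I^i=J^i-f_k^{ij}a_ja^k-\frac12c_{jk}^ia^ja^k+\frac12\phi^{ijk}a_ja_k$; for $x=p^ix_i+q_ix^i$, $(x,I)=p^iI_i+q_iI^i$ and $(x,\partial I)=\partial (x,I)$. $N=1\frac12$ superconformal algebra with central charge $d$: even fields $\mathsf T,\mathsf J,\mathsf F$ and odd fields $\mathsf G^+,\mathsf G^-,\Phi$ with $$\mathsf T(z)\cdot\mathsf T(w)\sim\frac{\frac32d}{(z-w)^4}+\frac{2\mathsf T(w)}{(z-w)^2}+\frac{\partial\mathsf T(w)}{z-w},\quad \mathsf T(z)\cdot\mathsf J(w)\sim\frac{\mathsf J(w)}{(z-w)^2}+\frac{\partial\mathsf J(w)}{z-w},\quad \mathsf J(z)\cdot\mathsf J(w)\sim\frac{d}{(z-w)^2};$$ $\mathsf G^+,\mathsf G^-,\Phi,\mathsf F$ have weights $(\frac32,1),(\frac32,-1),(\frac32,-3),(2,-2)$, where $A$ has weight $(a,q)$ if $\mathsf T(z)\cdot A(w)\sim\frac{aA(w)}{(z-w)^2}+\frac{\partial A(w)}{z-w}$ and $\mathsf J(z)\cdot A(w)\sim\frac{qA(w)}{z-w}$; and $$\mathsf G^+(z)\cdot\mathsf G^-(w)\sim\frac d{(z-w)^3}+\frac{\mathsf J(w)}{(z-w)^2}+\frac{\mathsf T(w)+\frac12\partial\mathsf J(w)}{z-w},$$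 $$\mathsf G^+(z)\cdot\Phi(w)\sim-\tfrac12\mathsf G^-(z)\cdot\mathsf G^-(w)\sim\frac{\mathsf F(w)}{z-w},\qquad \mathsf G^-(z)\cdot\mathsf F(w)\sim\frac{3\Phi(w)}{(z-w)^2}+\frac{\partial\Phi(w)}{z-w},$$ $$\mathsf G^+\cdot\mathsf G^+\sim\mathsf G^-\cdot\Phi\sim\mathsf G^+\cdot\mathsf F\sim\Phi\cdot\Phi\sim\Phi\cdot\mathsf F\sim\mathsf F\cdot\mathsf F\sim0.$$ The $N=2$ superconformal algebra is the case $\Phi=\mathsf F=0$.
   Formalization: The N=1½ claim is false as printed: the order-2 pole of G⁺·Φ is proportional to (ρ+ᾱ,[x^j,x^k])a_ja_k and need not vanish. It is proved under the added, necessary hypothesis ρ+ᾱ∈g_0, which is automatic for Manin triples. *)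

(* Defs.v *)
From HB Require Import structures.
From mathcomp Require Import all_boot all_order all_algebra.
From mathcomp Require Import boolp classical_sets functions fsbigop reals.
From mathcomp Require Import complex.

Set Implicit Arguments.
Unset Strict Implicit.
Unset Printing Implicit Defensive.

Import Order.TTheory GRing.Theory Num.Theory.
Local Open Scope ring_scope.
Local Open Scope complex_scope.

(* Finite-dimensional Lie algebras, given by a bilinear bracket on a vectType *)

Section Lie.
Context {C : fieldType} {g : vectType C}.
Variable br : {bilinear g -> g -> g}.
Implicit Types U W : {vspace g}.

Definition lie_bracket : Prop :=
  (forall x, br x x = 0) /\
  (forall x y z, br x (br y z) + br y (br z x) + br z (br x y) = 0).

Definition lie_subalgebra U : Prop :=
  forall x y, x \in U -> y \in U -> br x y \in U.

Definition lie_ideal U : Prop := forall x y, y \in U -> br x y \in U.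

(* Semisimplicity of the adjoint representation. *)
Definition reductive : Prop :=
  forall U, lie_ideal U ->
    exists W, [/\ lie_ideal W, (U + W)%VS = fullv & (U :&: W)%VS = 0%VS].

Definition bracketv U W : {vspace g} :=
  <<[seq br u w | u <- vbasis U, w <- vbasis W]>>%VS.

Definition lie_solvable U : Prop :=
  exists k, iter k (fun W => bracketv W W) U = 0%VS.

Definition borel U : Prop :=
  [/\ lie_subalgebra U, lie_solvable U &
      forall W, lie_subalgebra W -> lie_solvable W -> (U <= W)%VS -> W = U].

(* The trace of ad u \o ad v. *)
Definition killing (u v : g) : C :=
  \sum_(i < \dim {:g}) coord (vbasis {:g}) i (br u (br v (vbasis {:g})`_i)).

End Lie.

Section ManinPair.
Context {C : fieldType} {g : vectType C}.
Variables (br : {bilinear g -> g -> g}) (ip : {biscalar g}).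

Definition invariant_inner_product : Prop :=
  [/\ forall x y, ip x y = ip y x,
      forall x, (forall y, ip x y = 0) -> x = 0
    & forall x y z, ip (br x y) z = ip x (br y z)].

Definition isotropic (U : {vspace g}) : Prop :=
  forall x y, x \in U -> y \in U -> ip x y = 0.

Variables gp gm : {vspace g}.

Record manin_pair : Prop := ManinPair {
  mp_lie : lie_bracket br;
  mp_reductive : reductive br;
  mp_inner : invariant_inner_product;
  mp_sum : (gp + gm)%VS = fullv;
  mp_cap : (gp :&: gm)%VS = 0%VS;
  mp_isoP : isotropic gp;
  mp_isoM : isotropic gm;
  mp_sub : lie_subalgebra br gp }.

(* Brackets are taken in g, so [gm, gm] need not lie in gm. *)
Definition in_g0 (alpha : g) : Prop :=
  (forall z, z \in bracketv br gp gp -> ip alpha z = 0) /\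
  (forall z, z \in bracketv br gm gm -> ip alpha z = 0).

Definition barv (z : g) : g := daddv_pi gp gm z - daddv_pi gm gp z.

Variables (n : nat) (x y : n.-tuple g).

Definition dual_bases : Prop :=
  [/\ basis_of gp x, basis_of gm y
    & forall i j : 'I_n, ip x`_i y`_j = (i == j)%:R].

(* c i j k, f k i j and phi i j k stand for c_{ij}^k, f_k^{ij}, phi^{ijk}. *)
Definition structure_constants (c f phi : 'I_n -> 'I_n -> 'I_n -> C) : Prop :=
  forall i j : 'I_n,
  [/\ br x`_i x`_j = \sum_k c i j k *: x`_k,
      br x`_i y`_j = \sum_k (f i j k *: x`_k + c k i j *: y`_k)
    & br y`_i y`_j = \sum_k (f k i j *: y`_k - phi i j k *: x`_k)].

Definition rho : g := \sum_(i < n) br x`_i y`_i.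

Definition central_charge (alpha : g) : C :=
  (\dim {:g})%:R / 2 - ip rho rho - ip alpha alpha.

End ManinPair.

(* Fields on a vector space V: A : field V p is the formal distribution
   A(z) = \sum_n (A n) z^(-n-1) with coefficients in End(V).  The boolean p is
   the parity (true = odd); it only determines signs. *)

Definition field (C : fieldType) (V : lmodType C) (p : bool) : Type :=
  int -> V -> V.

HB.instance Definition _ (C : fieldType) (V : lmodType C) (p : bool) :=
  GRing.Lmodule.copy (field V p) (int -> V -> V).

Section Fields.
Context {C : fieldType} {V : lmodType C}.

Definition is_field {p} (A : field V p) : Prop :=
  (forall n, linear (A n)) /\
  (forall v, exists N : int, forall n, N <= n -> A n v = 0).

Definition one_field : field V false := fun n v => if n == -1 then v else 0.

Definition dfield {p} (A : field V p) : field V p :=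
  fun n v => - n%:~R *: A (n - 1) v.

(* Normally ordered product A_-(z) B(z) + (-1)^{pq} B(z) A_+(z), where A_+
   consists of the modes A n with n >= 0; on each vector of V both sums have
   finite support when A and B are fields. *)
Definition nprod {p q} (A : field V p) (B : field V q) : field V (p (+) q) :=
  fun n v =>
    \sum_(j \in [set: nat]) A (- j.+1%:Z) (B (n + j%:Z) v)
    + (-1) ^+ (p && q)
      *: \sum_(j \in [set: nat]) B (n - j.+1%:Z) (A j%:Z v).

(* m choose j, for m of either sign *)
Definition binz (m : int) (j : nat) : C :=
  (\prod_(i < j) (m - i%:Z)%:~R) / (j`!)%:R.

(* A(z).B(w) ~ \sum_j (cs_j)(w) / (z-w)^(j+1).  Expanding 1/(z-w)^(j+1) in
   |z| > |w| for A(z)B(w) and in |w| > |z| for (-1)^{pq} B(w)A(z), and comparing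
   coefficients of z^(-m-1) w^(-k-1), this is the commutator formula below. *)
Definition ope {p q} (A : field V p) (B : field V q)
    (cs : seq (field V (p (+) q))) : Prop :=
  [/\ is_field A, is_field B, forall j, is_field cs`_j
    & forall m k v,
      A m (B k v) - (-1) ^+ (p && q) *: B k (A m v)
      = \sum_(j < size cs) binz m j *: cs`_j (m + k - j%:Z) v].

Definition has_weight {p} (T J : field V false) (A : field V p) (a q : C) :=
  ope T A [:: dfield A; a *: A] /\ ope J A [:: q *: A].

Record N32_algebra (d : C) (T J F : field V false) (Gp Gm Phi : field V true)
  : Prop := N32Algebra {
  N32_TT : ope T T [:: dfield T; 2 *: T; 0; (3 / 2 * d) *: one_field];
  N32_TJ : ope T J [:: dfield J; J];
  N32_JJ : ope J J [:: 0; d *: one_field];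
  N32_wGp : has_weight T J Gp (3 / 2) 1;
  N32_wGm : has_weight T J Gm (3 / 2) (- 1);
  N32_wPhi : has_weight T J Phi (3 / 2) (- 3);
  N32_wF : has_weight T J F 2 (- 2);
  N32_GpGm : ope Gp Gm [:: T + 2^-1 *: dfield J; J; d *: one_field];
  N32_GpPhi : ope Gp Phi [:: F];
  N32_GmGm : ope Gm Gm [:: (- 2) *: F];
  N32_GmF : ope Gm F [:: dfield Phi; 3 *: Phi];
  N32_GpGp : ope Gp Gp [::];
  N32_GmPhi : ope Gm Phi [::];
  N32_GpF : ope Gp F [::];
  N32_PhiPhi : ope Phi Phi [::];
  N32_PhiF : ope Phi F [::];
  N32_FF : ope F F [::] }.

Definition N2_algebra (d : C) (T J : field V false) (Gp Gm : field V true) :=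
  N32_algebra d T J 0 Gp Gm 0.

Definition cyclic_vector (I : Type) (op : I -> V -> V) (v : V) : Prop :=
  forall P : V -> Prop, P v ->
    (forall a u w, P u -> P w -> P (a *: u + w)) ->
    (forall i u, P u -> P (op i u)) -> forall u, P u.

End Fields.

Notation "A ** B" := (nprod A B) (at level 38, right associativity).

(* The affine algebra acts on E through the modes X t^n |-> cur X n, with the
   central element absorbed in the bilinear form level. *)
Section Affine.
Context {C : fieldType} {g : vectType C}.
Variables (br : {bilinear g -> g -> g}) (level : g -> g -> C).
Context {E : lmodType C}.
Variable cur : g -> field E false.

Definition affine_currents : Prop :=
  (forall a X Y, cur (a *: X + Y) = a *: cur X + cur Y) /\
  (forall X Y, ope (cur X) (cur Y) [:: cur (br X Y); level X Y *: one_field]).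

(* Highest weight vector for the Borel subalgebra b + t g[t]: b acts on the
   line spanned by v (hence through a weight), and t g[t] kills v. *)
Definition highest_weight_vector (b : {vspace g}) (v : E) : Prop :=
  [/\ v <> 0,
      forall X (n : int), 0 < n -> cur X n v = 0
    & forall X, X \in b -> exists a : C, cur X 0 v = a *: v].

Definition highest_weight_representation : Prop :=
  affine_currents /\
  exists b v, [/\ borel br b, highest_weight_vector b v &
    cyclic_vector (fun Xn : g * int => cur Xn.1 Xn.2) v].

End Affine.

(* al i and au i stand for a_i and a^i. *)
Section Fermions.
Context {C : fieldType} {W : lmodType C} (n : nat).
Variables al au : 'I_n -> field W true.

Definition free_fermions : Prop :=
  forall i j, [/\ ope (al i) (au j) [:: (i == j)%:R *: one_field],
                  ope (al i) (al j) [::] & ope (au i) (au j) [::]].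

(* With the expansions a_i(z) = \sum_m a_{i,m} z^(-m-1) and
   a^i(z) = \sum_m a^i_m z^(-m), the vacuum is killed by all positive modes and
   by the zero modes a_{i,0} of one half of the polarization. *)
Definition fock_space : Prop :=
  free_fermions /\
  exists vac : W,
    [/\ vac <> 0,
        forall i (m : int), 0 <= m -> al i m vac = 0 /\ au i m vac = 0
      & cyclic_vector (fun k : bool * 'I_n * int =>
          (if k.1.1 then al k.1.2 else au k.1.2) k.2) vac].

End Fermions.

Section Tensor.
Context {C : fieldType} {E W V : lmodType C}.
Variable t : {bilinear E -> W -> V}.

Definition is_tensor_product : Prop :=
  forall (U : lmodType C) (b : {bilinear E -> W -> U}),
    (exists L : {linear V -> U}, forall e w, L (t e w) = b e w) /\
    (forall L1 L2 : {linear V -> U},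
      (forall e w, L1 (t e w) = L2 (t e w)) -> L1 =1 L2).

(* A' = A (x) 1 and A' = 1 (x) A; the space E is even, so no sign occurs. *)
Definition acts_left {p} (A : field E p) (A' : field V p) : Prop :=
  forall m, linear (A' m) /\ forall e w, A' m (t e w) = t (A m e) w.

Definition acts_right {p} (A : field W p) (A' : field V p) : Prop :=
  forall m, linear (A' m) /\ forall e w, A' m (t e w) = t e (A m w).

End Tensor.

(* The fields of the construction.  Products of several factors associate to
   the right, which for these fields is the full normal ordering: the factor
   (J_i - c_{il}^m a^l a_m) a_j a_k of F is expanded into monomials. *)
Section Fields_of_Manin_pair.
Context {C : fieldType} {g : vectType C} (ip : {biscalar g}).
Context {V : lmodType C} {n : nat}.
Variables (x y : n.-tuple g) (c f phi : 'I_n -> 'I_n -> 'I_n -> C).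
Variables (cur : g -> field V false) (al au : 'I_n -> field V true).

Let Jl (i : 'I_n) : field V false := cur x`_i.
Let Ju (i : 'I_n) : field V false := cur y`_i.

Definition Il (i : 'I_n) : field V false :=
  Jl i - \sum_j \sum_k c i j k *: (au j ** al k)
  - 2^-1 *: \sum_j \sum_k f i j k *: (al j ** al k).

Definition Iu (i : 'I_n) : field V false :=
  Ju i - \sum_j \sum_k f k i j *: (al j ** au k)
  - 2^-1 *: \sum_j \sum_k c j k i *: (au j ** au k)
  + 2^-1 *: \sum_j \sum_k phi i j k *: (al j ** al k).

(* (z, I); the coordinates of z are p^i = (z, x^i) and q_i = (z, x_i). *)
Definition curI (z : g) : field V false :=
  \sum_(i < n) (ip z y`_i *: Il i + ip z x`_i *: Iu i).

Definition Gplus (q : 'I_n -> C) : field V true :=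
  \sum_i (Jl i ** au i)
  - 2^-1 *: \sum_i \sum_j \sum_k c i j k *: (au i ** au j ** al k)
  + \sum_i q i *: dfield (au i).

Definition Gminus (p : 'I_n -> C) : field V true :=
  \sum_i (Ju i ** al i)
  - 2^-1 *: \sum_i \sum_j \sum_k f k i j *: (al i ** al j ** au k)
  + \sum_i p i *: dfield (al i).

Definition Phifield : field V true :=
  6^-1 *: \sum_i \sum_j \sum_k phi i j k *: (al i ** al j ** al k).

Definition Jfield (beta : g) : field V false :=
  \sum_i (au i ** al i) + curI beta.

Definition Tfield (alpha : g) : field V false :=
  2^-1 *: (\sum_i (Jl i ** Ju i + Ju i ** Jl i
                   + dfield (au i) ** al i - au i ** dfield (al i))
           + dfield (curI alpha)).

Definition Ffield : field V false :=
  2^-1 *: (\sum_i \sum_j \sum_k phi i j k *: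
             (Jl i ** al j ** al k
              - \sum_l \sum_m c i l m *: (au l ** al m ** al j ** al k)))
  + 2^-1 *: \sum_i \sum_j \sum_k \sum_l
             (c k l i * phi j k l) *: (dfield (al i) ** al j).

End Fields_of_Manin_pair.

(* Main.v *)
Require Import Defs.
From HB Require Import structures.
From mathcomp Require Import all_boot all_order all_algebra.
From mathcomp Require Import boolp classical_sets functions fsbigop reals.
From mathcomp Require Import complex.
From mathcomp Require Import zify ring.

Set Implicit Arguments.
Unset Strict Implicit.
Unset Printing Implicit Defensive.

Import Order.TTheory GRing.Theory Num.Theory.
Local Open Scope ring_scope.
Local Open Scope complex_scope.

(** Over dual bases e_A, e^A of g, the odd field D = G^+ + G^- + Phi is the shifted
    cubic Dirac current J_A a^A + (1/3) theta(e_A) a^A + d a(alpha), where theta(X) is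
    the fermionic current of ad X, whose level is half of the Killing form and
    cancels the shift of the level of E.  Invariance and the Jacobi identity give
    D.D ~ 2 T up to a third order pole, and J.D ~ G^+ - G^- - 3 Phi.  The zero mode of
    a^i a_i acts on G^+, G^-, Phi with charges 1, -1, -3 and on T, J with charge 0, so
    these two products split into their components.  The remaining relations, and
    the value of the central charge, follow from the Jacobi identity for the
    modes, starting from brackets with J.  On the tensor product it suffices to
    compare fields on pure tensors, by its universal property. *)

(** * Linear identities in a module *)

(** [D] sees only [g] with its inner product; the polarization enters through the involution [tau]
    by which u = a^i a_i acts on the fermions. Charges are therefore read off monomial by monomial
    from u, not from J. The price is that T and J must have charge 0 under u, so ad alpha and ad
    beta, beta = rho + bar alpha, must commute with [tau]; membership in g_0 provides this. The
    vector beta is forced: it is what cancels the double pole of u.D. Two quantities are never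
    evaluated. The constant in the third order pole of D.D is a trace of the Killing form, whose
    agreement with d would be an identity of strange-formula type; it stays an unknown until
    brackets with J identify it with the level of J.J. The second order pole of Phi.G^+ is written
    down but not simplified; a symmetry of its modes kills it. The charge -2 part of D.D contains
    G^-.G^- and G^+.Phi only in a sum, so F cannot be read off there; Phi.G^+ is the one further
    product computed by hand. *)

Inductive vexp (C : Type) :=
  | VZero | VAtom of nat | VAdd of vexp C & vexp C | VOpp of vexp C
  | VScale of C & vexp C.
Arguments VZero {C}.
Arguments VAtom {C}.

Fixpoint veval (C : fieldType) (V : lmodType C) (env : seq V) (e : vexp C) : V :=
  match e with
  | VZero => 0
  | VAtom i => nth 0 env i
  | VAdd e1 e2 => veval env e1 + veval env e2
  | VOpp e1 => - veval env e1
  | VScale c e1 => c *: veval env e1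
  end.

Fixpoint vcoef (C : fieldType) (e : vexp C) (i : nat) : C :=
  match e with
  | VZero => 0
  | VAtom j => if eqn i j then 1 else 0
  | VAdd e1 e2 => vcoef e1 i + vcoef e2 i
  | VOpp e1 => - vcoef e1 i
  | VScale c e1 => c * vcoef e1 i
  end.

Fixpoint vsame (C : fieldType) (e1 e2 : vexp C) (n : nat) : Prop :=
  if n is n'.+1 then vcoef e1 n' = vcoef e2 n' /\ vsame e1 e2 n' else True.

Lemma veval_coef (C : fieldType) (V : lmodType C) (env : seq V) (e : vexp C) :
  veval env e = \sum_(i < size env) vcoef e i *: env`_i.
Proof.
elim: e => [|j|e1 IH1 e2 IH2|e IH|c e IH] /=.
- by rewrite big1 // => i _; rewrite scale0r.
- have [jlt|jge] := ltnP j (size env); last first.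
    rewrite nth_default // big1 // => i _.
    case: eqnP => [ij|_]; last by rewrite scale0r.
    by move: (ltn_ord i); rewrite ij ltnNge jge.
  rewrite (bigD1 (Ordinal jlt)) //= big1 => [|i ij].
    by case: eqnP => // _; rewrite scale1r addr0.
  case: eqnP => [eij|_]; last by rewrite scale0r.
  by case/eqP: ij; apply/val_inj.
- by rewrite IH1 IH2 -big_split /=; apply: eq_bigr => i _; rewrite scalerDl.
- by rewrite IH -sumrN; apply: eq_bigr => i _; rewrite scaleNr.
- by rewrite IH scaler_sumr; apply: eq_bigr => i _; rewrite scalerA.
Qed.

(** Atoms are treated as if they were independent: one scalar identity per atom is enough for the
    identity of vectors. The reifying tactics below leave exactly these scalar goals to [ring] or
    [field]. *)
Lemma vsameP (C : fieldType) (V : lmodType C) (env : seq V) (e1 e2 : vexp C) :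
  vsame e1 e2 (size env) -> veval env e1 = veval env e2.
Proof.
move=> H; rewrite !veval_coef; apply: eq_bigr => i _; congr (_ *: _).
case: i => i /=; elim: (size env) H => // m IH.
by case=> E H; rewrite ltnS leq_eqVlt => /predU1P[->|/(IH H)].
Qed.

(** Certificate form of a deduction: the coefficients express L - R through the hypotheses, and
    checking them is again a scalar identity per atom. The Jacobi arguments on modes are run this
    way. *)
Lemma linear_comb1 (C : fieldType) (V : lmodType C) (c : C) (l r L R : V) :
  l = r -> L - R = c *: (l - r) -> L = R.
Proof. by move=> ->; rewrite subrr scaler0 => /subr0_eq. Qed.

Lemma linear_comb2 (C : fieldType) (V : lmodType C) (c c' : C)
    (l r l' r' L R : V) :
  l = r -> l' = r' -> L - R = c *: (l - r) + c' *: (l' - r') -> L = R.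
Proof. by move=> -> ->; rewrite !subrr !scaler0 addr0 => /subr0_eq. Qed.

Lemma linear_comb4 (C : fieldType) (V : lmodType C) (c1 c2 c3 c4 : C)
    (l1 l2 l3 l4 k1 k2 k3 k4 L R : V) :
  l1 = k1 -> l2 = k2 -> l3 = k3 -> l4 = k4 ->
  L - R = c1 *: (l1 - k1) + c2 *: (l2 - k2) + c3 *: (l3 - k3) + c4 *: (l4 - k4) ->
  L = R.
Proof. by move=> -> -> -> ->; rewrite !subrr !scaler0 !addr0 => /subr0_eq. Qed.

Ltac vmem t env :=
  lazymatch env with
  | nil => constr:(false)
  | cons t _ => constr:(true)
  | cons _ ?env' => vmem t env'
  end.
Ltac vidx t env :=
  lazymatch env with
  | cons t _ => constr:(0%N)
  | cons _ ?env' => let n := vidx t env' in constr:(S n)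
  end.
Ltac vatoms env t :=
  lazymatch t with
  | GRing.zero => env
  | GRing.add ?a ?b => let env := vatoms env a in vatoms env b
  | GRing.opp ?a => vatoms env a
  | GRing.scale _ ?a => vatoms env a
  | _ => let b := vmem t env in
         lazymatch b with true => env | _ => constr:(cons t env) end
  end.
Ltac vreify C env t :=
  lazymatch t with
  | GRing.zero => constr:(@VZero C)
  | GRing.add ?a ?b => let a := vreify C env a in
      let b := vreify C env b in constr:(@VAdd C a b)
  | GRing.opp ?a => let a := vreify C env a in constr:(@VOpp C a)
  | GRing.scale ?c ?a => let a := vreify C env a in constr:(@VScale C c a)
  | _ => let n := vidx t env in constr:(@VAtom C n)
  end.
Ltac vcoefs C V :=
  lazymatch goal with |- ?l = ?r =>
    let env := vatoms (@nil V) l in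
    let env := vatoms env r in
    let e1 := vreify C env l in
    let e2 := vreify C env r in
    refine (@vsameP C V env e1 e2 _);
    cbn [vsame vcoef size eqn]; repeat split
  end.

(** * Fields and their normally ordered products *)

Section BundledFields.
Context (C : numFieldType) (V : lmodType C).
Implicit Types A B : int -> V -> V.

(** One module holds even and odd fields alike; signs enter later, through a boolean argument of
    each product and bracket. *)
Definition is_vfield : pred (int -> V -> V) :=
  fun A => `[< @is_field C V true A >].

Lemma is_vfieldP A :
  reflect ((forall n, linear (A n)) /\
           (forall v, exists N : nat, forall n : int, N%:Z <= n -> A n v = 0))
          (is_vfield A).
Proof.
apply: (iffP (asboolP _)) => -[Al At]; split=> // v; have [N HN] := At v.
  by exists `|N|%N => n Hn; apply: HN; lia.
by exists N.
Qed.

Fact is_vfield_submod : submod_closed is_vfield.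
Proof.
split=> [|a A B].
  apply/is_vfieldP; split=> [n k u v|v]; first by rewrite scaler0 addr0.
  by exists 0%N.
move=> /is_vfieldP[Al At] /is_vfieldP[Bl Bt]; apply/is_vfieldP.
have E m w : (a *: A + B) m w = a *: A m w + B m w by [].
split=> [n k u v|v].
  rewrite !E (Al n) (Bl n).
  by vcoefs C V; ring.
have [N HN] := At v; have [M HM] := Bt v.
exists (N + M)%N => n Hn.
by rewrite E HN ?HM ?scaler0 ?addr0 //; lia.
Qed.
HB.instance Definition _ :=
  GRing.isSubmodClosed.Build C (int -> V -> V) is_vfield is_vfield_submod.

Record vfield := VField { vmode :> int -> V -> V; vmodeP : is_vfield vmode }.
HB.instance Definition _ := [isSub for vmode].
HB.instance Definition _ := [Choice of vfield by <:].
HB.instance Definition _ := [SubChoice_isSubLmodule of vfield by <:].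

Implicit Types (X Y : vfield) (u v : V) (k : C).

Lemma vfield_eq X Y : (forall n v, X n v = Y n v) -> X = Y.
Proof. by move=> H; apply/val_inj/funext => n; apply/funext => v; apply: H. Qed.

Lemma vmodeD X Y n v : (X + Y) n v = X n v + Y n v. Proof. by []. Qed.
Lemma vmodeN X n v : (- X) n v = - X n v. Proof. by []. Qed.
Lemma vmodeZ a X n v : (a *: X) n v = a *: X n v. Proof. by []. Qed.
Lemma vmode0 n v : (0 : vfield) n v = 0. Proof. by []. Qed.
Lemma vmode_lin X n : linear (X n).
Proof. by have /is_vfieldP[] := vmodeP X. Qed.
HB.instance Definition _ X n :=
  GRing.isLinear.Build C V V _ (X n) (vmode_lin X n).

Lemma vmode_trunc X v :
  exists N : nat, forall n : int, N%:Z <= n -> X n v = 0.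
Proof. by have /is_vfieldP[_] := vmodeP X. Qed.

End BundledFields.

Definition vmodeE := (vmodeD, vmodeN, vmodeZ, vmode0).

(** Modes at indices such as m + k - 1 and m + (k - 1) have to be identified before they can count
    as one atom. *)
Ltac vidx_eq :=
  repeat match goal with
  | |- context [vmode ?A ?i ?v] =>
    match goal with
    | |- context [vmode A ?j v] =>
        tryif constr_eq i j then fail else
        (let H := fresh in
         assert (H : vmode A i v = vmode A j v) by (congr (vmode A _ v); lia);
         rewrite H; clear H)
    end
  end.

(* Same as vcoefs, with atoms compared up to conversion. *)
Ltac uidx t env :=
  lazymatch env with
  | cons ?h ?env' =>
    match constr:(Set) with
    | _ => let _ := match constr:(Set) with _ => unify t h end in constr:(0%N)
    | _ => let n := uidx t env' in constr:(S n)
    end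
  end.
Ltac uatoms env t :=
  lazymatch t with
  | GRing.zero => env
  | GRing.add ?a ?b => let env := uatoms env a in uatoms env b
  | GRing.opp ?a => uatoms env a
  | GRing.scale _ ?a => uatoms env a
  | _ => match constr:(Set) with
         | _ => let _ := uidx t env in env
         | _ => constr:(cons t env)
         end
  end.
Ltac ureify C env t :=
  lazymatch t with
  | GRing.zero => constr:(@VZero C)
  | GRing.add ?a ?b => let a := ureify C env a in
      let b := ureify C env b in constr:(@VAdd C a b)
  | GRing.opp ?a => let a := ureify C env a in constr:(@VOpp C a)
  | GRing.scale ?c ?a => let a := ureify C env a in constr:(@VScale C c a)
  | _ => let n := uidx t env in constr:(@VAtom C n)
  end.
Ltac vmod C :=
  lazymatch goal with |- @eq ?T ?l ?r =>
    let env := uatoms (@nil T) l in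
    let env := uatoms env r in
    let e1 := ureify C env l in
    let e2 := ureify C env r in
    refine (@vsameP C _ env e1 e2 _);
    cbn [vsame vcoef size eqn]; repeat split
  end.

(** * Half sums: the creation and annihilation pieces of a normally ordered product *)

Section HalfSums.
Context (C : numFieldType) (V : lmodType C).
Local Notation vfield := (vfield V).
Implicit Types (A B D : vfield) (v : V).

Lemma fsbig_nat_trunc (F : nat -> V) (M : nat) :
  (forall j, (M <= j)%N -> F j = 0) ->
  \sum_(j \in [set: nat]) F j = \sum_(j < M) F j.
Proof.
move=> H; rewrite (fsbigE (iota 0 M)) ?iota_uniq //.
  by rewrite -(big_mkord xpredT F) /index_iota subn0; apply: eq_bigl => j; rewrite mem_set.
by move=> j _; rewrite mem_iota leq0n add0n -leqNgt; apply: H.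
Qed.

(** Both pieces of a normally ordered product have this shape: [s = 0] gives A_- B and, with the
    fields exchanged, [k = 0] gives B A_+. General [s] and [k] are needed because a commutator with
    a mode displaces both. *)
Definition halfsum A B (s k : int) v : V :=
  \sum_(j \in [set: nat]) A (s - j.+1%:Z) (B (k + j%:Z) v).

(** The bound depends on [v] and on a lower bound for [k], but not on [s]: all half sums of an
    identity can be cut at one common [M] and then compared term by term. *)
Lemma halfsumE A B v (k0 : int) : exists M0 : nat, forall M (s k : int),
  (M0 <= M)%N -> k0 <= k ->
  halfsum A B s k v = \sum_(j < M) A (s - j.+1%:Z) (B (k + j%:Z) v).
Proof.
have [N HN] := vmode_trunc B v.
exists (N + `|k0|)%N => M s k HM Hk; apply: fsbig_nat_trunc => j Hj.
by rewrite HN ?linear0 //; lia.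
Qed.

Lemma halfsum_shift A B (s k : int) v :
  halfsum A B (s + 1) k v = A s (B k v) + halfsum A B s (k + 1) v.
Proof.
have [M0 H] := halfsumE A B v (Num.min k (k + 1)).
rewrite (H M0.+1) ?(H M0) //; try lia.
rewrite big_ord_recl; congr (A _ (B _ v) + _); [by rewrite /=; lia..|].
by apply: eq_bigr => j _; rewrite lift0; congr (A _ (B _ v)); lia.
Qed.

Lemma halfsum0 A B (s k : int) v :
  (forall n, k <= n -> B n v = 0) -> halfsum A B s k v = 0.
Proof. by move=> H; apply: fsbig1 => j _; rewrite H ?linear0 //; lia. Qed.

Lemma halfsum_linear A B (s k : int) : linear (halfsum A B s k).
Proof.
move=> a u v.
have [M1 H1] := halfsumE A B u k; have [M2 H2] := halfsumE A B v k.
have [M3 H3] := halfsumE A B (a *: u + v) k.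
rewrite (H1 (M1 + M2 + M3)%N) ?(H2 (M1 + M2 + M3)%N) ?(H3 (M1 + M2 + M3)%N) //; try lia.
by rewrite scaler_sumr -big_split; apply: eq_bigr => j _; rewrite !linearP.
Qed.

Lemma halfsum_linl a A A' B (s k : int) v :
  halfsum (a *: A + A') B s k v = a *: halfsum A B s k v + halfsum A' B s k v.
Proof.
have [M1 H1] := halfsumE A B v k; have [M2 H2] := halfsumE A' B v k.
have [M3 H3] := halfsumE (a *: A + A') B v k.
rewrite (H1 (M1 + M2 + M3)%N) ?(H2 (M1 + M2 + M3)%N) ?(H3 (M1 + M2 + M3)%N) //; try lia.
by rewrite scaler_sumr -big_split; apply: eq_bigr => j _.
Qed.

Lemma halfsum_linr a A B B' (s k : int) v :
  halfsum A (a *: B + B') s k v = a *: halfsum A B s k v + halfsum A B' s k v.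
Proof.
have [M1 H1] := halfsumE A B v k; have [M2 H2] := halfsumE A B' v k.
have [M3 H3] := halfsumE A (a *: B + B') v k.
rewrite (H1 (M1 + M2 + M3)%N) ?(H2 (M1 + M2 + M3)%N) ?(H3 (M1 + M2 + M3)%N) //; try lia.
by rewrite scaler_sumr -big_split; apply: eq_bigr => j _; rewrite linearP.
Qed.

Definition sg (e : bool) : C := (-1) ^+ e.

Lemma sg_addb e e' : sg (e (+) e') = sg e * sg e'.
Proof. by rewrite /sg signr_addb. Qed.

Lemma nprod_halfsum p q A B n v :
  @nprod C V p q A B n v =
  halfsum A B 0 n v + sg (p && q) *: halfsum B A n 0 v.
Proof.
rewrite /nprod /halfsum; congr (_ + _ *: _).
by apply: eq_fsbigr => j _; rewrite add0r.
Qed.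

Fact nop_subproof e A B : is_vfield (@nprod C V e true A B).
Proof.
apply/is_vfieldP; split=> [n a u v|v].
  rewrite !nprod_halfsum !halfsum_linear.
  by vcoefs C V; ring.
have [M HM] := halfsumE B A v 0.
have [N1 HN1] := vmode_trunc B v.
(* In the second half the vectors A_j v vary with j, but only j < M contribute, so their truncation
   bounds can be added up to a single one. *)
have [N2 HN2] : exists N : nat, forall n : int, N%:Z <= n ->
    forall j, (j < M)%N -> B (n - j.+1%:Z) (A j%:Z v) = 0.
  elim: (M) => [|m [N IH]]; first by exists 0%N.
  have [N' HN'] := vmode_trunc B (A m%:Z v).
  exists (N + N' + m.+1)%N => n Hn j; rewrite ltnS leq_eqVlt => /predU1P[->|Hj].
    by apply: HN'; lia.
  by apply: IH => //; lia.
exists (N1 + N2)%N => n Hn; rewrite nprod_halfsum halfsum0 ?add0r; last first.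
  by move=> k Hk; apply: HN1; lia.
rewrite (HM M) // big1 ?scaler0 // => j _; rewrite add0r.
by apply: HN2 => //; lia.
Qed.

(** Of the two parities only the bit [e], saying whether both factors are odd, enters the sign. *)
Definition nop e A B : vfield := locked (VField (nop_subproof e A B)).

Lemma nopE e A B n v :
  nop e A B n v = halfsum A B 0 n v + sg e *: halfsum B A n 0 v.
Proof. by rewrite /nop -lock /= nprod_halfsum andbT. Qed.

Lemma nprodE p q A B :
  @nprod C V p q A B = nop (p && q) A B :> (int -> V -> V).
Proof.
by apply/funext => n; apply/funext => v; rewrite nopE nprod_halfsum.
Qed.

Lemma nop_linl e B : linear (nop e ^~ B).
Proof.
move=> a A A'; apply: vfield_eq => n v.
rewrite vmodeD vmodeZ !nopE halfsum_linl halfsum_linr.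
by vcoefs C V; ring.
Qed.
Lemma nop_linr e A : linear (nop e A).
Proof.
move=> a B B'; apply: vfield_eq => n v.
rewrite vmodeD vmodeZ !nopE halfsum_linl halfsum_linr.
by vcoefs C V; ring.
Qed.

HB.instance Definition _ e A :=
  GRing.isLinear.Build C vfield vfield *:%R (nop e A) (nop_linr e A).
Lemma nop_is_bilinear e : bilinear_for *:%R *:%R (nop e).
Proof. by split=> A a B B'; [exact: nop_linl|exact: nop_linr]. Qed.
HB.instance Definition _ e :=
  bilinear_isBilinear.Build C vfield vfield vfield *:%R *:%R (nop e)
    (nop_is_bilinear e).

Fact vd_subproof A : is_vfield (fun n v => - n%:~R *: A (n - 1) v).
Proof.
apply/is_vfieldP; split=> [n a u v|v].
  by rewrite vmode_lin; vcoefs C V; ring.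
have [N HN] := vmode_trunc A v; exists N.+1 => n Hn.
by rewrite HN ?scaler0 //; lia.
Qed.
Definition vd A : vfield := locked (VField (vd_subproof A)).
Lemma vdE A n v : vd A n v = - n%:~R *: A (n - 1) v.
Proof. by rewrite /vd -lock. Qed.

Lemma vd_lin : linear vd.
Proof.
move=> a A B; apply: vfield_eq => n v; rewrite vmodeD vmodeZ !vdE vmodeD vmodeZ.
by vcoefs C V; ring.
Qed.
HB.instance Definition _ := GRing.isLinear.Build C vfield vfield *:%R vd vd_lin.

Fact vone_subproof : is_vfield (@one_field C V).
Proof.
rewrite /one_field; apply/is_vfieldP; split=> [n a u v|v].
  by case: eqP => //; rewrite scaler0 addr0.
by exists 0%N => n Hn; case: eqP => // E; lia.
Qed.
Definition vone : vfield := locked (VField vone_subproof).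
Lemma voneE n v : vone n v = if n == -1 then v else 0.
Proof. by rewrite /vone -lock. Qed.

End HalfSums.
Arguments vone {C V}.
Arguments sg {C}.
Arguments nopE {C V}.

(** * Commutation relations of fields *)

Section Brackets.
Context (C : numFieldType) (V : lmodType C).
Local Notation vfield := (vfield V).
Local Notation sg := (@sg C).
Implicit Types (A B D c d : vfield) (v w : V) (m k s : int) (e : bool).

Lemma vlinD A k v w : A k (v + w) = A k v + A k w.
Proof. by rewrite -[v in LHS]scale1r vmode_lin scale1r. Qed.
Lemma vlin0 A k : A k 0 = 0.
Proof. exact: linear0. Qed.
Lemma vlinZ A k a v : A k (a *: v) = a *: A k v.
Proof. by rewrite -[a *: v]addr0 vmode_lin vlin0 addr0. Qed.
Lemma vlinN A k v : A k (- v) = - A k v.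
Proof. by rewrite -scaleN1r vlinZ scaleN1r. Qed.
Definition vlinE := (vlinD, vlinZ, vlinN, vlin0).
Lemma vlin_sum A k (I : Type) (r : seq I) (P : pred I) (F : I -> V) :
  A k (\sum_(i <- r | P i) F i) = \sum_(i <- r | P i) A k (F i).
Proof. exact: linear_sum. Qed.

(* A(z).B(w) ~ c0(w)/(z-w) + c1(w)/(z-w)^2 + c2(w)/(z-w)^3, where e says whether
   A and B are both odd. *)
Definition br3 e A B c0 c1 c2 : Prop := forall m k v,
  A m (B k v) - sg e *: B k (A m v) =
  c0 (m + k) v + m%:~R *: c1 (m + k - 1) v
  + (m%:~R * (m%:~R - 1) / 2) *: c2 (m + k - 2) v.

Lemma br3_eq e A B c0 c1 c2 d0 d1 d2 : br3 e A B c0 c1 c2 ->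
  c0 = d0 -> c1 = d1 -> c2 = d2 -> br3 e A B d0 d1 d2.
Proof. by move=> H <- <- <-. Qed.

Lemma br3_linl e a A A' B c0 c1 c2 d0 d1 d2 :
  br3 e A B c0 c1 c2 -> br3 e A' B d0 d1 d2 ->
  br3 e (a *: A + A') B (a *: c0 + d0) (a *: c1 + d1) (a *: c2 + d2).
Proof.
move=> H H' m k v; rewrite !vmodeE !vlinE.
apply: (linear_comb2 (c := a) (c' := 1) (H m k v) (H' m k v)).
by vcoefs C V; ring.
Qed.

Lemma br3_linr e a A B B' c0 c1 c2 d0 d1 d2 :
  br3 e A B c0 c1 c2 -> br3 e A B' d0 d1 d2 ->
  br3 e A (a *: B + B') (a *: c0 + d0) (a *: c1 + d1) (a *: c2 + d2).
Proof.
move=> H H' m k v; rewrite !vmodeE !vlinE.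
apply: (linear_comb2 (c := a) (c' := 1) (H m k v) (H' m k v)).
by vcoefs C V; ring.
Qed.

Lemma br30l e B : br3 e 0 B 0 0 0.
Proof. by move=> m k v; rewrite !vmodeE !vlinE; vcoefs C V; ring. Qed.
Lemma br30r e A : br3 e A 0 0 0 0.
Proof. by move=> m k v; rewrite !vmodeE !vlinE; vcoefs C V; ring. Qed.

Lemma br3_Dl e A A' B c0 c1 c2 d0 d1 d2 :
  br3 e A B c0 c1 c2 -> br3 e A' B d0 d1 d2 ->
  br3 e (A + A') B (c0 + d0) (c1 + d1) (c2 + d2).
Proof. by move=> H H'; have := br3_linl 1 H H'; rewrite !scale1r. Qed.
Lemma br3_Dr e A B B' c0 c1 c2 d0 d1 d2 :
  br3 e A B c0 c1 c2 -> br3 e A B' d0 d1 d2 ->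
  br3 e A (B + B') (c0 + d0) (c1 + d1) (c2 + d2).
Proof. by move=> H H'; have := br3_linr 1 H H'; rewrite !scale1r. Qed.
Lemma br3_Zl e a A B c0 c1 c2 :
  br3 e A B c0 c1 c2 -> br3 e (a *: A) B (a *: c0) (a *: c1) (a *: c2).
Proof. by move=> H; have := br3_linl a H (br30l e B); rewrite !addr0. Qed.
Lemma br3_Zr e a A B c0 c1 c2 :
  br3 e A B c0 c1 c2 -> br3 e A (a *: B) (a *: c0) (a *: c1) (a *: c2).
Proof. by move=> H; have := br3_linr a H (br30r e A); rewrite !addr0. Qed.
Lemma br3_Nr e A B c0 c1 c2 :
  br3 e A B c0 c1 c2 -> br3 e A (- B) (- c0) (- c1) (- c2).
Proof. by move=> /(br3_Zr (-1)); rewrite !scaleN1r. Qed.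

Lemma br3_sumr e A (I : finType) (B c0 c1 c2 : I -> vfield) :
  (forall i, br3 e A (B i) (c0 i) (c1 i) (c2 i)) ->
  br3 e A (\sum_i B i) (\sum_i c0 i) (\sum_i c1 i) (\sum_i c2 i).
Proof.
move=> H; elim: (index_enum I) => [|i r IH].
  by rewrite !big_nil; apply: br30r.
by rewrite !big_cons; apply: br3_Dr.
Qed.

Lemma br3_suml e B (I : finType) (A c0 c1 c2 : I -> vfield) :
  (forall i, br3 e (A i) B (c0 i) (c1 i) (c2 i)) ->
  br3 e (\sum_i A i) B (\sum_i c0 i) (\sum_i c1 i) (\sum_i c2 i).
Proof.
move=> H; elim: (index_enum I) => [|i r IH].
  by rewrite !big_nil; apply: br30l.
by rewrite !big_cons; apply: br3_Dl.
Qed.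

Lemma sg_sqr e : sg e * sg e = 1.
Proof. by rewrite /sg -expr2 sqrr_sign. Qed.

(** Exchanging z and w re-expands the poles at the other point, whence the Taylor corrections in
    [vd]. On modes it is the substitution k = (m + k) - m in the coefficients. *)
Lemma br3_skew e A B c0 c1 c2 : br3 e A B c0 c1 c2 ->
  br3 e B A (- sg e *: (c0 - vd c1 + 2^-1 *: vd (vd c2)))
            (sg e *: (c1 - vd c2)) (- sg e *: c2).
Proof.
move=> H m k v; rewrite ?(vmodeE, vdE).
have {H} := H k m v.
have -> : B m (A k v) - sg e *: A k (B m v)
  = - sg e *: (A k (B m v) - sg e *: B m (A k v)).
  rewrite scalerBr scalerA mulNr sg_sqr.
  by vcoefs C V; ring.
move=> ->.
by vidx_eq; vcoefs C V; field.
Qed.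

(** A derivative raises the order of a pole by one; the hypothesis stops at order two so that the
    conclusion stays within [br3]. *)
Lemma br3_dl e A B c0 c1 : br3 e A B c0 c1 0 ->
  br3 e (vd A) B 0 (- c0) (- 2 *: c1).
Proof.
move=> H m k v; rewrite ?(vmodeE, vdE, vlinE).
apply: (linear_comb1 (c := - m%:~R) (H (m - 1) k v)); rewrite !vmodeE.
by vidx_eq; vcoefs C V; field.
Qed.

Lemma br3_dr e A B c0 c1 : br3 e A B c0 c1 0 ->
  br3 e A (vd B) (vd c0) (vd c1 + c0) (2 *: c1).
Proof.
move=> H m k v; rewrite ?(vmodeE, vdE, vlinE).
apply: (linear_comb1 (c := - k%:~R) (H m (k - 1) v)); rewrite !vmodeE.
by vidx_eq; vcoefs C V; field.
Qed.

(** The left side is the normally ordered product with the cut between creation and annihilation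
    modes of [A] placed at [s] instead of 0. Moving the cut past the mode A_r costs the commutator
    [A_r, B_q]; summing over 0 <= r < s gives the coefficients s and s(s-1)/2. Negative [s] is
    reached by running the recursion backwards. *)
Lemma nsh e A B c0 c1 (s k : int) v : br3 e A B c0 c1 0 ->
  halfsum A B s k v + sg e *: halfsum B A k s v =
  nop e A B (s + k) v + s%:~R *: c0 (s + k - 1) v
  + (s%:~R * (s%:~R - 1) / 2) *: c1 (s + k - 2) v.
Proof.
move=> H; pose P (s : int) := forall k : int,
  halfsum A B s k v + sg e *: halfsum B A k s v =
  nop e A B (s + k) v + s%:~R *: c0 (s + k - 1) v
  + (s%:~R * (s%:~R - 1) / 2) *: c1 (s + k - 2) v.
suff: P s by [].
have E (r q : int) : halfsum A B (r + 1) q v + sg e *: halfsum B A q (r + 1) v =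
    halfsum A B r (q + 1) v + sg e *: halfsum B A (q + 1) r v +
    (c0 (r + q) v + r%:~R *: c1 (r + q - 1) v).
  rewrite (halfsum_shift A B r q) (halfsum_shift B A q r).
  apply: (linear_comb1 (c := 1) (H r q v)); rewrite !vmodeE.
  by vcoefs C V; field.
have Pup (r : int) : P r -> P (r + 1).
  move=> IH q; rewrite E IH.
  by vidx_eq; vcoefs C V; field.
have Pdown (r : int) : P (r + 1) -> P r.
  move=> IH q.
  apply: (linear_comb2 (c := 1) (c' := -1) (IH (q - 1)) (E r (q - 1))).
  rewrite subrK.
  by vidx_eq; vcoefs C V; field.
elim/int_rect: s => [|n IH|n IH].
- by move=> q; rewrite nopE add0r; vcoefs C V; field.
- by have := Pup _ IH; congr P; lia.
- by apply: Pdown; move: IH; congr P; lia.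
Qed.

(** Leibniz rule, applied to each term of the truncated sums. The poles of A.B displace the cut from
    [s] to [m + s] and below; [nsh] repairs this afterwards. *)
Lemma halfsum_bracket eb ed A B D c0 c1 c2 d0 d1 d2 m s k v :
  br3 eb A B c0 c1 c2 -> br3 ed A D d0 d1 d2 ->
  A m (halfsum B D s k v) - (sg eb * sg ed) *: halfsum B D s k (A m v) =
  halfsum c0 D (m + s) k v + m%:~R *: halfsum c1 D (m + s - 1) k v
  + (m%:~R * (m%:~R - 1) / 2) *: halfsum c2 D (m + s - 2) k v
  + sg eb *: (halfsum B d0 s (m + k) v + m%:~R *: halfsum B d1 s (m + k - 1) v
  + (m%:~R * (m%:~R - 1) / 2) *: halfsum B d2 s (m + k - 2) v).
Proof.
move=> HB HD.
have [M1 H1] := halfsumE B D v k; have [M2 H2] := halfsumE B D (A m v) k.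
have [M3 H3] := halfsumE c0 D v k; have [M4 H4] := halfsumE c1 D v k.
have [M5 H5] := halfsumE c2 D v k; have [M6 H6] := halfsumE B d0 v (m + k - 2).
have [M7 H7] := halfsumE B d1 v (m + k - 2).
have [M8 H8] := halfsumE B d2 v (m + k - 2).
pose M := (M1 + M2 + M3 + M4 + M5 + M6 + M7 + M8)%N.
rewrite (H1 M) ?(H2 M) ?(H3 M) ?(H4 M) ?(H5 M) ?(H6 M) ?(H7 M) ?(H8 M);
  rewrite ?{}/M; try lia.
rewrite vlin_sum !scaler_sumr -sumrN -!big_split /= scaler_sumr -big_split /=.
apply: eq_bigr => j _.
have E1 := HB m (s - j.+1%:Z) (D (k + j%:Z) v).
have E2 := congr1 (B (s - j.+1%:Z)) (HD m (k + j%:Z) v).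
rewrite !vlinE in E2.
apply: (linear_comb2 (c := 1) (c' := sg eb) E1 E2).
by vidx_eq; vcoefs C V; field.
Qed.

End Brackets.

(** * The Wick formula, quasi-commutativity and nested products *)

Section Wick.
Context (C : numFieldType) (V : lmodType C).
Local Notation vfield := (vfield V).
Local Notation sg := (@sg C).
Implicit Types (A B D c d : vfield) (v w : V) (m k s : int) (e : bool).

Ltac hidx_eq :=
  repeat match goal with
  | |- context [halfsum ?A ?B ?i ?k ?v] =>
    match goal with
    | |- context [halfsum A B ?j ?l v] =>
        tryif (constr_eq i j; constr_eq k l) then fail else
        (let H := fresh in
         assert (H : halfsum A B i k v = halfsum A B j l v)
           by (congr (halfsum A B _ _ v); lia);
         rewrite H; clear H)
    end
  end.

Lemma sg_pm e : sg e = 1 \/ sg e = -1.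
Proof. by case: e; [right|left]. Qed.

Lemma halfsum0l B s k v : halfsum 0 B s k v = 0.
Proof. exact: fsbig1. Qed.
Lemma halfsum0r A s k v : halfsum A 0 s k v = 0.
Proof. by apply: fsbig1 => j _; rewrite linear0. Qed.

(** The terms [f0], [f1] and [2 *: h0] are the double contractions. They appear because the half
    sums with [c0] and [c1] come out of the Leibniz rule cut at m and m - 1; moving these cuts back
    to 0 by [nsh] produces the poles of c0.D and c1.D. The bounds on these poles keep the result at
    order three. *)
Lemma wick eab ead ebd A B D c0 c1 d0 d1 d2 f0 f1 h0 :
  br3 eab A B c0 c1 0 -> br3 ead A D d0 d1 d2 ->
  br3 (ead (+) ebd) c0 D f0 f1 0 -> br3 (ead (+) ebd) c1 D h0 0 0 ->
  br3 (eab (+) ead) A (nop ebd B D)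
    (nop (ead (+) ebd) c0 D + sg eab *: nop (eab (+) ebd) B d0)
    (nop (ead (+) ebd) c1 D + sg eab *: nop (eab (+) ebd) B d1 + f0)
    (sg eab *: nop (eab (+) ebd) B d2 + f1 + 2 *: h0).
Proof.
move=> HB HD Hc0 Hc1 m k v.
rewrite !vmodeE !(nopE ebd) !(nopE (_ (+) _) B) !sg_addb vlinD vlinZ.
have E1 := halfsum_bracket m 0 k v HB HD.
have E2 := halfsum_bracket m k 0 v HD HB.
have N0 := nsh m k v Hc0.
have N1 := nsh (m - 1) k v Hc1.
rewrite !sg_addb in N0 N1.
have E3 := esym (congr2 (fun x y => x + m%:~R *: y) N0 N1); cbv beta in E3.
have E4 := congr2 (fun x y => x + sg ebd *: y) E1 E2; cbv beta in E4.
apply: (linear_comb2 (c := 1) (c' := -1) E4 E3).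
rewrite ?(halfsum0l, halfsum0r, vmode0) !(add0r, addr0).
by vidx_eq; hidx_eq; case: (sg_pm eab) => ->; vcoefs C V; field.
Qed.

(** With the cut at [s = n] and [k = 0] the two half sums of [nsh] form the product in the opposite
    order, so the correction terms of [nsh] are the failure of commutativity. *)
Lemma nop_comm e A B c0 c1 : br3 e A B c0 c1 0 ->
  nop e A B = sg e *: nop e B A + vd c0 - 2^-1 *: vd (vd c1).
Proof.
move=> H; apply: vfield_eq => n v.
have := nsh n 0 v H; rewrite ?(vmodeE, vdE) nopE (nopE e B) addr0 => E.
apply: (linear_comb1 (c := -1) E); rewrite (nopE e A).
by vidx_eq; case: (sg_pm e) => ->; vcoefs C V; field.
Qed.

Lemma halfsumE_uniform A B (w : nat -> V) (k0 : nat -> int) (m : nat) :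
  exists M0 : nat, forall (i M : nat) (s k : int),
  (i < m)%N -> (M0 <= M)%N -> k0 i <= k ->
  halfsum A B s k (w i) = \sum_(j < M) A (s - j.+1%:Z) (B (k + j%:Z) (w i)).
Proof.
elim: m => [|m [N IH]]; first by exists 0%N.
have [N' H'] := halfsumE A B (w m) (k0 m); exists (N + N')%N => i M s k.
rewrite ltnS leq_eqVlt => /predU1P[->|im] NM; first by apply: H'; lia.
by apply: IH => //; lia.
Qed.

(** Each of the two normal orderings puts one factor on the left or on the right, hence four terms
    for each pair (i, j). A square range is chosen so that A(BD) and B(AD) can be compared after
    transposing i and j. *)
Lemma nop_nop_trunc e1 e2 A B D n v : exists M0 : nat, forall M,
  (M0 <= M)%N -> nop e1 A (nop e2 B D) n v =
  \sum_(i < M) \sum_(j < M)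
    (A (- i.+1%:Z) (B (- j.+1%:Z) (D (n + (i + j)%N%:Z) v))
     + sg e2 *: A (- i.+1%:Z) (D (n + i%:Z - j.+1%:Z) (B j%:Z v))
     + sg e1 *: (B (- j.+1%:Z) (D (n - i.+1%:Z + j%:Z) (A i%:Z v))
       + sg e2 *: D (n - (i + j).+2%:Z) (B j%:Z (A i%:Z v)))).
Proof.
have [MA HA] := vmode_trunc A v.
have [M1 H1] := halfsumE A (nop e2 B D) v n.
have [M2 H2] := halfsumE B D v n.
have [M3 H3] := halfsumE D B v 0.
have [M4 H4] := halfsumE (nop e2 B D) A v 0.
have [M5 H5] := halfsumE_uniform B D (fun i : nat => A i%:Z v)
  (fun i => n - i.+1%:Z) MA.
have [M6 H6] := halfsumE_uniform D B (fun i : nat => A i%:Z v) (fun=> 0) MA.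
exists (M1 + M2 + M3 + M4 + M5 + M6)%N => M HM.
rewrite nopE (H1 M) ?(H4 M) //; try lia.
rewrite scaler_sumr -big_split /=; apply: eq_bigr => i _.
rewrite !nopE (H2 M) ?(H3 M) //; try lia.
have -> : halfsum B D 0 (n - i.+1%:Z) (A (0 + i%:Z) v)
  + sg e2 *: halfsum D B (n - i.+1%:Z) 0 (A (0 + i%:Z) v) =
  \sum_(j < M) (B (- j.+1%:Z) (D (n - i.+1%:Z + j%:Z) (A i%:Z v))
       + sg e2 *: D (n - (i + j).+2%:Z) (B j%:Z (A i%:Z v))).
  (* Beyond [MA] the vectors A_i v vanish, so a truncation bound uniform over finitely many of them
     suffices. *)
  rewrite add0r; have [Hi|Hi] := ltnP i MA; last first.
    rewrite HA; last lia.
    rewrite !(halfsum0 _ _ (v := 0)); try by move=> *; rewrite vlin0.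
    by rewrite scaler0 addr0 big1 // => j _; rewrite !vlin0 scaler0 addr0.
  rewrite (H5 _ M) ?(H6 _ M) //; try lia.
  rewrite scaler_sumr -big_split /=; apply: eq_bigr => j _.
  by rewrite !add0r; vidx_eq.
rewrite vlinD vlinZ !vlin_sum !scaler_sumr -!big_split /=; apply: eq_bigr => j _.
by rewrite !add0r; vidx_eq.
Qed.

End Wick.

Section NormalOrder.
Context (C : numFieldType) (V : lmodType C).
Local Notation vfield := (vfield V).
Local Notation sg := (@sg C).
Implicit Types (A B D c d : vfield) (v w : V) (m k : int) (e : bool).

(** There are s + 1 pairs with i + j = s, and the vanishing of [F] from [M] on lets the square
    replace the triangle. The factor s + 1 is the one that a derivative puts in front of a mode. *)
Lemma sum_antidiagonal (F : nat -> V) (M : nat) :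
  (forall s : nat, (M <= s)%N -> F s = 0) ->
  \sum_(i < M) \sum_(j < M) F (i + j)%N = \sum_(s < M) s.+1%:R *: F s.
Proof.
move=> F0.
have E (i : 'I_M) : \sum_(j < M) F (i + j)%N = \sum_(s < M | (i <= s)%N) F s.
  rewrite -(big_mkord xpredT (fun j => F (i + j)%N)).
  rewrite -(big_mkord (fun s : nat => i <= s)%N F).
  rewrite [RHS](big_cat_nat _ (n := i)) //=; last exact: ltnW.
  rewrite [X in _ = X + _]big_nat_cond [X in _ = X + _]big1 ?add0r; last first.
    by move=> s /andP[/andP[_ si] is_]; move: (leq_ltn_trans is_ si); rewrite ltnn.
  rewrite [RHS]big_nat_cond [RHS](eq_bigl (fun s => i <= s < M)%N); last by move=> s /=; lia.
  rewrite -[RHS]big_nat.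
  have iM := ltn_ord i.
  rewrite [LHS](big_cat_nat _ (n := (M - i)%N)) //=; last lia.
  rewrite [X in _ + X]big_nat_cond [X in _ + X]big1 ?addr0; last first.
    by move=> s Hs; apply: F0; lia.
  rewrite -[in RHS](add0n (i : nat)) big_addn; apply: eq_bigr => s _.
  by rewrite addnC.
rewrite (eq_bigr _ (fun i _ => E i)) (exchange_big_dep xpredT) //=.
apply: eq_bigr => s _; rewrite sumr_const scaler_nat; congr (_ *+ _).
rewrite -sum1_card -(big_mkord (fun i : nat => i <= s)%N (fun _ => 1%N)).
have sM := ltn_ord s.
transitivity (\sum_(0 <= i < s.+1) 1)%N; last first.
  by rewrite sum_nat_const_nat subn0 muln1.
by rewrite [RHS](big_nat_widen _ _ M).
Qed.

(* The difference of the two sides is the sum of the [A_(-i-1), B_(-j-1)] D_(n+i+j)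
   and of the D_(n-i-j-2) [B_j, A_i]; grouping by i + j gives the derivative. *)
Lemma nop_swap eab ead ebd A B D c0 : br3 eab A B c0 0 0 ->
  nop (eab (+) ead) A (nop ebd B D) =
  sg eab *: nop (eab (+) ebd) B (nop ead A D) + nop (ead (+) ebd) (vd c0) D.
Proof.
move=> H; apply: vfield_eq => n v.
have [M1 H1] := nop_nop_trunc (eab (+) ead) ebd A B D n v.
have [M2 H2] := nop_nop_trunc (eab (+) ebd) ead B A D n v.
have [M3 H3] := halfsumE (vd c0) D v n.
have [M4 H4] := halfsumE D (vd c0) v 0.
have [M5 H5] := vmode_trunc D v.
have [M6 H6] := vmode_trunc c0 v.
pose M := (M1 + M2 + M3 + M4 + M5 + M6 + `|n|)%N.
(* The mode 0 of a derivative is zero. Cutting the second half sum at M + 1 and dropping its first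
   term lines it up with the first one. *)
rewrite vmodeD vmodeZ (H1 M) ?(H2 M) ?nopE ?(H3 M) ?(H4 M.+1); rewrite ?/M; try lia.
rewrite -/M exchange_big /=.
pose F (s : nat) := c0 (- s.+2%:Z) (D (n + s%:Z) v)
  - (sg ead * sg ebd) *: D (n - s.+2%:Z) (c0 s%:Z v).
have F0 (s : nat) : (M <= s)%N -> F s = 0.
  by rewrite /M => Ms; rewrite /F H5 ?H6 ?vlin0 ?scaler0 ?subr0 //; lia.
have -> : \sum_(j < M) vd c0 (0 - j.+1%:Z) (D (n + j%:Z) v)
  + sg (ead (+) ebd) *: \sum_(j < M.+1) D (n - j.+1%:Z) (vd c0 (0 + j%:Z) v) =
  \sum_(s < M) s.+1%:R *: F s.
  rewrite big_ord_recl vdE scaleNr scale0r oppr0 vlin0 add0r scaler_sumr.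
  under [X in _ + X]eq_bigr do rewrite lift0.
  rewrite -big_split; apply: eq_bigr => j _; rewrite sg_addb /F /= !vdE vlinZ.
  have -> : - (0 - j.+1%:Z)%:~R = j.+1%:R :> C by rewrite sub0r mulrNz opprK.
  have -> : - (0 + j.+1%:Z)%:~R = - j.+1%:R :> C by rewrite add0r.
  have -> : 0 - j.+1%:Z - 1 = - j.+2%:Z by lia.
  have -> : 0 + j.+1%:Z - 1 = j%:Z by lia.
  by vcoefs C V; ring.
rewrite -(sum_antidiagonal F0) scaler_sumr -big_split /=.
apply: eq_bigr => i _; rewrite scaler_sumr -big_split /=; apply: eq_bigr => j _.
have E1 := H (- j.+1%:Z) (- i.+1%:Z) (D (n + (i + j)%N%:Z) v).
have E2 := congr1 (D (n - (i + j).+2%:Z)) (H j%:Z i%:Z v).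
rewrite ?(vmodeE, vlinE) in E1 E2.
apply: (linear_comb2 (c := 1) (c' := - (sg ead * sg ebd)) E1 E2).
rewrite /F !sg_addb; vidx_eq.
by case: (sg_pm C eab) => ->; vcoefs C V; field.
Qed.

Lemma vd_nop e A B : vd (nop e A B) = nop e (vd A) B + nop e A (vd B).
Proof.
have E1 X Y k v : - k%:~R *: halfsum X Y 0 (k - 1) v =
    halfsum (vd X) Y 0 k v + halfsum X (vd Y) 0 k v.
  have [M1 H1] := halfsumE X Y v (k - 1).
  have [M2 H2] := halfsumE (vd X) Y v k.
  have [M3 H3] := halfsumE X (vd Y) v k.
  pose M := (M1 + M2 + M3)%N.
  (* Since (vd X)_(-j-1) = (j+1) X_(-j-2), the sum with the derivative on X is displaced by one
     place, whence the cuts M and M + 1. *)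
  rewrite (H1 M.+1) ?(H2 M) ?(H3 M.+1); rewrite ?/M; try lia.
  rewrite -/M !big_ord_recl; under eq_bigr do rewrite lift0.
  under [X in _ = _ + (_ + X)]eq_bigr do rewrite lift0.
  rewrite scalerDr scaler_sumr addrCA -big_split !(vdE, vlinZ) /=.
  rewrite !addr0; congr (_ + _); apply: eq_bigr => j _; rewrite !(vdE, vlinZ).
  by vidx_eq; vcoefs C V; ring.
have E2 X Y (s : int) v : - s%:~R *: halfsum X Y (s - 1) 0 v =
    halfsum (vd X) Y s 0 v + halfsum X (vd Y) s 0 v.
  have [M1 H1] := halfsumE X Y v 0.
  have [M2 H2] := halfsumE (vd X) Y v 0.
  have [M3 H3] := halfsumE X (vd Y) v 0.
  pose M := (M1 + M2 + M3)%N.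
  rewrite (H1 M) ?(H2 M) ?(H3 M.+1); rewrite ?/M; try lia.
  rewrite -/M big_ord_recl; under [X in _ = _ + (_ + X)]eq_bigr do rewrite lift0.
  rewrite vdE [- (0 + _)%:~R]oppr0 scale0r vlin0 add0r -big_split /= scaler_sumr.
  apply: eq_bigr => j _; rewrite !(vdE, vlinZ).
  by vidx_eq; vcoefs C V; ring.
apply: vfield_eq => n v; rewrite vmodeD vdE !nopE scalerDr E1 scalerA mulrC -scalerA E2.
by vcoefs C V; ring.
Qed.

Lemma nop1l e B : nop e vone B = B.
Proof.
apply: vfield_eq => n v; rewrite nopE.
have [M1 H1] := halfsumE vone B v n.
have [M2 H2] := halfsumE B vone v 0.
rewrite (H1 M1.+1) ?(H2 M2) //.
rewrite [X in _ *: X]big1 ?scaler0 ?addr0 => [|j _]; last first.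
  by rewrite voneE; case: eqP => [|_]; [lia|rewrite vlin0].
rewrite big_ord_recl big1 ?addr0 => [|j _].
  by rewrite voneE; case: eqP => // _; congr (B _ v); rewrite addr0.
by rewrite voneE lift0; case: eqP => // E; lia.
Qed.

Lemma vd1 : vd vone = 0 :> vfield.
Proof.
apply: vfield_eq => n v; rewrite vdE voneE.
by case: eqP => [E|_]; rewrite ?scaler0 // (_ : n = 0) ?oppr0 ?scale0r //; lia.
Qed.

Lemma br31r A : br3 false A vone 0 0 0.
Proof.
move=> m k v; rewrite !voneE ?vmodeE.
by case: eqP => _; rewrite ?vlin0; vcoefs C V; rewrite /sg /=; ring.
Qed.
Lemma br31l A : br3 false vone A 0 0 0.
Proof.
move=> m k v; rewrite !voneE ?vmodeE.
by case: eqP => _; rewrite ?vlin0; vcoefs C V; rewrite /sg /=; ring.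
Qed.

Lemma nop1r A : nop false A vone = A.
Proof.
by rewrite (nop_comm (br31r A)) nop1l !linear0 !addr0 /sg scale1r.
Qed.

(** Only the zero mode of [A] is involved. It acts on normally ordered products as a derivation
    without Wick corrections and commutes with [vd], so charges of composite fields simply add
    up. *)
Definition charge A (q : C) B :=
  forall k v, A 0 (B k v) - B k (A 0 v) = q *: B k v.

Lemma charge_br3 A B c0 c1 c2 q : br3 false A B c0 c1 c2 -> c0 = q *: B ->
  charge A q B.
Proof.
move=> H E k v; have := H 0 k v; rewrite E /sg scale1r => ->.
by rewrite add0r vmodeE; vcoefs C V; ring.
Qed.

Lemma charge_lin A q a B B' : charge A q B -> charge A q B' ->
  charge A q (a *: B + B').
Proof.
move=> H H' k v; rewrite ?vmodeE ?vlinE.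
apply: (linear_comb2 (c := a) (c' := 1) (H k v) (H' k v)).
by vcoefs C V; ring.
Qed.
Lemma charge0 A q : charge A q 0.
Proof. by move=> k v; rewrite !vmodeE vlin0 subrr scaler0. Qed.
Lemma chargeZ A q a B : charge A q B -> charge A q (a *: B).
Proof. by move=> H; rewrite -[_ *: _]addr0; apply: charge_lin (charge0 _ _). Qed.
Lemma chargeD A q B B' : charge A q B -> charge A q B' -> charge A q (B + B').
Proof. by move=> H H'; rewrite -[B]scale1r; apply: charge_lin. Qed.
Lemma charge_sum A q (I : finType) (B : I -> vfield) :
  (forall i, charge A q (B i)) -> charge A q (\sum_i B i).
Proof.
move=> H; elim/big_ind: _ => [|? ? ? ?|//]; [exact: charge0|exact: chargeD].
Qed.
Lemma charge_vd A q B : charge A q B -> charge A q (vd B).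
Proof.
move=> H k v; rewrite !vdE vlinE.
apply: (linear_comb1 (c := - k%:~R) (H (k - 1) v)).
by vcoefs C V; ring.
Qed.

Lemma charge_nop e A q q' B B' : charge A q B -> charge A q' B' ->
  charge A (q + q') (nop e B B').
Proof.
have E X Y r r' (s k : int) v : charge A r X -> charge A r' Y ->
  A 0 (halfsum X Y s k v) - halfsum X Y s k (A 0 v) = (r + r') *: halfsum X Y s k v.
  move=> HX HY.
  have [M1 H1] := halfsumE X Y v k.
  have [M2 H2] := halfsumE X Y (A 0 v) k.
  rewrite (H1 (M1 + M2)%N) ?(H2 (M1 + M2)%N) //; try lia.
  rewrite vlin_sum -sumrB scaler_sumr; apply: eq_bigr => j _.
  have E1 := HX (s - j.+1%:Z) (Y (k + j%:Z) v).
  have E2 := congr1 (X (s - j.+1%:Z)) (HY (k + j%:Z) v).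
  rewrite ?vlinE in E2.
  by apply: (linear_comb2 (c := 1) (c' := 1) E1 E2); vcoefs C V; ring.
move=> H H' k v; rewrite !nopE ?vlinE.
apply: (linear_comb2 (c := 1) (c' := sg e) (E _ _ _ _ 0 k v H H')
  (E _ _ _ _ k 0 v H' H)).
by vcoefs C V; ring.
Qed.

End NormalOrder.

(** * The N = 3/2 relations from the supercurrent D = G^+ + G^- + Phi *)

Section OpeBracket.
Context (C : numFieldType) (V : lmodType C).
Local Notation vfield := (vfield V).

Lemma vmode_is_field p (A : vfield) : @is_field C V p (vmode A).
Proof. exact: (asboolW (vmodeP A)). Qed.

Lemma binz0 m : binz m 0 = 1 :> C.
Proof. by rewrite /binz big_ord0 fact0 divr1. Qed.
Lemma binz1 m : binz m 1 = m%:~R :> C.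
Proof. by rewrite /binz big_ord1 subr0 divr1. Qed.
Lemma binz2 m : binz m 2 = m%:~R * (m%:~R - 1) / 2 :> C.
Proof. by rewrite /binz !big_ord_recr big_ord0 /= mul1r subr0 intrB. Qed.
Lemma binz3 m : binz m 3 = m%:~R * (m%:~R - 1) * (m%:~R - 2) / 6 :> C.
Proof. by rewrite /binz !big_ord_recr big_ord0 /= mul1r subr0 !intrB. Qed.

Lemma ope_br3 p q (A B c0 c1 c2 : vfield) (cs : seq (field V (p (+) q))) :
  br3 (p && q) A B c0 c1 c2 -> (size cs <= 3)%N ->
  cs`_0 = vmode c0 -> cs`_1 = vmode c1 -> cs`_2 = vmode c2 ->
  @ope C V p q (vmode A) (vmode B) cs.
Proof.
move=> H sz H0 H1 H2; split; try exact: vmode_is_field.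
  move=> [|[|[|j]]]; rewrite ?H0 ?H1 ?H2; try exact: vmode_is_field.
  rewrite nth_default; last exact: leq_trans sz _.
  exact: (vmode_is_field (p (+) q) 0).
move=> m k v; rewrite [LHS]H.
have -> : \sum_(j < size cs) binz m j *: cs`_j (m + k - j%:Z) v =
  \sum_(j < 3) binz m j *: cs`_j (m + k - j%:Z) v.
  rewrite (big_ord_widen 3 (fun j => binz m j *: cs`_j (m + k - j%:Z) v)) //.
  rewrite big_mkcond; apply: eq_bigr => j _; case: ltnP => // sj.
  by rewrite nth_default // scaler0.
rewrite !big_ord_recr big_ord0 /= H0 H1 H2 binz0 binz1 binz2 subr0.
by vidx_eq; vcoefs C V; ring.
Qed.

End OpeBracket.

(** * Separating operators by their charges *)

Section ChargeSplit.
Context (C : numFieldType) (V : lmodType C) (N : V -> V).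
Context (ND : forall v w, N (v + w) = N v + N w) (NZ : forall a v, N (a *: v) = a *: N v).

Let N0 : N 0 = 0. Proof. by rewrite -[X in N X](scale0r 0) NZ scale0r. Qed.

Definition optotal (s : seq (C * (V -> V))) (v : V) : V :=
  foldr (fun p acc => p.2 v + acc) 0 s.

Lemma optotal_shift (a : C) (s : seq (C * (V -> V))) v :
  (forall p, List.In p s -> forall v, N (p.2 v) - p.2 (N v) = p.1 *: p.2 v) ->
  optotal [seq (p.1, fun w => (p.1 - a) *: p.2 w) | p <- s] v =
  N (optotal s v) - optotal s (N v) - a *: optotal s v.
Proof.
elim: s => [|p s IH] Hs /=; first by rewrite N0 scaler0 !subrr.
rewrite IH; last by move=> ? ?; apply: Hs; right.
rewrite ND; have := Hs p (or_introl erefl) v => E.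
by apply: (linear_comb1 (c := -1) E); vcoefs C V; ring.
Qed.

(** Eigenvectors of ad N for distinct eigenvalues are independent: applying ad N - q to the
    vanishing total removes the operator of charge q, and induction on the length handles the
    others, rescaled by their nonzero charge differences. *)
Lemma charge_split (s : seq (C * (V -> V))) :
  uniq (map fst s) ->
  (forall p, List.In p s -> forall v, N (p.2 v) - p.2 (N v) = p.1 *: p.2 v) ->
  (forall v, optotal s v = 0) ->
  forall p, List.In p s -> forall v, p.2 v = 0.
Proof.
have [n] := ubnP (size s); elim: n s => // n IH [//|[q Z] s] /= sn /andP[qs us] Hc Hs.
have tail p : List.In p s -> forall v, p.2 v = 0.
  move=> ps v; have pq : p.1 - q != 0.
    rewrite subr_eq0; apply: contraNneq qs => <-.
    elim: s ps {sn us Hc Hs} => //= r s IHs [->|/IHs]; rewrite inE ?eqxx //.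
    by move=> ->; rewrite orbT.
  pose s' := [seq (p.1, fun w => (p.1 - q) *: p.2 w) | p <- s].
  have ps' : List.In (p.1, fun w => (p.1 - q) *: p.2 w) s'.
    by rewrite /s'; elim: s ps {sn qs us Hc Hs s'} => //= r s IHs [->|/IHs]; [left|right].
  suff /(scalerI pq) : (p.1 - q) *: p.2 v = (p.1 - q) *: 0 by [].
  rewrite scaler0; apply: (IH s' _ _ _ _ _ ps' v).
  - by rewrite size_map.
  - by rewrite -map_comp.
  - move=> p'; rewrite /s'; elim: s {ps qs us Hs s' ps' sn} Hc => //= r s IHs Hc.
    case=> [<- w /=|].
      rewrite NZ -scalerBr (Hc r) ?scalerA 1?mulrC //; by right; left.
    by apply: IHs => p'' [H|H]; apply: Hc; [left|right; right].
  move=> w; rewrite (optotal_shift q) => [|r rs]; last by apply: Hc; right.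
  have E0 := Hs w; have E1 := congr1 N (Hs w); have E2 := Hs (N w).
  have E3 := Hc (q, Z) (or_introl erefl) w.
  rewrite /= ?ND in E0 E1 E2 E3.
  rewrite N0 in E1.
  have {}E1 : N (optotal s w) = - N (Z w) by apply/eqP; rewrite -addr_eq0 addrC E1.
  have {}E2 : optotal s (N w) = - Z (N w) by apply/eqP; rewrite -addr_eq0 addrC E2.
  have {}E0 : optotal s w = - Z w by apply/eqP; rewrite -addr_eq0 addrC E0.
  rewrite E1 E2 E0.
  by apply: (linear_comb1 (c := -1) E3); vcoefs C V; ring.
move=> p [<- v /=|/tail//].
have := Hs v; rewrite (_ : optotal s v = 0) ?addr0 //.
elim: s tail {sn qs us Hc Hs} => //= r s IHs Ht.
by rewrite Ht ?IHs ?addr0 //; [move=> ? ?; apply: Ht; right|left].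
Qed.

End ChargeSplit.

Section SuperAlgebra.
Context (C : numFieldType) (V : lmodType C).
Local Notation vfield := (vfield V).
Implicit Types (X : vfield) (v w : V) (m k n l s : int).
Context (Gp Gm Phi T J u F r0 r1 : vfield) (d kap : C).
Context (HDD : br3 true (Gp + Gm + Phi) (Gp + Gm + Phi)
                 (2 *: T) 0 ((2 * kap) *: vone)).
Context (HJD : br3 false J (Gp + Gm + Phi) (Gp - Gm - 3 *: Phi) 0 0).
Context (HJT : br3 false J T 0 J 0) (HJJ : br3 false J J 0 (d *: vone) 0).
Context (HPG : br3 true Phi Gp r0 r1 0) (HF : F = r0 - vd r1).
Context (cGp : charge u 1 Gp) (cGm : charge u (-1) Gm) (cPhi : charge u (-3) Phi).
Context (cJ : charge u 0 J) (cT : charge u 0 T).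

Let ac (X : vfield) (m : int) (Y : vfield) (k : int) (v : V) :=
  X m (Y k v) + Y k (X m v).

Let mode_split (s : seq (int * (V -> V))) :
  uniq (map fst s) ->
  (forall p, List.In p s -> forall v,
    u 0 (p.2 v) - p.2 (u 0 v) = p.1%:~R *: p.2 v) ->
  (forall v, foldr (fun p acc => p.2 v + acc) 0 s = 0) ->
  forall p, List.In p s -> forall v, p.2 v = 0.
Proof.
move=> us Hc Hs p ps v.
pose s' : seq (C * (V -> V)) := [seq (p.1%:~R, p.2) | p <- s].
apply: (@charge_split C V (u 0) (vlinD u 0) (fun a w => vlinZ u 0 a w) s' _ _ _
  (p.1%:~R, p.2)).
- rewrite -map_comp (eq_map (g := intr \o fst)) // map_comp map_inj_uniq //.
  (* Characteristic zero keeps distinct integer charges distinct as scalars. *)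
  exact: intr_inj.
- move=> p' p's w; have {p's} : List.In p' s' by [].
  rewrite /s'; elim: s Hc {us Hs ps s'} => //= r s IH Hc [<-|].
    by apply: Hc; left.
  by apply: IH => p'' H; apply: Hc; right.
- by move=> w; have := Hs w; rewrite /optotal /s' foldr_map.
- by rewrite /s'; elim: s ps {us Hc Hs s'} => //= r s IH [->|/IH]; [left|right].
Qed.

Let cE (X : vfield) q : charge u q X ->
  forall k v, u 0 (X k v) = X k (u 0 v) + q *: X k v.
Proof.
by move=> H k v; apply: (linear_comb1 (c := 1) (H k v)); vcoefs C V; ring.
Qed.

Let u1 k v : u 0 (vone k v) = vone k (u 0 v).
Proof. by rewrite !voneE; case: eqP; rewrite ?vlin0. Qed.

(** Pairs of the charges 1, -1, -3 add up to 2, 0, -2, -4, -6, while T and the identity field have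
    charge 0. Only symmetrized sums come out, and charge -2 receives both G^-.G^- and G^+.Phi;
    brackets with J have to undo this mixing. *)
Let DD_split m k :
  [/\ forall v, ac Gp m Gp k v = 0,
      forall v, ac Gp m Gm k v + ac Gm m Gp k v =
        2 *: T (m + k) v + (m%:~R * (m%:~R - 1) * kap) *: vone (m + k - 2) v,
      forall v, ac Gm m Gm k v + ac Gp m Phi k v + ac Phi m Gp k v = 0,
      forall v, ac Gm m Phi k v + ac Phi m Gm k v = 0
    & forall v, ac Phi m Phi k v = 0].
Proof.
pose ss : seq (int * (V -> V)) := [::
  (2, ac Gp m Gp k);
  (0, fun v => ac Gp m Gm k v + ac Gm m Gp k v -
        (2 *: T (m + k) v + (m%:~R * (m%:~R - 1) * kap) *: vone (m + k - 2) v));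
  (-2, fun v => ac Gm m Gm k v + ac Gp m Phi k v + ac Phi m Gp k v);
  (-4, fun v => ac Gm m Phi k v + ac Phi m Gm k v);
  (-6, ac Phi m Phi k)].
have H p : List.In p ss -> forall v, p.2 v = 0.
  apply: mode_split => //.
    move=> p' /= Hp v; rewrite /ac in Hp.
    by case: Hp => [|[|[|[|[|[]]]]]] <- /=;
      rewrite ?(vlinE, cE cGp, cE cGm, cE cPhi, cE cT, u1); vcoefs C V; ring.
  move=> v; rewrite /= /ac; have E := HDD m k v.
  rewrite !vmodeE ?vlinE /sg in E.
  by apply: (linear_comb1 (c := 1) E); vcoefs C V; field.
split=> v.
- exact: (H (_, _) (or_introl erefl)).
- by apply/subr0_eq; apply: (H (_, _) (or_intror (or_introl erefl))).
- exact: (H (_, _) (or_intror (or_intror (or_introl erefl)))).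
- exact: (H (_, _) (or_intror (or_intror (or_intror (or_introl erefl))))).
- exact: (H (_, _) (or_intror (or_intror (or_intror (or_intror (or_introl erefl)))))).
Qed.

Let JD_split m k :
  [/\ forall v, J m (Gp k v) = Gp k (J m v) + Gp (m + k) v,
      forall v, J m (Gm k v) = Gm k (J m v) - Gm (m + k) v
    & forall v, J m (Phi k v) = Phi k (J m v) - 3 *: Phi (m + k) v].
Proof.
pose ss : seq (int * (V -> V)) := [::
  (1, fun v => J m (Gp k v) - (Gp k (J m v) + Gp (m + k) v));
  (-1, fun v => J m (Gm k v) - (Gm k (J m v) - Gm (m + k) v));
  (-3, fun v => J m (Phi k v) - (Phi k (J m v) - 3 *: Phi (m + k) v))].
have H p : List.In p ss -> forall v, p.2 v = 0.
  apply: mode_split => //.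
    move=> p' /= Hp v.
    by case: Hp => [|[|[|[]]]] <- /=;
      rewrite ?(vlinE, cE cGp, cE cGm, cE cPhi, cE cJ); vcoefs C V; ring.
  move=> v; rewrite /=; have E := HJD m k v.
  rewrite !vmodeE ?vlinE /sg in E.
  by apply: (linear_comb1 (c := 1) E); vcoefs C V; field.
split=> v; apply/subr0_eq.
- exact: (H (_, _) (or_introl erefl)).
- exact: (H (_, _) (or_intror (or_introl erefl))).
- exact: (H (_, _) (or_intror (or_intror (or_introl erefl)))).
Qed.

Let JGp m k v : J m (Gp k v) = Gp k (J m v) + Gp (m + k) v.
Proof. by have [H _ _] := JD_split m k. Qed.
Let JGm m k v : J m (Gm k v) = Gm k (J m v) - Gm (m + k) v.
Proof. by have [_ H _] := JD_split m k. Qed.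
Let JPhi m k v : J m (Phi k v) = Phi k (J m v) - 3 *: Phi (m + k) v.
Proof. by have [_ _ H] := JD_split m k. Qed.
Let JJ m k v : J m (J k v) = J k (J m v) + (m%:~R * d) *: vone (m + k - 1) v.
Proof.
apply: (linear_comb1 (c := 1) (HJJ m k v)); rewrite !vmodeE /sg.
by vcoefs C V; field.
Qed.
Let JT m k v : J m (T k v) = T k (J m v) + m%:~R *: J (m + k - 1) v.
Proof.
apply: (linear_comb1 (c := 1) (HJT m k v)); rewrite !vmodeE /sg.
by vcoefs C V; field.
Qed.
Let oneC (X : vfield) (m k : int) v : vone k (X m v) = X m (vone k v).
Proof. by rewrite !voneE; case: eqP; rewrite ?vlin0. Qed.

(* Applied to {G^-_k, Phi_k} = 0, [J_(m-k), -] shifts the two modes with different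
   weights -1 and -3, which separates {G^-_m, Phi_k} from {G^-_k, Phi_m}. *)
Let GmPhi m k v : Gm m (Phi k v) + Phi k (Gm m v) = 0.
Proof.
have [_ _ _ A _] := DD_split m k.
have [_ _ _ B _] := DD_split k k.
have E1 := congr1 (J (m - k)) (B v); have E2 := B (J (m - k) v); have E3 := A v.
rewrite /ac ?vlinE in E1 E2 E3.
rewrite !(JGm, JPhi, vlinE) in E1.
apply: (linear_comb4 (c1 := 1 / 4) (c2 := - (1 / 4)) (c3 := 3 / 2) (c4 := 0) E1 E2 E3 E3).
by vidx_eq; vcoefs C V; field.
Qed.

(** Let g = {G^-_m, G^-_k}, x = {G^+_m, Phi_k}, y = {G^+_k, Phi_m}. Charge -2 of D.D gives g + x + y
    = 0, and [J_(m-k), -] applied to its case m = k gives g = x - 3 y. Hence x = y. *)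
Let GpPhi_sym m k v :
  Gp m (Phi k v) + Phi k (Gp m v) = Gp k (Phi m v) + Phi m (Gp k v).
Proof.
have [_ _ A _ _] := DD_split m k.
have [_ _ B _ _] := DD_split k k.
have E1 := congr1 (J (m - k)) (B v); have E2 := B (J (m - k) v); have E3 := A v.
rewrite /ac ?vlinE in E1 E2 E3.
rewrite !(JGm, JPhi, JGp, vlinE) in E1.
apply: (linear_comb4 (c1 := 1 / 4) (c2 := - (1 / 4)) (c3 := 1 / 2) (c4 := 0) E1 E2 E3 E3).
by vidx_eq; vcoefs C V; field.
Qed.

(* {G^+_m, Phi_k} is symmetric in m and k, whereas a second order pole would
   contribute k r1_(m+k-1). *)
Let r1_eq0 : r1 = 0.
Proof.
apply: vfield_eq => s v; rewrite vmodeE.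
(* Exchanging the indices changes the coefficient of r1_s by s + 1 for the pair (s + 1, 0) and by s
   + 3 for (s + 2, -1); half the difference isolates r1_s for every s. *)
have E1 := HPG (s + 1) 0 v; have E1' := HPG 0 (s + 1) v.
have E2 := HPG (s + 2) (-1) v; have E2' := HPG (-1) (s + 2) v.
have S1 := GpPhi_sym (s + 1) 0 v; have S2 := GpPhi_sym (s + 2) (-1) v.
rewrite !vmodeE /sg in E1 E1' E2 E2'.
apply: (linear_comb4 (c1 := 1 / 2) (c2 := - (1 / 2)) (c3 := - (1 / 2)) (c4 := 1 / 2)
  E1 E1' E2 E2').
apply: (linear_comb2 (c := 1 / 2) (c' := - (1 / 2)) S1 S2).
by vidx_eq; vcoefs C V; field.
Qed.

Let GpPhi m k v : Gp m (Phi k v) + Phi k (Gp m v) = F (m + k) v.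
Proof.
have E := HPG k m v; rewrite HF r1_eq0 linear0 subr0; rewrite r1_eq0 !vmodeE /sg in E.
by apply: (linear_comb1 (c := 1) E); vidx_eq; vcoefs C V; field.
Qed.

Let GmGm m k v : Gm m (Gm k v) + Gm k (Gm m v) = - 2 *: F (m + k) v.
Proof.
have [_ _ A _ _] := DD_split m k.
apply: (linear_comb4 (c1 := 1) (c2 := - 1) (c3 := - 1) (c4 := 0)
  (A v) (GpPhi m k v) (GpPhi k m v) (A v)).
by rewrite /ac; vidx_eq; vcoefs C V; field.
Qed.

Let GpGp m k v : Gp m (Gp k v) + Gp k (Gp m v) = 0.
Proof. by have [A _ _ _ _] := DD_split m k; apply: A. Qed.
Let PhiPhi m k v : Phi m (Phi k v) + Phi k (Phi m v) = 0.
Proof. by have [_ _ _ _ A] := DD_split m k; apply: A. Qed.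

Let double0 (v : V) : v + v = 0 -> v = 0.
Proof. by move=> E; apply: (linear_comb1 (c := 1 / 2) E); vcoefs C V; field. Qed.

Let Gp2 m v : Gp m (Gp m v) = 0. Proof. exact/double0/GpGp. Qed.
Let Phi2 m v : Phi m (Phi m v) = 0. Proof. exact/double0/PhiPhi. Qed.

(** The sum {G^+_m, G^-_k} + {G^+_k, G^-_m} is the charge 0 part of D.D; the difference is (m - k)
    J_(m+k-1), by applying [J_(m-k), -] to that relation at m = k. *)
Let GpGm_kap m k v : Gp m (Gm k v) + Gm k (Gp m v) = T (m + k) v
  + (2^-1 * (m%:~R - k%:~R)) *: J (m + k - 1) v
  + (2^-1 * m%:~R * (m%:~R - 1) * kap) *: vone (m + k - 2) v.
Proof.
have [_ A _ _ _] := DD_split m k.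
have [_ B _ _ _] := DD_split k k.
have E1 := congr1 (J (m - k)) (B v); have E2 := B (J (m - k) v); have E3 := A v.
rewrite /ac ?vlinE in E1 E2 E3.
rewrite !(JGm, JT, JGp, vlinE) in E1.
rewrite -(oneC J) in E1.
apply: (linear_comb4 (c1 := 1 / 4) (c2 := - (1 / 4)) (c3 := 1 / 2) (c4 := 0) E1 E2 E3 E3).
by vidx_eq; vcoefs C V; field.
Qed.

(* From [J_1, {G^+_1, G^-_(-1)}], where [J_1, T_0] and [J_1, J_(-1)] give d. *)
Let kapE k v : kap *: vone k v = d *: vone k v.
Proof.
have [->|kN] := eqVneq k (-1); last first.
  by rewrite voneE (negPf kN) !scaler0.
have E1 := congr1 (J 1) (GpGm_kap 1 (-1) v).
have E2 := GpGm_kap 1 (-1) (J 1 v).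
have E3 := GpGm_kap 2 (-1) v.
have E4 := GpGm_kap 1 0 v.
rewrite !(JGm, JT, JGp, JJ 1, vlinE) in E1.
rewrite -(oneC J) in E1.
apply: (linear_comb4 (c1 := 1) (c2 := - 1) (c3 := - 1) (c4 := 1) E1 E2 E3 E4).
by vidx_eq; vcoefs C V; field.
Qed.

Let GpGm m k v : Gp m (Gm k v) + Gm k (Gp m v) = T (m + k) v
  + (2^-1 * (m%:~R - k%:~R)) *: J (m + k - 1) v
  + (2^-1 * m%:~R * (m%:~R - 1) * d) *: vone (m + k - 2) v.
Proof. by rewrite GpGm_kap -!scalerA kapE !scalerA. Qed.

Let JTr m k v : T k (J m v) = J m (T k v) - m%:~R *: J (m + k - 1) v.
Proof.
by apply: (linear_comb1 (c := -1) (JT m k v)); vcoefs C V; ring.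
Qed.

(** Because G^+_m squares to zero, it commutes with {G^+_m, G^-_(s-m)}, whose leading term is T_s;
    the same index m is taken twice for this reason. *)
Let TGp s m v : T s (Gp m v) =
  Gp m (T s v) + (2^-1 * (s%:~R - 2 * m%:~R)) *: Gp (s + m - 1) v.
Proof.
have E1 := congr1 (Gp m) (GpGm m (s - m) v).
have E2 := GpGm m (s - m) (Gp m v).
rewrite !(vlinE, Gp2) in E1; rewrite !(JGp, oneC Gp, Gp2, vlinE) in E2.
apply: (linear_comb2 (c := 1) (c' := -1) E1 E2).
by vidx_eq; vcoefs C V; field.
Qed.

Let FE m k v : F (m + k) v = Gp m (Phi k v) + Phi k (Gp m v).
Proof. by rewrite GpPhi. Qed.

(** F_n is {G^+_m, Phi_(n-m)} for every m, so m can be matched to the mode of G^+ that it meets, and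
    (G^+_m)^2 = 0 applies. *)
Let GpF m n v : Gp m (F n v) = F n (Gp m v).
Proof.
have := FE m (n - m); rewrite [m + _]addrC subrK => E.
by rewrite !E !vlinE !Gp2 vlin0 add0r addr0.
Qed.

Let PhiF c n v : Phi c (F n v) = F n (Phi c v).
Proof.
have := FE (n - c) c; rewrite subrK => E.
by rewrite !E !vlinE !Phi2 vlin0 add0r addr0.
Qed.

Let FF m n v : F m (F n v) = F n (F m v).
Proof.
have := FE 0 n; rewrite add0r => E.
by rewrite !E !vlinE -!GpF -!PhiF -!GpF.
Qed.

Let Gm2 m v : Gm m (Gm m v) = - F (m + m) v.
Proof.
by apply: (linear_comb1 (c := 1 / 2) (GmGm m m v)); vcoefs C V; field.
Qed.

(** As for G^+, except that (G^-_m)^2 = - F_(2m); this commutes with G^+, which is what the argument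
    needs. *)
Let TGm s m v : T s (Gm m v) =
  Gm m (T s v) + (2^-1 * (s%:~R - 2 * m%:~R)) *: Gm (s + m - 1) v.
Proof.
have E1 := congr1 (Gm m) (GpGm (s - m) m v).
have E2 := GpGm (s - m) m (Gm m v).
rewrite !(vlinE, Gm2, GpF) in E1; rewrite !(JGm, oneC Gm, Gm2, vlinE, GpF) in E2.
apply: (linear_comb2 (c := 1) (c' := -1) E1 E2).
by vidx_eq; vcoefs C V; field.
Qed.

Let GmPhi_swap m k v : Gm m (Phi k v) = - Phi k (Gm m v).
Proof.
by apply: (linear_comb1 (c := 1) (GmPhi m k v)); vcoefs C V; ring.
Qed.

Let PhiGp k m v : Phi k (Gp m v) = F (m + k) v - Gp m (Phi k v).
Proof. by rewrite -GpPhi addrC addKr. Qed.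

(** Jacobi identity for G^+_m, G^-_l, Phi_k. It ties two unknown brackets, [T, Phi] and [G^-, F],
    together, but the splitting of the index of T into m + l is free. *)
Let TPhi_aux m l k v : T (m + l) (Phi k v) - Phi k (T (m + l) v) =
  Gm l (F (m + k) v) - F (m + k) (Gm l v)
  + (3 / 2 * (m%:~R - l%:~R)) *: Phi (m + l + k - 1) v.
Proof.
have E1 := congr1 (Phi k) (GpGm m l v).
have E2 := GpGm m l (Phi k v).
rewrite !vlinE !PhiGp in E1; rewrite !(JPhi, oneC Phi, GmPhi_swap, vlinE) in E2.
have E3 := GmPhi_swap l k (Gp m v); have E4 := GmPhi_swap l k v.
have E5 := congr1 (Gm l) (PhiGp k m v); rewrite vlinD vlinN in E5.
apply: (linear_comb4 (c1 := 1) (c2 := -1) (c3 := -1) (c4 := 1) E1 E2 E3 E5).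
by vidx_eq; vcoefs C V; field.
Qed.

(** Jacobi identity for the modes G^-_0, G^-_0, G^-_n, with the anticommutators replaced by F. *)
Let GmF0 n v : Gm n (F 0 v) - F 0 (Gm n v) + 2 *: (Gm 0 (F n v) - F n (Gm 0 v)) = 0.
Proof.
have E1 := congr1 (Gm n) (Gm2 0 v); have E2 := Gm2 0 (Gm n v).
have E3 := congr1 (Gm 0) (GmGm 0 n v); have E4 := GmGm 0 n (Gm 0 v).
rewrite ?addr0 ?add0r ?vlinE in E1 E2 E3 E4.
apply: (linear_comb4 (c1 := 1) (c2 := -1) (c3 := 1) (c4 := -1) E1 E2 E3 E4).
by vidx_eq; vcoefs C V; field.
Qed.

(** Three linear equations for X = [T_0, Phi_n], P = [G^-_0, F_n], Q = [G^-_n, F_0]: the splittings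
    0 + 0 and -n + n of the index of T_0 give X = P and X = Q - 3n Phi_(n-1), and [GmF0] gives Q + 2
    P = 0. *)
Let TPhi0 n v : T 0 (Phi n v) - Phi n (T 0 v) = - n%:~R *: Phi (n - 1) v.
Proof.
have E1 := TPhi_aux 0 0 n v; have E2 := TPhi_aux (- n) n n v.
have E3 := GmF0 n v.
rewrite ?addr0 ?add0r ?addNr in E1 E2.
apply: (linear_comb4 (c1 := 2 / 3) (c2 := 1 / 3) (c3 := 1 / 3) (c4 := 0) E1 E2 E3 E3).
by vidx_eq; vcoefs C V; field.
Qed.

Let GmF m n v : Gm m (F n v) =
  F n (Gm m v) + (2 * m%:~R - n%:~R) *: Phi (m + n - 1) v.
Proof.
have E1 := TPhi_aux (- m) m (n + m) v; have E2 := TPhi0 (n + m) v.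
rewrite ?addNr in E1.
apply: (linear_comb2 (c := -1) (c' := 1) E1 E2).
by vidx_eq; vcoefs C V; field.
Qed.

Let TPhi s m v : T s (Phi m v) =
  Phi m (T s v) + (2^-1 * s%:~R - m%:~R) *: Phi (s + m - 1) v.
Proof.
have E1 := TPhi_aux s 0 m v; have E2 := GmF 0 (s + m) v.
rewrite ?addr0 in E1.
apply: (linear_comb2 (c := 1) (c' := 1) E1 E2).
by vidx_eq; vcoefs C V; field.
Qed.

Let TF s n v : T s (F n v) =
  F n (T s v) + (s%:~R - n%:~R) *: F (s + n - 1) v.
Proof.
have E1 := congr1 (T s) (FE 0 n v); have E2 := FE 0 n (T s v).
have E3 := GpPhi (s - 1) n v; have E4 := GpPhi 0 (n + s - 1) v.
rewrite ?add0r ?(vlinE, TPhi, TGp) in E1 E2 E3 E4.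
apply: (linear_comb4 (c1 := 1) (c2 := -1) (c3 := 2^-1 * s%:~R)
  (c4 := 2^-1 * s%:~R - n%:~R) E1 E2 E3 E4).
by vidx_eq; vcoefs C V; field.
Qed.

Let JF s n v : J s (F n v) = F n (J s v) - 2 *: F (s + n) v.
Proof.
have E1 := congr1 (J s) (FE 0 n v); have E2 := FE 0 n (J s v).
have E3 := GpPhi s n v; have E4 := GpPhi 0 (s + n) v.
rewrite ?add0r ?(vlinE, JPhi, JGp) in E1 E2 E3 E4.
apply: (linear_comb4 (c1 := 1) (c2 := -1) (c3 := 1) (c4 := -3) E1 E2 E3 E4).
by vidx_eq; vcoefs C V; field.
Qed.

(** Only the mode -1 of the identity field is nonzero, so a coefficient of vone_k matters only
    modulo k + 1. The central term of [T_s, T_n] takes its standard form only after such a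
    reduction. *)
Let vone_mul k v : (k%:~R + 1) *: vone k v = 0 :> V.
Proof.
rewrite voneE; case: eqP => [->|_]; last by rewrite scaler0.
by rewrite mulrN1z addNr scale0r.
Qed.

Let TT s n v : T s (T n v) = T n (T s v) + (s%:~R - n%:~R) *: T (s + n - 1) v
  + (4^-1 * d * s%:~R * (s%:~R - 1) * (s%:~R - 2)) *: vone (s + n - 3) v.
Proof.
have E1 := congr1 (T s) (GpGm n 0 v); have E2 := GpGm n 0 (T s v).
have E3 := GpGm (s + n - 1) 0 v; have E4 := GpGm n (s - 1) v.
have E5 := vone_mul (s + n - 3) v.
rewrite ?addr0 ?(vlinE, JTr, TGm, TGp, oneC T) in E1 E2 E3 E4.
apply: (linear_comb4 (c1 := -1) (c2 := 1) (c3 := 2^-1 * (s%:~R - 2 * n%:~R))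
  (c4 := 2^-1 * s%:~R) E1 E2 E3 E4).
apply: (linear_comb1 (c := 4^-1 * d * ((s%:~R - 2 * n%:~R) * (n%:~R + s%:~R - 1)
  + s%:~R * (n%:~R - s%:~R + 1))) E5).
by vidx_eq; vcoefs C V; field.
Qed.

Local Notation "A =f= B" := (A = B :> (int -> V -> V)) (at level 70).

Theorem N32_of_supercurrent : N32_algebra d (vmode T) (vmode J) (vmode F)
  (vmode Gp) (vmode Gm) (vmode Phi).
Proof.
have dE (X : vfield) : (fun n v => - n%:~R *: X (n - 1) v) =f= vd X.
  by apply/funext => n; apply/funext => v; rewrite vdE.
have oneE : @one_field C V =f= vone.
  by apply/funext => n; apply/funext => v; rewrite voneE.
have ope_weight p (X : vfield) (a : C) :
    (forall s m v, T s (X m v) = X m (T s v)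
      + ((a - 1) * s%:~R - m%:~R) *: X (s + m - 1) v) ->
    @ope C V false p (vmode T) (vmode X) [:: @dfield C V p (vmode X); a *: (vmode X : field V p)].
  move=> H; apply: (@ope_br3 _ _ false p T X (vd X) (a *: X) 0) => //; last exact: dE.
  move=> m k v; rewrite H /sg ?(vmodeE, vdE).
  by vidx_eq; vcoefs C V; field.
have ope_charge p (X : vfield) (q : C) :
    (forall s m v, J s (X m v) = X m (J s v) + q *: X (s + m) v) ->
    @ope C V false p (vmode J) (vmode X) [:: q *: (vmode X : field V p)].
  move=> H; apply: (@ope_br3 _ _ false p J X (q *: X) 0 0) => //.
  move=> m k v; rewrite H /sg ?vmodeE.
  by vidx_eq; vcoefs C V; field.
have ope_zero p q (X Y : vfield) :
    (forall m k v, X m (Y k v) - sg (p && q) *: Y k (X m v) = 0) ->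
    @ope C V p q (vmode X) (vmode Y) [::].
  move=> H; apply: (@ope_br3 _ _ p q X Y 0 0 0) => //.
  by move=> m k v; rewrite H ?vmodeE; vcoefs C V; ring.
split.
(* The fourth order pole of T.T lies beyond [br3], so this product is matched with its list of poles
   directly. *)
- have E0 : @dfield C V false (vmode T) =f= vd T by apply: dE.
  split; try exact: vmode_is_field.
    move=> [|[|[|[|j]]]] /=; rewrite ?E0 ?nth_nil; try exact: vmode_is_field.
    + exact: (vmode_is_field false (2 *: T)).
    + exact: (vmode_is_field false 0).
    + rewrite oneE; exact: (vmode_is_field false ((3 / 2 * d) *: vone)).
    + exact: (vmode_is_field false 0).
  move=> m k v; rewrite !big_ord_recr big_ord0 /= binz0 binz1 binz2 binz3.
  rewrite E0 oneE TT.
  transitivity (vd T (m + k) v + m%:~R *: (2 *: T (m + k - 1) v)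
    + (m%:~R * (m%:~R - 1) * (m%:~R - 2) / 6) *: ((3 / 2 * d) *: vone (m + k - 3) v)).
    by rewrite vdE; vidx_eq; vcoefs C V; field.
  rewrite add0r subr0 scale1r; congr (_ + _).
  by rewrite -[LHS]addr0; congr (_ + _); rewrite scaler0.
- apply: (@ope_br3 _ _ false false T J (vd J) J 0) => //; last exact: dE.
  move=> m k v; rewrite JTr /sg ?(vmodeE, vdE).
  by vidx_eq; vcoefs C V; field.
- apply: (@ope_br3 _ _ false false J J 0 (d *: vone) 0) => //.
  by rewrite /= oneE.
- split; [apply: ope_weight|apply: ope_charge] => s m v; rewrite (TGp, JGp).
    by vcoefs C V; field.
  by vcoefs C V; field.
- split; [apply: ope_weight|apply: ope_charge] => s m v; rewrite (TGm, JGm).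
    by vcoefs C V; field.
  by vcoefs C V; field.
- split; [apply: ope_weight|apply: ope_charge] => s m v; rewrite (TPhi, JPhi).
    by vcoefs C V; field.
  by vcoefs C V; field.
- split; [apply: ope_weight|apply: ope_charge] => s m v; rewrite (TF, JF).
    by vcoefs C V; field.
  by vcoefs C V; field.
- apply: (@ope_br3 _ _ true true Gp Gm (T + 2^-1 *: vd J) J (d *: vone)) => //.
  + move=> m k v; apply: (linear_comb1 (c := 1) (GpGm m k v)).
    rewrite ?(vmodeE, vdE) /sg.
    by vidx_eq; vcoefs C V; field.
  + by rewrite /= /dfield dE.
  + by rewrite /= oneE.
- apply: (@ope_br3 _ _ true true Gp Phi F 0 0) => //.
  move=> m k v; apply: (linear_comb1 (c := 1) (GpPhi m k v)).
  by rewrite ?vmodeE /sg; vcoefs C V; field.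
- apply: (@ope_br3 _ _ true true Gm Gm (-2 *: F) 0 0) => //.
  move=> m k v; apply: (linear_comb1 (c := 1) (GmGm m k v)).
  by rewrite ?vmodeE /sg; vcoefs C V; field.
- apply: (@ope_br3 _ _ true false Gm F (vd Phi) (3 *: Phi) 0) => //; last exact: dE.
  move=> m k v; rewrite GmF /sg ?(vmodeE, vdE).
  by vidx_eq; vcoefs C V; field.
- apply: ope_zero => m k v; rewrite -(GpGp m k v) /sg.
  by vcoefs C V; ring.
- apply: ope_zero => m k v; rewrite -(GmPhi m k v) /sg.
  by vcoefs C V; ring.
- by apply: ope_zero => m k v; rewrite GpF /sg scale1r subrr.
- apply: ope_zero => m k v; rewrite -(PhiPhi m k v) /sg.
  by vcoefs C V; ring.
- by apply: ope_zero => m k v; rewrite PhiF /sg scale1r subrr.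
- by apply: ope_zero => m k v; rewrite FF /sg scale1r subrr.
Qed.

End SuperAlgebra.

(** * Traces over the canonical tensor of a Manin pair *)

Section DualBases.
Context (C : numFieldType) (g : vectType C).
Context (br : {bilinear g -> g -> g}) (ip : {biscalar g}) (gp gm : {vspace g}).
Context (Hpair : manin_pair br ip gp gm).
Context (n : nat) (x y : n.-tuple g) (Hxy : dual_bases ip gp gm x y).
Implicit Types (u v w z X Y : g) (a b : C).

Lemma brL z a u v : br (a *: u + v) z = a *: br u z + br v z.
Proof. exact: linearPl. Qed.
Lemma brR z a u v : br z (a *: u + v) = a *: br z u + br z v.
Proof. exact: linearPr. Qed.
Lemma ipL z a u v : ip (a *: u + v) z = a * ip u z + ip v z.
Proof. exact: linearPl. Qed.
Lemma ipR z a u v : ip z (a *: u + v) = a * ip z u + ip z v.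
Proof. exact: linearPr. Qed.

Lemma ipC u v : ip u v = ip v u.
Proof. by have [] := mp_inner Hpair. Qed.
Lemma ip_br u v w : ip (br u v) w = ip u (br v w).
Proof. by have [] := mp_inner Hpair. Qed.
Lemma brvv u : br u u = 0.
Proof. by have [] := mp_lie Hpair. Qed.
Lemma brC u v : br u v = - br v u.
Proof.
apply/eqP; rewrite -addr_eq0; apply/eqP.
have := brvv (u + v); rewrite linearDl !linearDr !brvv add0r addr0 //.
Qed.
Lemma jacobi u v w : br u (br v w) + br v (br w u) + br w (br u v) = 0.
Proof. by have [] := mp_lie Hpair. Qed.
Lemma br_br u v w : br (br u v) w = br u (br v w) - br v (br u w).
Proof.
apply: (linear_comb1 (c := -1) (jacobi u v w)).
rewrite (brC (br u v)) (brC w u) linearNr.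
by vcoefs C g; ring.
Qed.

(* A = (s, i) runs through a basis of g: be is the basis (x, y), and bd its dual
   basis (y, x). *)
Definition be (A : bool * 'I_n) : g := if A.1 then y`_A.2 else x`_A.2.
Definition bd (A : bool * 'I_n) : g := if A.1 then x`_A.2 else y`_A.2.

Lemma sum_dual (M : zmodType) (F : g -> g -> M) :
  \sum_A F (be A) (bd A) = \sum_(i < n) (F x`_i y`_i + F y`_i x`_i).
Proof.
rewrite big_split /= addrC -(pair_big xpredT xpredT (fun s i => F (be (s, i)) (bd (s, i)))) /=.
by rewrite big_bool.
Qed.

Lemma sum_dualC (M : zmodType) (F : g -> g -> M) :
  \sum_A F (be A) (bd A) = \sum_A F (bd A) (be A).
Proof.
by rewrite sum_dual (sum_dual (fun u v => F v u)); apply: eq_bigr => i _; rewrite addrC.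
Qed.

Lemma x_in i : (i < n)%N -> x`_i \in gp.
Proof.
move=> iN; have [/basis_mem Hx _ _] := Hxy; apply: Hx.
by apply: mem_nth; rewrite size_tuple.
Qed.
Lemma y_in i : (i < n)%N -> y`_i \in gm.
Proof.
move=> iN; have [_ /basis_mem Hy _] := Hxy; apply: Hy.
by apply: mem_nth; rewrite size_tuple.
Qed.

Lemma ip_xy (i j : 'I_n) : ip x`_i y`_j = (i == j)%:R.
Proof. by have [_ _] := Hxy. Qed.
Lemma ip_yx (i j : 'I_n) : ip y`_i x`_j = (i == j)%:R.
Proof. by rewrite ipC ip_xy eq_sym. Qed.
Lemma ip_xx (i j : 'I_n) : ip x`_i x`_j = 0.
Proof. by apply: (mp_isoP Hpair); apply: x_in. Qed.
Lemma ip_yy (i j : 'I_n) : ip y`_i y`_j = 0.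
Proof. by apply: (mp_isoM Hpair); apply: y_in. Qed.

Lemma sum_delta (M : lmodType C) (F : 'I_n -> M) (j : 'I_n) :
  \sum_i (i == j)%:R *: F i = F j.
Proof.
rewrite (bigD1 j) //= eqxx scale1r big1 ?addr0 // => i /negPf ->.
by rewrite scale0r.
Qed.

Lemma expand_xy z : z = \sum_(i < n) (ip z y`_i *: x`_i + ip z x`_i *: y`_i).
Proof.
have [bx by_ _] := Hxy.
have : z \in (gp + gm)%VS by rewrite (mp_sum Hpair) memvf.
case/memv_addP=> u up [v vm E].
have {E} [p [q ->]] : exists p q : 'I_n -> C,
    z = \sum_i (p i *: x`_i + q i *: y`_i).
  exists (fun i => coord x i u), (fun i => coord y i v).
  by rewrite E {1}(coord_basis bx up) {1}(coord_basis by_ vm) -big_split.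
apply: eq_bigr => j _; congr (_ *: _ + _ *: _).
  rewrite linear_sumlz (eq_bigr (fun i => (i == j)%:R *: (p i : C^o))) => [|i _].
    by rewrite sum_delta.
  by rewrite ipL linearZl_LR /= ip_xy ip_yy mulr0 addr0 mulrC.
rewrite linear_sumlz (eq_bigr (fun i => (i == j)%:R *: (q i : C^o))) => [|i _].
  by rewrite sum_delta.
by rewrite ipL linearZl_LR /= ip_yx ip_xx mulr0 add0r mulrC.
Qed.

Lemma expand_be z : z = \sum_A ip z (bd A) *: be A.
Proof.
rewrite [LHS]expand_xy (sum_dual (fun u v => ip z v *: u)).
by apply: eq_bigr.
Qed.
Lemma expand_bd z : z = \sum_A ip z (be A) *: bd A.
Proof.
rewrite [LHS]expand_be (sum_dualC (fun u v => ip z v *: u)).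
by apply: eq_bigr.
Qed.

Lemma lin_fun0 (M : lmodType C) (F : g -> M) :
  (forall a u v, F (a *: u + v) = a *: F u + F v) -> F 0 = 0.
Proof.
by move=> FL; have := FL (-1) 0 0; rewrite !scaleN1r oppr0 addr0 addNr.
Qed.

Lemma lin_funN (M : lmodType C) (F : g -> M) u :
  (forall a u v, F (a *: u + v) = a *: F u + F v) -> F (- u) = - F u.
Proof.
by move=> FL; rewrite -[- u]addr0 -(scaleN1r u) FL (lin_fun0 FL) addr0 scaleN1r.
Qed.

Lemma lin_sum (M : lmodType C) (F : g -> M) (I : finType) (c : I -> C) (w : I -> g) :
  (forall a u v, F (a *: u + v) = a *: F u + F v) ->
  F (\sum_i c i *: w i) = \sum_i c i *: F (w i).
Proof.
move=> FL; have F0 := lin_fun0 FL.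
elim: (index_enum I) => [|i r IH]; first by rewrite !big_nil.
by rewrite !big_cons FL IH.
Qed.

Lemma dual_contract (M : lmodType C) (F : g -> M) z :
  (forall a u v, F (a *: u + v) = a *: F u + F v) ->
  \sum_A ip z (be A) *: F (bd A) = F z.
Proof. by move=> FL; rewrite [in RHS](expand_bd z) lin_sum. Qed.

Lemma dual_contractC (M : lmodType C) (F : g -> M) z :
  (forall a u v, F (a *: u + v) = a *: F u + F v) ->
  \sum_A ip z (bd A) *: F (be A) = F z.
Proof. by move=> FL; rewrite [in RHS](expand_be z) lin_sum. Qed.

Definition blin (M : lmodType C) (B : g -> g -> M) : Prop :=
  (forall a u v w, B (a *: u + v) w = a *: B u w + B v w) /\
  (forall a u v w, B w (a *: u + v) = a *: B w u + B w v).

Lemma blinNr (M : lmodType C) (B : g -> g -> M) u v :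
  blin B -> B u (- v) = - B u v.
Proof.
by case=> _ BR; apply: (lin_funN (F := B u)) => a w z; apply: BR.
Qed.

(** The canonical tensor represents the identity map of [g], so an endomorphism of one leg equals
    its adjoint on the other. Invariance under ad X is the skew-adjoint case. *)
Lemma dual_adjoint (M : lmodType C) (B : g -> g -> M) (f h : g -> g) :
  blin B -> (forall u v, ip (f u) v = ip u (h v)) ->
  \sum_A B (f (be A)) (bd A) = \sum_A B (be A) (h (bd A)).
Proof.
move=> [BL BR] fh.
have E1 A : B (f (be A)) (bd A) = \sum_A' ip (f (be A)) (bd A') *: B (be A') (bd A).
  by rewrite [in LHS](expand_be (f _)) (lin_sum (F := B^~ _)).
have E2 A : B (be A) (h (bd A)) = \sum_A' ip (h (bd A)) (be A') *: B (be A) (bd A').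
  by rewrite [in LHS](expand_bd (h _)) lin_sum.
rewrite (eq_bigr _ (fun A _ => E1 A)) (eq_bigr _ (fun A _ => E2 A)) exchange_big /=.
by apply: eq_bigr => A _; apply: eq_bigr => A' _; rewrite fh ipC.
Qed.

Lemma dual_invariant (M : lmodType C) (B : g -> g -> M) X :
  blin B -> \sum_A B (br X (be A)) (bd A) = - \sum_A B (be A) (br X (bd A)).
Proof.
move=> HB; rewrite (dual_adjoint (h := fun v => - br X v) HB).
  by rewrite -sumrN; apply: eq_bigr => A _; rewrite blinNr.
by move=> u v; rewrite linearNr -ip_br (brC u X) linearNl opprK.
Qed.

Lemma dual_invariantC (M : lmodType C) (B : g -> g -> M) X :
  blin B -> \sum_A B (br X (bd A)) (be A) = - \sum_A B (bd A) (br X (be A)).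
Proof.
move=> HB; rewrite -(sum_dualC (fun u v => B (br X u) v)) dual_invariant //.
by rewrite (sum_dualC (fun u v => B u (br X v))).
Qed.

(** The Casimir operator of the adjoint representation: self-adjoint, and the endomorphism that
    represents the Killing form with respect to [ip]. *)
Definition kap X : g := \sum_A br (be A) (br (bd A) X).

Lemma kap_lin a u v : kap (a *: u + v) = a *: kap u + kap v.
Proof.
by rewrite /kap scaler_sumr -big_split; apply: eq_bigr => A _; rewrite !brR.
Qed.

(** Independence of the trace from the basis; here the basis of the definition is exchanged for the
    dual bases of the pair. *)
Lemma killing_dual u v :
  killing br u v = \sum_A ip (br u (br v (be A))) (bd A).
Proof.
pose f z := br u (br v z); rewrite /killing.
have fL a w z : f (a *: w + z) = a *: f w + f z by rewrite /f !brR.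
set b := vbasis {:g}.
have E1 i : coord b i (br u (br v b`_i)) =
    \sum_A ip (f b`_i) (bd A) * coord b i (be A).
  by rewrite -/(f _) [in LHS](expand_be (f _)) linear_sum; apply: eq_bigr => A _; rewrite linearZ.
rewrite (eq_bigr _ (fun i _ => E1 i)) exchange_big /=; apply: eq_bigr => A _.
rewrite -/(f _) [be A in RHS](coord_basis (vbasisP _) (memvf _)).
rewrite lin_sum // linear_sumlz; apply: eq_bigr => i _.
by rewrite linearZl_LR /= mulrC.
Qed.

Lemma killing_kap u v : killing br u v = ip u (kap v).
Proof.
rewrite killing_dual /kap linear_sumr.
rewrite (sum_dualC (fun w z => ip u (br w (br z v)))); apply: eq_bigr => A _.
by rewrite ip_br; congr (ip u _); rewrite brC (brC v) linearNr opprK.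
Qed.

Lemma kapC u v : ip (kap u) v = ip u (kap v).
Proof.
have E w z : ip (kap w) z = - \sum_A ip (br (bd A) w) (br (be A) z).
  rewrite /kap linear_sumlz -sumrN; apply: eq_bigr => A _.
  by rewrite brC linearNl ip_br.
rewrite E ipC E (sum_dualC (fun t s => ip (br s v) (br t u))).
by congr (- _); apply: eq_bigr => A _; rewrite ipC.
Qed.

(** The canonical tensor with a self-adjoint [f] on one leg is symmetric. This removes the second
    order poles of D.D, with [f] the identity, the level operator or the Casimir. *)
Lemma dual_antisym (M : lmodType C) (B : g -> g -> M) (f : g -> g) :
  blin B -> (forall u v, B u v = - B v u) ->
  (forall u v, ip (f u) v = ip u (f v)) -> \sum_A B (bd A) (f (be A)) = 0.
Proof.
move=> HB anti fC.
have E : \sum_A B (bd A) (f (be A)) = - \sum_A B (bd A) (f (be A)).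
  rewrite [LHS](eq_bigr (fun A => - B (f (be A)) (bd A))) => [|A _]; last exact: anti.
  by rewrite sumrN (dual_adjoint HB fC) (sum_dualC (fun u v => B u (f v))).
apply: (linear_comb1 (c := 1 / 2) E).
by vcoefs C M; field.
Qed.

(** The involution with eigenvalue -1 on [gp] and +1 on [gm], that is minus the bar map. The sign is
    chosen so that the zero mode of a^i a_i sends a(z) to a(tau z). *)
Definition tau z : g := \sum_(i < n) (- ip z y`_i *: x`_i + ip z x`_i *: y`_i).

Lemma tau_lin a u v : tau (a *: u + v) = a *: tau u + tau v.
Proof.
rewrite /tau scaler_sumr -big_split; apply: eq_bigr => i _; rewrite !ipL /=.
by vcoefs C g; ring.
Qed.

Lemma tau_x (i : 'I_n) : tau x`_i = - x`_i.
Proof.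
rewrite /tau (eq_bigr (fun j => (j == i)%:R *: (- x`_j))) ?sum_delta // => j _.
by rewrite ip_xy ip_xx scale0r addr0 eq_sym scalerN scaleNr.
Qed.
Lemma tau_y (i : 'I_n) : tau y`_i = y`_i.
Proof.
rewrite /tau (eq_bigr (fun j => (j == i)%:R *: y`_j)) ?sum_delta // => j _.
by rewrite ip_yx ip_yy oppr0 scale0r add0r eq_sym.
Qed.

Lemma tauC u v : ip (tau u) v = - ip u (tau v).
Proof.
rewrite /tau linear_sumlz linear_sumr -sumrN; apply: eq_bigr => i _.
rewrite ipL ipR linearZl_LR linearZr_LR /= (ipC x`_i v) (ipC y`_i v).
by ring.
Qed.

Lemma tau_tau z : tau (tau z) = z.
Proof.
rewrite [RHS]expand_xy {1}/tau; apply: eq_bigr => i _.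
by rewrite !tauC tau_x tau_y linearNr !opprK.
Qed.

Lemma dual_tau (M : lmodType C) (B : g -> g -> M) : blin B ->
  \sum_A B (tau (be A)) (bd A) = \sum_(i < n) (B y`_i x`_i - B x`_i y`_i).
Proof.
move=> [BL BR]; rewrite (sum_dual (fun u v => B (tau u) v)); apply: eq_bigr => i _.
rewrite tau_x tau_y addrC; congr (_ + _).
by apply: (lin_funN (F := B^~ _)) => a u v; apply: BL.
Qed.

(** Presents [rho] as the canonical tensor contracted through [tau]; this is the form in which it
    comes out of double contractions, and the one on which invariance can act. *)
Lemma rho_tau : \sum_A br (tau (be A)) (bd A) = - 2 *: rho br x y.
Proof.
rewrite (dual_tau (B := br)); last by split=> *; rewrite ?brL ?brR.
rewrite /rho scaler_sumr; apply: eq_bigr => i _.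
by rewrite (brC y`_i) -opprD -mulr2n scaleNr scaler_nat.
Qed.

End DualBases.

(** * The cubic Dirac current of a Manin pair *)

Section SpecialWick.
Context (C : numFieldType) (V : lmodType C).
Local Notation vfield := (vfield V).
Implicit Types (A B D c : vfield) (b : C) (p e : bool).

Lemma nop0l e B : nop e 0 B = 0. Proof. exact: linear0l. Qed.
Lemma nop0r e B : nop e B 0 = 0. Proof. exact: linear0r. Qed.
Lemma nopZl e b A B : nop e (b *: A) B = b *: nop e A B.
Proof. exact: linearZl_LR. Qed.
Lemma nopZr e b A B : nop e A (b *: B) = b *: nop e A B.
Proof. exact: linearZr_LR. Qed.
Lemma nopDl e A A' B : nop e (A + A') B = nop e A B + nop e A' B.
Proof. exact: linearDl. Qed.
Lemma nopDr e A B B' : nop e A (B + B') = nop e A B + nop e A B'.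
Proof. exact: linearDr. Qed.
Lemma nopNl e A B : nop e (- A) B = - nop e A B.
Proof. exact: linearNl. Qed.
Lemma nopNr e A B : nop e A (- B) = - nop e A B.
Proof. exact: linearNr. Qed.
Lemma nop_suml e (I : finType) (A : I -> vfield) B :
  nop e (\sum_i A i) B = \sum_i nop e (A i) B.
Proof. exact: linear_sumlz. Qed.
Lemma nop_sumr e (I : finType) (B : I -> vfield) A :
  nop e A (\sum_i B i) = \sum_i nop e A (B i).
Proof. exact: linear_sumr. Qed.

Lemma br31Zl b D : br3 false (b *: vone) D 0 0 0.
Proof. by have := br3_Zl b (br31l D); rewrite !scaler0. Qed.
Lemma vdZ1 b : vd (b *: vone) = 0 :> vfield.
Proof. by rewrite linearZ /= vd1 scaler0. Qed.

Lemma wick_const p A B D b d0 d1 d2 :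
  br3 true A B (b *: vone) 0 0 -> br3 p A D d0 d1 d2 ->
  br3 (~~ p) A (nop p B D) (b *: D - nop (~~ p) B d0)
    (- nop (~~ p) B d1) (- nop (~~ p) B d2).
Proof.
move=> HB HD; have [S0 S1] : sg true = -1 :> C /\ p (+) p = false.
  by split=> //; rewrite addbb.
have H0 : br3 (p (+) p) (b *: vone) D 0 0 0 by rewrite S1; apply: br31Zl.
have H1 : br3 (p (+) p) 0 D 0 0 0 by apply: br30l.
apply: (br3_eq (wick HB HD H0 H1)).
- by rewrite nopZl nop1l S0 scaleN1r.
- by rewrite nop0l S0 scaleN1r add0r addr0.
- by rewrite S0 scaleN1r scaler0 !addr0.
Qed.

(** The auxiliary bracket of k times the identity field with [D] carries the sign bit [e]. The
    identity commutes with everything, so when [e] is the bit of two odd fields, k has to vanish. *)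
Lemma wick_even e A B D c0 k d0 d1 d2 f0 f1 :
  br3 false A B c0 (k *: vone) 0 -> br3 false A D d0 d1 d2 ->
  br3 e c0 D f0 f1 0 -> (e ==> (k == 0)) ->
  br3 false A (nop e B D) (nop e c0 D + nop e B d0)
    (k *: D + nop e B d1 + f0) (nop e B d2 + f1).
Proof.
move=> HB HD Hc ek.
have H1 : br3 (false (+) e) (k *: vone) D 0 0 0.
  case: e ek {Hc} => [/eqP ->|_]; last exact: br31Zl.
  by rewrite scale0r; apply: br30l.
apply: (br3_eq (wick HB HD Hc H1)).
- by rewrite [sg _]expr0 scale1r.
- by rewrite nopZl nop1l [sg _]expr0 scale1r.
- by rewrite [sg _]expr0 scale1r scaler0 addr0.
Qed.

Lemma wick_even0 e A B D c0 d0 d1 d2 f0 f1 :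
  br3 false A B c0 0 0 -> br3 false A D d0 d1 d2 -> br3 e c0 D f0 f1 0 ->
  br3 false A (nop e B D) (nop e c0 D + nop e B d0)
    (nop e B d1 + f0) (nop e B d2 + f1).
Proof.
move=> HB HD Hc; have HB' : br3 false A B c0 (0 *: vone) 0 by rewrite scale0r.
have ek : e ==> (0 == 0 :> C) by rewrite eqxx implybT.
by have := wick_even HB' HD Hc ek; rewrite scale0r add0r.
Qed.

Lemma skew_odd A B c : br3 true A B c 0 0 -> br3 true B A c 0 0.
Proof.
move=> H; apply: (br3_eq (br3_skew H)); rewrite !linear0 ?addr0 ?scaler0 //.
by rewrite [sg true]expr1; vmod C; ring.
Qed.

Lemma skew_even A B c (c1 : vfield) : br3 false A B c c1 0 -> br3 false B A (vd c1 - c) c1 0.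
Proof.
move=> H; apply: (br3_eq (br3_skew H)); rewrite ?linear0 ?addr0 ?scaler0 ?[sg false]expr0 ?scale1r //.
by vmod C; ring.
Qed.

End SpecialWick.

Section DiracCurrent.
Context (C : numFieldType) (V : lmodType C) (g : vectType C).
Local Notation vfield := (vfield V).
Context (br : {bilinear g -> g -> g}) (ip : {biscalar g}) (gp gm : {vspace g}).
Context (Hpair : manin_pair br ip gp gm).
Context (n : nat) (x y : n.-tuple g) (Hxy : dual_bases ip gp gm x y).
Context (J a : g -> vfield).
Context (JL : forall s u v, J (s *: u + v) = s *: J u + J v).
Context (aL : forall s u v, a (s *: u + v) = s *: a u + a v).
Context (Baa : forall u v, br3 true (a u) (a v) (ip u v *: vone) 0 0).
Context (BJa : forall u v, br3 false (J u) (a v) 0 0 0).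
Context (BJJ : forall u v, br3 false (J u) (J v) (J (br u v))
  ((ip u v - 2^-1 * killing br u v) *: vone) 0).
Implicit Types (X Y Z u v w z : g).
Local Notation e := (be x y).
Local Notation e' := (bd x y).
Local Notation kp := (kap br x y).

Definition theta X : vfield :=
  locked (2^-1 *: \sum_A nop true (a (br X (e A))) (a (e' A))).
Lemma thetaE X : theta X = 2^-1 *: \sum_A nop true (a (br X (e A))) (a (e' A)).
Proof. by rewrite /theta -lock. Qed.

Lemma sg1 : sg true = -1 :> C. Proof. by []. Qed.
Lemma sg0 : sg false = 1 :> C. Proof. by []. Qed.

Lemma aN u : a (- u) = - a u. Proof. exact: lin_funN. Qed.
Lemma aB u v : a (u - v) = a u - a v.
Proof. by rewrite -aN -[u in LHS]scale1r aL scale1r. Qed.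

Lemma a_sum (I : finType) (w : I -> g) : a (\sum_i w i) = \sum_i a (w i).
Proof.
transitivity (a (\sum_i 1 *: w i)); last rewrite lin_sum //.
  by congr a; apply: eq_bigr => i _; rewrite scale1r.
by apply: eq_bigr => i _; rewrite scale1r.
Qed.

Lemma blin_aa e0 (f h : g -> g) :
  (forall s u v, f (s *: u + v) = s *: f u + f v) ->
  (forall s u v, h (s *: u + v) = s *: h u + h v) ->
  blin (fun u v => nop e0 (a (f u)) (a (h v))).
Proof.
move=> fL hL; split=> s u v w; rewrite ?fL ?hL aL ?nopDl ?nopDr ?nopZl ?nopZr //.
Qed.

(** The contractions with the two fermions of [theta] agree because ad X is skew-adjoint; together
    they cancel the factor 1/2. *)
Lemma a_theta X Y : br3 false (a Y) (theta X) (- a (br X Y)) 0 0.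
Proof.
rewrite thetaE.
apply: (br3_eq (br3_Zr 2^-1 (br3_sumr (fun A =>
  wick_const (Baa Y (br X (e A))) (Baa Y (e' A)))))).
- rewrite sumrB.
  rewrite (eq_bigr (fun A => ip (br Y X) (e A) *: a (e' A))) => [|A _]; last first.
    by rewrite (ip_br Hpair).
  rewrite (dual_contract Hpair Hxy _ aL).
  rewrite (eq_bigr (fun A => ip Y (e' A) *: a (br X (e A)))) => [|A _]; last first.
    by rewrite nopZr nop1r.
  rewrite (dual_contractC Hpair Hxy (F := fun z => a (br X z))); last first.
    by move=> s u v; rewrite brR aL.
  rewrite (brC Hpair Y) aN.
  by vmod C; field.
- by rewrite big1 ?scaler0 // => A _; rewrite nop0r oppr0.
- by rewrite big1 ?scaler0 // => A _; rewrite nop0r oppr0.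
Qed.

Lemma theta_a X Y : br3 false (theta X) (a Y) (a (br X Y)) 0 0.
Proof.
apply: (br3_eq (br3_skew (a_theta X Y))).
- by rewrite sg0 !linear0 scaleN1r; vmod C; field.
- by rewrite !linear0 addr0 scaler0.
- by rewrite scaler0.
Qed.

Lemma aa_anti u v : nop true (a u) (a v) = - nop true (a v) (a u).
Proof.
by rewrite (nop_comm (Baa u v)) sg1 vdZ1 !linear0 !addr0 scaleN1r.
Qed.

Lemma theta_lin s X Y : theta (s *: X + Y) = s *: theta X + theta Y.
Proof.
rewrite !thetaE !scaler_sumr -big_split; apply: eq_bigr => A _.
rewrite brL aL nopDl nopZl /=.
by vmod C; ring.
Qed.

(** Single contractions recombine into the commutator by invariance of the canonical tensor. The
    double contraction is the trace of ad X ad Y, halved by the normalization of [theta]. *)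
Lemma theta_theta X Y : br3 false (theta X) (theta Y) (theta (br X Y))
  ((2^-1 * killing br X Y) *: vone) 0.
Proof.
rewrite [theta Y]thetaE.
apply: (br3_eq (br3_Zr 2^-1 (br3_sumr (fun A =>
  wick_even0 (theta_a X (br Y (e A))) (theta_a X (e' A)) (Baa _ _))))).
- rewrite thetaE; congr (_ *: _); rewrite big_split /=.
  have := dual_invariant Hpair Hxy (B := fun u v => nop true (a (br Y u)) (a v)) X.
  move=> E; rewrite [X in _ + X](_ : _ = - \sum_A nop true (a (br Y (br X (e A)))) (a (e' A))).
    rewrite -sumrB; apply: eq_bigr => A _.
    by rewrite (br_br Hpair) aB nopDl nopNl.
  apply/eqP; rewrite eq_sym eqr_oppLR; apply/eqP; apply: E.
  by apply: blin_aa => *; rewrite ?brR.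
- under eq_bigr do rewrite nop0r add0r.
  by rewrite -scaler_suml scalerA (killing_dual Hpair Hxy).
- by rewrite big1 ?scaler0 // => A _; rewrite nop0r addr0.
Qed.

Lemma theta_flip X : \sum_A nop true (a (e' A)) (a (br X (e A))) = - 2 *: theta X.
Proof.
rewrite thetaE scalerA mulNr divff ?pnatr_eq0 // scaleN1r -sumrN.
by apply: eq_bigr => A _; rewrite aa_anti.
Qed.

Let vdL s (A B : vfield) : vd (s *: A + B) = s *: vd A + vd B.
Proof. exact: vd_lin. Qed.
Let kapL := kap_lin br x y.
Let linE := (aL, JL, theta_lin, brL, brR, vdL, kapL,
  @nopDl C V, @nopDr C V, @nopZl C V, @nopZr C V).
Ltac blin_tac := split=> ? ? ? ?; rewrite ?linE //.

Definition cubic : vfield := 3^-1 *: \sum_A nop false (a (e' A)) (theta (e A)).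
Definition Scur : vfield := \sum_A nop false (a (e' A)) (J (e A)).
Definition Icur X : vfield := J X + theta X.
(** The simple pole of J(X).S. By invariance theta(X).S has the opposite one, which is why the sum J
    + theta has no simple pole with [Dcur]. *)
Definition Mcur X : vfield :=
  locked (\sum_A nop false (a (e' A)) (J (br X (e A)))).
Lemma McurE X : Mcur X = \sum_A nop false (a (e' A)) (J (br X (e A))).
Proof. by rewrite /Mcur -lock. Qed.
(** The shifted level as an endomorphism: (X, Y) minus half the Killing form equals (ell X, Y). *)
Definition ell X : g := X - 2^-1 *: kp X.

(** Contraction with the explicit fermion gives [theta] once, contraction inside [theta] gives it
    twice; the factor 1/3 of [cubic] compensates. *)
Lemma a_cubic X : br3 true (a X) cubic (theta X) 0 0.
Proof.
apply: (br3_eq (br3_Zr 3^-1 (br3_sumr (fun A =>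
  wick_const (Baa X (e' A)) (a_theta (e A) X))))).
- rewrite sumrB (dual_contractC Hpair Hxy _ theta_lin).
  rewrite (eq_bigr (fun A => nop true (a (e' A)) (a (br X (e A))))) => [|A _].
    by rewrite theta_flip; vmod C; field.
  by rewrite (brC Hpair (e A)) aN opprK.
- by rewrite big1 ?scaler0 // => A _; rewrite nop0r oppr0.
- by rewrite big1 ?scaler0 // => A _; rewrite nop0r oppr0.
Qed.

Lemma theta_cubic X : br3 false (theta X) cubic 0 (2^-1 *: a (kp X)) 0.
Proof.
apply: (br3_eq (br3_Zr 3^-1 (br3_sumr (fun A =>
  wick_even0 (theta_a X (e' A)) (theta_theta X (e A)) (a_theta (e A) (br X (e' A))))))).
- rewrite big_split /= (dual_invariantC Hpair Hxy (B := fun u v => nop false (a u) (theta v))).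
    by rewrite addNr scaler0.
  by blin_tac.
- rewrite big_split /=.
  rewrite (eq_bigr (fun A => (2^-1 * ip (kp X) (e A)) *: a (e' A))) => [|A _]; last first.
    by rewrite nopZr nop1r (killing_kap Hpair Hxy) (kapC Hpair).
  under eq_bigr do rewrite -scalerA.
  rewrite -scaler_sumr (dual_contract Hpair Hxy _ aL).
  rewrite (_ : \sum_A - a (br (e A) (br X (e' A))) = a (kp X)); last first.
    rewrite /kap a_sum; apply: eq_bigr => A _.
    by rewrite -aN -linearNr -(brC Hpair).
  by vmod C; field.
- by rewrite big1 ?scaler0 // => A _; rewrite nop0r addr0.
Qed.

Lemma J_theta X Y : br3 false (J X) (theta Y) 0 0 0.
Proof.
rewrite [theta Y]thetaE.
apply: (br3_eq (br3_Zr 2^-1 (br3_sumr (fun A =>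
  wick_even0 (BJa X (br Y (e A))) (BJa X (e' A)) (br30l true _))))).
- by rewrite big1 ?scaler0 // => A _; rewrite nop0l nop0r addr0.
- by rewrite big1 ?scaler0 // => A _; rewrite nop0r addr0.
- by rewrite big1 ?scaler0 // => A _; rewrite nop0r addr0.
Qed.

Lemma J_cubic X : br3 false (J X) cubic 0 0 0.
Proof.
apply: (br3_eq (br3_Zr 3^-1 (br3_sumr (fun A =>
  wick_even0 (BJa X (e' A)) (J_theta X (e A)) (br30l false _))))).
- by rewrite big1 ?scaler0 // => A _; rewrite nop0l nop0r addr0.
- by rewrite big1 ?scaler0 // => A _; rewrite nop0r addr0.
- by rewrite big1 ?scaler0 // => A _; rewrite nop0r addr0.
Qed.

Lemma a_J X Y : br3 false (a X) (J Y) 0 0 0.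
Proof.
by apply: (br3_eq (br3_skew (BJa Y X))); rewrite !linear0 ?addr0 ?scaler0.
Qed.

Lemma a_S X : br3 true (a X) Scur (J X) 0 0.
Proof.
apply: (br3_eq (br3_sumr (fun A => wick_const (Baa X (e' A)) (a_J X (e A))))).
- rewrite sumrB (dual_contractC Hpair Hxy _ JL) big1 ?subr0 // => A _.
  by rewrite nop0r.
- by rewrite big1 // => A _; rewrite nop0r oppr0.
- by rewrite big1 // => A _; rewrite nop0r oppr0.
Qed.

Lemma J_S X : br3 false (J X) Scur (Mcur X) (a (ell X)) 0.
Proof.
rewrite McurE.
apply: (br3_eq (br3_sumr (fun A =>
  wick_even0 (BJa X (e' A)) (BJJ X (e A)) (br30l false _)))).
- by apply: eq_bigr => A _; rewrite nop0l add0r.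
- rewrite (eq_bigr (fun A => ip (ell X) (e A) *: a (e' A))) => [|A _].
    by rewrite (dual_contract Hpair Hxy _ aL).
  rewrite nopZr nop1r addr0 (killing_kap Hpair Hxy) -(kapC Hpair).
  by congr (_ *: _); rewrite /ell (addrC X) -scaleNr ipL; ring.
- by rewrite big1 // => A _; rewrite nop0r addr0.
Qed.

Lemma theta_J X Y : br3 false (theta X) (J Y) 0 0 0.
Proof.
by apply: (br3_eq (br3_skew (J_theta Y X))); rewrite !linear0 ?addr0 ?scaler0.
Qed.

Lemma theta_S X : br3 false (theta X) Scur (- Mcur X) 0 0.
Proof.
rewrite McurE.
apply: (br3_eq (br3_sumr (fun A =>
  wick_even0 (theta_a X (e' A)) (theta_J X (e A)) (a_J _ _)))).
- under eq_bigr do rewrite nop0r addr0.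
  rewrite (dual_invariantC Hpair Hxy (B := fun u v => nop false (a u) (J v))) //.
  by blin_tac.
- by rewrite big1 // => A _; rewrite nop0r addr0.
- by rewrite big1 // => A _; rewrite nop0r addr0.
Qed.

Definition Dcur : vfield := Scur + cubic.

Lemma a_ell X : a (ell X) = a X - 2^-1 *: a (kp X).
Proof. by rewrite /ell aB -[2^-1 *: kp X]addr0 aL (lin_fun0 aL) addr0. Qed.

Lemma Icur_D X : br3 false (Icur X) Dcur 0 (a X) 0.
Proof.
apply: (br3_eq (br3_Dl (br3_Dr (J_S X) (J_cubic X)) (br3_Dr (theta_S X) (theta_cubic X)))).
- by rewrite !addr0 subrr.
- by rewrite a_ell; vmod C; ring.
- by rewrite !addr0.
Qed.

Lemma a_D X : br3 true (a X) Dcur (Icur X) 0 0.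
Proof. by apply: (br3_eq (br3_Dr (a_S X) (a_cubic X))); rewrite ?addr0. Qed.

Lemma J_pair0 : \sum_A J (br (e' A) (e A)) = 0.
Proof.
apply: (dual_antisym Hpair Hxy (B := fun u v => J (br u v)) (f := id)) => //; first by blin_tac.
by move=> u v; rewrite (brC Hpair u) (lin_funN _ JL).
Qed.

Lemma S_S : br3 true Scur Scur
  (\sum_A nop false (J (e' A)) (J (e A)) + \sum_A nop true (a (e' A)) (Mcur (e A))
   - \sum_A nop true (a (e' A)) (vd (a (ell (e A))))) 0
  ((\sum_A (ip (e' A) (e A) - 2^-1 * killing br (e' A) (e A))) *: vone).
Proof.
apply: (br3_eq (br3_sumr (fun A => wick (skew_odd (a_S (e' A)))
  (skew_even (J_S (e A))) (BJJ (e' A) (e A)) (br30l _ _)))).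
- rewrite big_split /= -addrA; congr (_ + _); rewrite -sumrB; apply: eq_bigr => A _.
  by rewrite sg1 nopDr nopNr; vmod C; ring.
- rewrite !big_split /= J_pair0 addr0.
  rewrite big1 => [|A _]; last by rewrite nop0l.
  rewrite add0r -scaler_sumr.
  rewrite (dual_antisym Hpair Hxy (B := fun u v => nop true (a u) (a v)) (f := ell)) ?scaler0 //.
  + by blin_tac.
  + exact: aa_anti.
  + move=> u v; rewrite /ell linearBl linearBr linearZl_LR linearZr_LR /=.
    by rewrite (kapC Hpair).
- rewrite scaler_suml; apply: eq_bigr => A _.
  by rewrite nop0r !scaler0 add0r addr0.
Qed.

Lemma S_cubic : br3 true Scur cubic
  (3^-1 *: (\sum_A nop false (J (e' A)) (theta (e A))
    - \sum_A nop true (a (e' A)) (Mcur (e A)))) 0 0.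
Proof.
apply: (br3_eq (br3_Zr 3^-1 (br3_sumr (fun A => wick (skew_odd (a_S (e' A)))
  (skew_even (theta_S (e A))) (J_theta (e' A) (e A)) (br30l _ _))))).
- congr (_ *: _); rewrite -sumrB; apply: eq_bigr => A _.
  by rewrite linear0 sub0r opprK sg1 scaleN1r.
- by rewrite big1 ?scaler0 // => A _; rewrite nop0l nop0r scaler0 !addr0.
- by rewrite big1 ?scaler0 // => A _; rewrite nop0r !scaler0 !addr0.
Qed.

Lemma theta_pair0 : \sum_A theta (br (e' A) (e A)) = 0.
Proof.
apply: (dual_antisym Hpair Hxy (B := fun u v => theta (br u v)) (f := id)) => //; first by blin_tac.
by move=> u v; rewrite (brC Hpair u) (lin_funN _ theta_lin).
Qed.

Lemma cubic_cubic : br3 true cubic cubic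
  (3^-1 *: (\sum_A nop false (theta (e' A)) (theta (e A))
    - 2^-1 *: \sum_A nop true (a (e' A)) (vd (a (kp (e A)))))) 0
  ((3^-1 * \sum_A (2^-1 * killing br (e' A) (e A))) *: vone).
Proof.
apply: (br3_eq (br3_Zr 3^-1 (br3_sumr (fun A => wick (skew_odd (a_cubic (e' A)))
  (skew_even (theta_cubic (e A))) (theta_theta (e' A) (e A)) (br30l _ _))))).
- congr (_ *: _); rewrite scaler_sumr -sumrB; apply: eq_bigr => A _.
  by rewrite subr0 sg1 scaleN1r linearZ /= nopZr.
- rewrite !big_split /= theta_pair0 addr0.
  rewrite big1 => [|A _]; last by rewrite nop0l.
  rewrite add0r (eq_bigr (fun A => (- 2^-1) *: nop true (a (e' A)) (a (kp (e A))))) => [|A _].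
    rewrite -scaler_sumr (dual_antisym Hpair Hxy (B := fun u v => nop true (a u) (a v)) (f := kp)) ?scaler0 //.
    + by blin_tac.
    + exact: aa_anti.
    + exact: (kapC Hpair x y).
  by rewrite nopZr sg1; vmod C; ring.
- rewrite -scalerA scaler_suml; congr (_ *: _); apply: eq_bigr => A _.
  by rewrite nop0r !scaler0 add0r addr0.
Qed.

Lemma aJ_swap u v z :
  nop true (a u) (nop false (a v) (J z)) = nop false (J z) (nop true (a u) (a v)).
Proof.
rewrite (nop_comm (a_J v z)) !linear0 !addr0 sg0 scale1r.
have -> := nop_swap (eab := false) true false (a v) (a_J u z).
by rewrite linear0 nop0l addr0 sg0 scale1r.
Qed.

Lemma aa_swap u v D0 :
  nop true (a u) (nop false (a v) D0) = - nop true (a v) (nop false (a u) D0).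
Proof.
have -> := nop_swap (eab := true) false false D0 (Baa u v).
by rewrite vdZ1 nop0l addr0 sg1 scaleN1r.
Qed.

Lemma aa_swap_odd u v D0 :
  nop false (a u) (nop true (a v) D0) = - nop false (a v) (nop true (a u) D0).
Proof.
have -> := nop_swap (eab := true) true true D0 (Baa u v).
by rewrite vdZ1 nop0l addr0 sg1 scaleN1r.
Qed.

(** Makes the mixed terms of D.D cancel: writing M for the sum on the right, S.S contributes M, and
    each of the two products of S with the cubic term contributes (-1/2 - 1) M / 3 = - M / 2. *)
Lemma J_theta_sum : \sum_A nop false (J (e' A)) (theta (e A)) =
  - 2^-1 *: \sum_A nop true (a (e' A)) (Mcur (e A)).
Proof.
have -> : \sum_A nop true (a (e' A)) (Mcur (e A)) =
    \sum_B \sum_A nop false (J (br (e A) (e B))) (nop true (a (e' A)) (a (e' B))).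
  rewrite exchange_big; apply: eq_bigr => A _ /=; rewrite McurE nop_sumr.
  by apply: eq_bigr => B _; rewrite aJ_swap.
have -> : \sum_A nop false (J (e' A)) (theta (e A)) = 2^-1 *:
    \sum_B \sum_A nop false (J (e' A)) (nop true (a (br (e A) (e B))) (a (e' B))).
  rewrite exchange_big scaler_sumr; apply: eq_bigr => A _ /=.
  by rewrite thetaE nopZr nop_sumr.
rewrite !scaler_sumr; apply: eq_bigr => B _; rewrite scaleNr -scalerN; congr (_ *: _).
rewrite -sumrN.
transitivity (- \sum_A nop false (J (e' A)) (nop true (a (br (e B) (e A))) (a (e' B)))).
  rewrite -sumrN; apply: eq_bigr => A _.
  by rewrite (brC Hpair) aN nopNl nopNr.
rewrite -(dual_invariantC Hpair Hxy
  (B := fun u v => nop false (J u) (nop true (a v) (a (e' B))))); last by blin_tac.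
rewrite -(sum_dualC x y (fun u v => nop false (J (br (e B) u)) (nop true (a v) (a (e' B))))).
apply: eq_bigr => A _.
by rewrite (brC Hpair) (lin_funN _ JL) nopNl.
Qed.

Let aaaa u v z w := nop true (a u) (nop false (a v) (nop true (a z) (a w))).

Let aaaa_rot u v z w : aaaa u v z w = aaaa u z w v.
Proof. by rewrite /aaaa aa_swap_odd (aa_anti v w) !nopNr opprK. Qed.

Let aaaa_front u v z w : aaaa u v z w = aaaa z u v w.
Proof.
by rewrite /aaaa aa_swap_odd nopNr aa_swap opprK.
Qed.

Let sum3_rot (I : finType) (M : zmodType) (f : I -> I -> I -> M) :
  \sum_A \sum_B \sum_D f A B D = \sum_A \sum_B \sum_D f B D A.
Proof.
rewrite [RHS]exchange_big; apply: eq_bigr => A _.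
by rewrite [RHS]exchange_big.
Qed.

(* The quartic part of the square of the cubic term vanishes by Jacobi. *)
Lemma quartic0 : \sum_A \sum_B
  nop true (a (br (e A) (e B))) (nop false (a (e' B)) (theta (e' A))) = 0.
Proof.
have -> : \sum_A \sum_B
    nop true (a (br (e A) (e B))) (nop false (a (e' B)) (theta (e' A))) =
    2^-1 *: \sum_A \sum_B \sum_D
      aaaa (br (br (e B) (e A)) (e D)) (e' A) (e' B) (e' D).
  transitivity (2^-1 *: \sum_B \sum_D \sum_A
      aaaa (br (e A) (e B)) (e' B) (br (e' A) (e D)) (e' D)).
    rewrite exchange_big scaler_sumr; apply: eq_bigr => B _ /=.
    rewrite exchange_big scaler_sumr; apply: eq_bigr => A _ /=.
    by rewrite thetaE nopZr nopZr nop_sumr nop_sumr.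
  congr (_ *: _); rewrite [RHS]exchange_big; apply: eq_bigr => B _ /=.
  rewrite [RHS]exchange_big; apply: eq_bigr => D _ /=.
  transitivity (- \sum_A aaaa (br (e B) (e A)) (e' B) (br (e' A) (e D)) (e' D)).
    rewrite -sumrN; apply: eq_bigr => A _.
    by rewrite /aaaa (brC Hpair) aN nopNl.
  rewrite (dual_invariant Hpair Hxy
    (B := fun u v => aaaa u (e' B) (br v (e D)) (e' D))); last by rewrite /aaaa; blin_tac.
  rewrite opprK (sum_dualC x y (fun u v => aaaa u (e' B) (br (br (e B) v) (e D)) (e' D))).
  by apply: eq_bigr => A _; rewrite -aaaa_front.
set S := \sum_A _.
pose f A B D := aaaa (br (br (e B) (e A)) (e D)) (e' A) (e' B) (e' D).
(* The string a^A a^B a^D is unchanged by cyclic relabelling, so S equals each of its rotations;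
   their sum carries the Jacobi combination in its first slot. *)
have S1 : S = \sum_A \sum_B \sum_D f A B D by [].
have S2 : S = \sum_A \sum_B \sum_D f B D A by rewrite S1 sum3_rot.
have S3 : S = \sum_A \sum_B \sum_D f D A B by rewrite S2 sum3_rot.
suff : S + S + S = 0.
  move=> S0; rewrite (_ : S = 0) ?scaler0 //.
  by apply: (linear_comb1 (c := 1 / 3) S0); vmod C; field.
rewrite {1}S1 {1}S2 S3 -!big_split /=; apply: big1 => A _.
rewrite -!big_split /=; apply: big1 => B _.
rewrite -!big_split /=; apply: big1 => D _.
rewrite /f (aaaa_rot _ (e' A)) -[in X in _ + X]aaaa_rot /aaaa -!nopDl.
have aD u v : a (u + v) = a u + a v by rewrite -[u in LHS]scale1r aL scale1r.
rewrite -!aD.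
have -> : br (br (e B) (e A)) (e D) + br (br (e D) (e B)) (e A)
  + br (br (e A) (e D)) (e B) = 0.
  rewrite !(brC Hpair (br _ _)).
  apply: (linear_comb1 (c := -1) (jacobi Hpair (e A) (e D) (e B))).
  by vmod C; ring.
by rewrite (lin_fun0 aL) nop0l.
Qed.

Lemma a_vda u v : br3 true (a u) (vd (a v)) 0 (ip u v *: vone) 0.
Proof.
apply: (br3_eq (br3_dr (Baa u v))); first exact: vdZ1.
  by rewrite linear0 add0r.
by rewrite scaler0.
Qed.

Lemma vda_anti u v : nop true (vd (a u)) (a v) = - nop true (a v) (vd (a u)).
Proof.
have H : br3 true (vd (a u)) (a v) 0 ((- ip u v) *: vone) 0.
  by apply: (br3_eq (br3_dl (Baa u v))); rewrite ?scaler0 ?scaleNr.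
by rewrite (nop_comm H) vdZ1 !linear0 sg1 scaleN1r !addr0.
Qed.

(** Normal reordering leaves a quartic term, which vanishes, and two equal quadratic ones. With K
    the sum on the right without its sign, the cubic square contributes (-1 - 1/2) K / 3 = - K / 2
    to D.D, against the + K / 2 that the shift of the level puts into S.S. *)
Lemma theta_theta_sum : \sum_A nop false (theta (e' A)) (theta (e A)) =
  - \sum_A nop true (a (e' A)) (vd (a (kp (e A)))).
Proof.
have E A B : nop false (theta (e' A)) (nop true (a (br (e A) (e B))) (a (e' B))) =
    nop true (a (br (e A) (e B))) (nop false (a (e' B)) (theta (e' A)))
    + nop true (a (br (e A) (e B))) (vd (a (br (e' A) (e' B))))
    + nop true (vd (a (br (e' A) (br (e A) (e B))))) (a (e' B)).
  have -> := nop_swap (eab := false) false true (a (e' B))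
    (theta_a (e' A) (br (e A) (e B))).
  rewrite sg0 scale1r (nop_comm (theta_a (e' A) (e' B))) !linear0 !addr0 sg0 scale1r.
  by rewrite nopDr.
have -> : \sum_A nop false (theta (e' A)) (theta (e A)) = 2^-1 *: \sum_A \sum_B
    nop false (theta (e' A)) (nop true (a (br (e A) (e B))) (a (e' B))).
  rewrite scaler_sumr; apply: eq_bigr => A _.
  by rewrite [theta (e A)]thetaE nopZr nop_sumr.
under eq_bigr do under eq_bigr do rewrite E.
under eq_bigr do rewrite !big_split /=.
rewrite !big_split /= quartic0 add0r.
have -> : \sum_A \sum_B nop true (a (br (e A) (e B))) (vd (a (br (e' A) (e' B)))) =
    - \sum_A nop true (a (e' A)) (vd (a (kp (e A)))).
  transitivity (- \sum_A \sum_B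
      nop true (a (e' B)) (vd (a (br (e' A) (br (e A) (e B)))))).
    rewrite -sumrN; apply: eq_bigr => A _.
    rewrite (dual_invariant Hpair Hxy (B := fun u v =>
      nop true (a u) (vd (a (br (e' A) v))))); last by blin_tac.
    by rewrite (sum_dualC x y (fun u v => nop true (a u) (vd (a (br (e' A) (br (e A) v)))))).
  congr (- _); rewrite exchange_big; apply: eq_bigr => B _ /=.
  rewrite /kap (sum_dualC x y (fun u v => br u (br v (e B)))) a_sum linear_sum nop_sumr.
  by [].
have -> : \sum_A \sum_B nop true (vd (a (br (e' A) (br (e A) (e B))))) (a (e' B)) =
    - \sum_A nop true (a (e' A)) (vd (a (kp (e A)))).
  rewrite exchange_big -sumrN; apply: eq_bigr => B _ /=.
  rewrite -vda_anti.
  rewrite /kap (sum_dualC x y (fun u v => br u (br v (e B)))) a_sum linear_sum nop_suml.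
  by [].
by rewrite -opprD -mulr2n -scaler_nat scalerN scalerA mulVf ?scale1r ?pnatr_eq0.
Qed.

Definition T0cur : vfield :=
  \sum_A nop false (J (e' A)) (J (e A)) - \sum_A nop true (a (e' A)) (vd (a (e A))).

Lemma D_D : exists k, br3 true Dcur Dcur T0cur 0 (k *: vone).
Proof.
exists (\sum_A (ip (e' A) (e A) - 2^-1 * killing br (e' A) (e A))
  + 3^-1 * \sum_A (2^-1 * killing br (e' A) (e A))).
apply: (br3_eq (br3_Dl (br3_Dr S_S S_cubic) (br3_Dr (skew_odd S_cubic) cubic_cubic))).
- have Eell : \sum_A nop true (a (e' A)) (vd (a (ell (e A)))) =
      \sum_A nop true (a (e' A)) (vd (a (e A)))
      - 2^-1 *: \sum_A nop true (a (e' A)) (vd (a (kp (e A)))).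
    rewrite scaler_sumr -sumrB; apply: eq_bigr => A _.
    by rewrite a_ell linearB linearZ /= nopDr nopNr nopZr.
  rewrite theta_theta_sum J_theta_sum /T0cur Eell.
  set JJ := \sum_A nop false (J _) _; set M := \sum_A nop true _ (Mcur _).
  set P := \sum_A nop true _ (vd (a (e _))); set K := \sum_A nop true _ _.
  by vmod C; field.
- by rewrite !addr0.
- by rewrite addr0 add0r scalerDl.
Qed.

Local Notation tau := (tau ip x y).
Local Notation rho := (rho br x y).

Definition ucur : vfield := \sum_(i < n) nop true (a y`_i) (a x`_i).
Definition Ucur X : vfield := 2^-1 *: \sum_A
  (nop true (a (tau (br X (e A)))) (a (e' A)) + nop true (a (br X (e A))) (a (tau (e' A)))).

Lemma u_a Z : br3 false ucur (a Z) (a (tau Z)) 0 0.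
Proof.
have H : br3 false (a Z) ucur (- a (tau Z)) 0 0.
  apply: (br3_eq (br3_sumr (fun i : 'I_n => wick_const (Baa Z y`_i) (Baa Z x`_i)))).
  - rewrite -aN /tau -sumrN a_sum; apply: eq_bigr => i _.
    rewrite nopZr nop1r opprD scaleNr opprK -(scaleNr _ y`_i).
    rewrite aL -[- _ *: y`_i]addr0 aL (lin_fun0 aL).
    by vmod C; ring.
  - by rewrite big1 // => i _; rewrite nop0r oppr0.
  - by rewrite big1 // => i _; rewrite nop0r oppr0.
by apply: (br3_eq (skew_even H)); rewrite // linear0 sub0r opprK.
Qed.

Lemma u_J X : br3 false ucur (J X) 0 0 0.
Proof.
have H : br3 false (J X) ucur 0 0 0.
  apply: (br3_eq (br3_sumr (fun i : 'I_n =>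
    wick_even0 (BJa X y`_i) (BJa X x`_i) (br30l true _)))).
  - by rewrite big1 // => i _; rewrite nop0l nop0r addr0.
  - by rewrite big1 // => i _; rewrite nop0r addr0.
  - by rewrite big1 // => i _; rewrite nop0r addr0.
by apply: (br3_eq (skew_even H)); rewrite // linear0 subr0.
Qed.

(** Here [rho] enters: the double contraction pairs X with the bracket of the canonical tensor
    through [tau], which is -2 rho. *)
Lemma u_theta X : br3 false ucur (theta X) (Ucur X) ((- ip X rho) *: vone) 0.
Proof.
rewrite thetaE; apply: (br3_eq (br3_Zr 2^-1 (br3_sumr (fun A =>
  wick_even0 (u_a (br X (e A))) (u_a (e' A)) (Baa _ _))))).
- by [].
- under eq_bigr do rewrite nop0r add0r.
  rewrite -scaler_suml scalerA; congr (_ *: _).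
  rewrite (eq_bigr (fun A => ip X (br (tau (e' A)) (e A)))) => [|A _]; last first.
    by rewrite (tauC Hpair) -linearNr (ip_br Hpair) (brC Hpair) linearNl opprK.
  rewrite -linear_sumr -(sum_dualC x y (fun u v => br (tau u) v)) (rho_tau Hpair Hxy).
  by rewrite linearZr_LR /=; field.
- by rewrite big1 ?scaler0 // => A _; rewrite nop0r addr0.
Qed.

(** [tau] is skew-adjoint and may be moved from one leg to the other; once it commutes with ad X the
    two terms are opposite. *)
Lemma Ucur0 X : (forall z, tau (br X z) = br X (tau z)) -> Ucur X = 0.
Proof.
move=> HX; rewrite /Ucur big_split /=.
rewrite -(dual_adjoint Hpair Hxy (B := fun u v => nop true (a (br X u)) (a v))
  (f := fun z => - tau z)).
- rewrite -big_split big1 ?scaler0 // => A _.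
  by rewrite /= HX linearNr aN nopNl subrr.
- by blin_tac.
- by move=> u v; rewrite linearNl (tauC Hpair) opprK.
Qed.

(** The simple pole is left unnamed, since the charges of G^+, G^- and Phi determine it later. What
    counts is the double pole - a(rho). *)
Lemma u_cubic : exists c, br3 false ucur cubic c (- a rho) 0.
Proof.
eexists; apply: (br3_eq (br3_Zr 3^-1 (br3_sumr (fun A =>
  wick_even0 (u_a (e' A)) (u_theta (e A)) (a_theta (e A) (tau (e' A))))))).
- by [].
- rewrite big_split /=.
  rewrite (eq_bigr (fun A => - (ip rho (e A) *: a (e' A)))) => [|A _]; last first.
    by rewrite nopZr nop1r scaleNr (ipC Hpair).
  rewrite sumrN (dual_contract Hpair Hxy _ aL).
  rewrite (_ : \sum_A - a (br (e A) (tau (e' A))) = a (- 2 *: rho)).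
    by rewrite -[-2 *: _]addr0 aL (lin_fun0 aL); vmod C; field.
  rewrite -(rho_tau Hpair Hxy) (sum_dualC x y (fun u v => br (tau u) v)) a_sum.
  by apply: eq_bigr => A _; rewrite -aN -(brC Hpair).
- by rewrite big1 ?scaler0 // => A _; rewrite nop0r addr0.
Qed.

Lemma u_D : exists c, br3 false ucur Dcur c (- a rho) 0.
Proof.
have [c Hc] := u_cubic; eexists; apply: (br3_eq (br3_Dr (br3_sumr (fun A =>
  wick_even0 (u_a (e' A)) (u_J (e A)) (a_J (tau (e' A)) (e A)))) Hc)).
- by [].
- by rewrite big1 ?add0r // => A _; rewrite nop0r addr0.
- by rewrite big1 ?addr0 // => A _; rewrite nop0r addr0.
Qed.

Lemma I_a X Y : br3 false (Icur X) (a Y) (a (br X Y)) 0 0.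
Proof. by apply: (br3_eq (br3_Dl (BJa X Y) (theta_a X Y))); rewrite ?addr0 ?add0r. Qed.

Lemma I_J X Y : br3 false (Icur X) (J Y) (J (br X Y))
  ((ip X Y - 2^-1 * killing br X Y) *: vone) 0.
Proof. by apply: (br3_eq (br3_Dl (BJJ X Y) (theta_J X Y))); rewrite ?addr0. Qed.

Lemma I_I X Y : br3 false (Icur X) (Icur Y) (Icur (br X Y)) (ip X Y *: vone) 0.
Proof.
apply: (br3_eq (br3_Dl (br3_Dr (BJJ X Y) (J_theta X Y))
  (br3_Dr (theta_J X Y) (theta_theta X Y)))); rewrite ?addr0 ?add0r //.
by rewrite -scalerDl subrK.
Qed.

Lemma pair_flip : \sum_A nop true (a (e' A)) (a (tau (e A))) = - 2 *: ucur.
Proof.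
rewrite -(sum_dualC x y (fun u v => nop true (a u) (a (tau v)))).
rewrite (sum_dual x y (fun u v => nop true (a u) (a (tau v)))) scaler_sumr.
apply: eq_bigr => i _; rewrite (tau_x Hpair Hxy) (tau_y Hpair Hxy) aN nopNr.
by rewrite aa_anti; vmod C; ring.
Qed.

Lemma ellC u v : ip (ell u) v = ip u (ell v).
Proof.
by rewrite /ell linearBl linearBr linearZl_LR linearZr_LR /= (kapC Hpair).
Qed.

Lemma level_ell u v : ip u v - 2^-1 * killing br u v = ip (ell u) v.
Proof.
rewrite (killing_kap Hpair Hxy) -(kapC Hpair).
by rewrite /ell (addrC u) -scaleNr ipL; ring.
Qed.

Lemma br_ell_pair0 : \sum_A br (e' A) (ell (e A)) = 0.
Proof.
apply: (dual_antisym Hpair Hxy (B := fun u v => br u v) (f := ell)).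
- by blin_tac.
- exact: brC Hpair.
- exact: ellC.
Qed.

Lemma vd_br3 A u v w : br3 false A (a u) (a w) 0 0 -> v = w ->
  br3 false A (vd (a u)) (vd (a v)) (a v) 0.
Proof.
by move=> H ->; apply: (br3_eq (br3_dr H)); rewrite ?linear0 ?add0r ?scaler0.
Qed.

(** A skew-adjoint [f] preserves the canonical tensor, so there is no simple pole, and it has trace
    zero, so there is no third order pole. *)
Lemma even_avda (Q : vfield) (f : g -> g) :
  (forall u, br3 false Q (a u) (a (f u)) 0 0) ->
  (forall s u v, f (s *: u + v) = s *: f u + f v) ->
  (forall u v, ip (f u) v = - ip u (f v)) ->
  br3 false Q (\sum_A nop true (a (e' A)) (vd (a (e A)))) 0
    (\sum_A nop true (a (e' A)) (a (f (e A)))) 0.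
Proof.
move=> H fL fC.
apply: (br3_eq (br3_sumr (fun A => wick_even0 (H (e' A))
  (vd_br3 (H (e A)) erefl) (a_vda (f (e' A)) (e A))))).
- rewrite big_split /= (eq_bigr (fun A => - nop true (a (- f (e' A))) (vd (a (e A))))) => [|A _].
    rewrite sumrN -(sum_dualC x y (fun u v => nop true (a (- f u)) (vd (a v)))).
    rewrite (dual_adjoint Hpair Hxy (B := fun u v => nop true (a u) (vd (a v)))
      (f := fun z => - f z) (h := f)).
    + rewrite (sum_dualC x y (fun u v => nop true (a u) (vd (a (f v))))).
      by rewrite addNr.
    + by blin_tac.
    + by move=> u v; rewrite linearNl fC opprK.
  by rewrite aN nopNl opprK.
- by apply: eq_bigr => A _; rewrite addr0.
- rewrite big_split /= big1 ?add0r => [|A _]; last by rewrite nop0r.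
  rewrite -scaler_suml (_ : \sum_A _ = 0) ?scale0r //.
  have E : \sum_A ip (f (e' A)) (e A) = - \sum_A ip (f (e' A)) (e A).
    rewrite -[in RHS](sum_dualC x y (fun u v => ip (f u) v)) -sumrN.
    by apply: eq_bigr => A _; rewrite fC (ipC Hpair).
  by apply: (linear_comb1 (V := C^o) (c := 1 / 2) E); rewrite /GRing.scale /=; field.
Qed.

(** In the J part the two single contractions contribute 2 ell X and the double contraction adds the
    Casimir of X: the sum is 2 X, so the shift by half the Killing form is exactly the Sugawara
    correction. *)
Lemma I_T0 X : br3 false (Icur X) T0cur 0 (2 *: Icur X) 0.
Proof.
have HJ : br3 false (Icur X) (\sum_A nop false (J (e' A)) (J (e A))) 0 (2 *: J X) 0.
  apply: (br3_eq (br3_sumr (fun A => wick_even (I_J X (e' A)) (I_J X (e A))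
    (BJJ (br X (e' A)) (e A)) isT))).
  - rewrite big_split /=.
    rewrite (dual_invariantC Hpair Hxy (B := fun u v => nop false (J u) (J v))).
      by rewrite addNr.
    by blin_tac.
  - rewrite !big_split /=.
    under eq_bigr do rewrite level_ell.
    rewrite (dual_contractC Hpair Hxy _ JL).
    rewrite (eq_bigr (fun A => ip (ell X) (e A) *: J (e' A))) => [|A _]; last first.
      by rewrite level_ell nopZr nop1r.
    rewrite (dual_contract Hpair Hxy _ JL).
    have -> : \sum_A J (br (br X (e' A)) (e A)) = J (kp X).
      transitivity (J (\sum_A (1 : C) *: br (br X (e' A)) (e A))).
        by rewrite lin_sum //; apply: eq_bigr => A _; rewrite scale1r.
      congr J; apply: eq_bigr => A _.
      by rewrite scale1r (brC Hpair) (brC Hpair X) linearNr opprK.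
    rewrite /ell (addrC X) -scaleNr JL.
    by vmod C; field.
  - rewrite big_split /= big1 ?add0r => [|A _]; last by rewrite nop0r.
    under eq_bigr do rewrite level_ell ellC (ip_br Hpair).
    by rewrite -scaler_suml -linear_sumr br_ell_pair0 linear0r scale0r.
have Ha := even_avda (I_a X) (brR br X) (fun u v => _).
apply: (br3_eq (br3_Dr HJ (br3_Nr (Ha _)))).
- by move=> u v; rewrite (brC Hpair) linearNl (ip_br Hpair).
- by rewrite oppr0 addr0.
- by rewrite theta_flip /Icur; vmod C; ring.
- by rewrite oppr0 addr0.
Qed.

Lemma u_T0 : br3 false ucur T0cur 0 (2 *: ucur) 0.
Proof.
have HJ : br3 false ucur (\sum_A nop false (J (e' A)) (J (e A))) 0 0 0.
  apply: (br3_eq (br3_sumr (fun A => wick_even0 (u_J (e' A)) (u_J (e A))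
    (br30l false (J (e A)))))).
  - by rewrite big1 // => A _; rewrite nop0l nop0r addr0.
  - by rewrite big1 // => A _; rewrite nop0r addr0.
  - by rewrite big1 // => A _; rewrite nop0r addr0.
have Ha := even_avda u_a (@tau_lin _ _ ip _ x y) (@tauC _ _ _ _ _ _ Hpair _ x y).
apply: (br3_eq (br3_Dr HJ (br3_Nr Ha))); rewrite ?oppr0 ?addr0 //.
by rewrite pair_flip; vmod C; ring.
Qed.

Definition Dshift alpha : vfield := Dcur + vd (a alpha).
Definition Tcur alpha : vfield := 2^-1 *: (T0cur + vd (Icur alpha)).
Definition Jcur beta : vfield := ucur + Icur beta.

Lemma Dshift_Dshift alpha : exists k,
  br3 true (Dshift alpha) (Dshift alpha) (2 *: Tcur alpha) 0 ((2 * k) *: vone).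
Proof.
have [k Hk] := D_D; exists (k / 2 - ip alpha alpha).
apply: (br3_eq (br3_Dl (br3_Dr Hk (br3_dr (skew_odd (a_D alpha))))
  (br3_Dr (br3_dl (a_D alpha)) (br3_dl (a_vda alpha alpha))))).
- by rewrite /Tcur; vmod C; field.
- by rewrite linear0; vmod C; ring.
- by vmod C; field.
Qed.

(** The double pole is - a(rho) + a(tau alpha) + a(beta), so beta is chosen to cancel it;
    [beta, alpha] = 0 removes what I(beta) makes of the shift. The simple pole is then that of u
    alone, which makes it computable from charges. *)
Lemma Jcur_Dshift alpha beta :
  beta = rho - tau alpha -> br beta alpha = 0 ->
  exists c, br3 false (Jcur beta) (Dshift alpha) c 0 0 /\
    exists c1, br3 false ucur (Dshift alpha) c c1 0.
Proof.
move=> Eb E0; have [c Hc] := u_D.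
have Hu : br3 false ucur (Dshift alpha) (c + vd (a (tau alpha)))
    (- a rho + a (tau alpha)) 0.
  apply: (br3_eq (br3_Dr Hc (br3_dr (u_a alpha)))) => //.
    by rewrite linear0 add0r.
  by rewrite scaler0 addr0.
exists (c + vd (a (tau alpha))); split; last by exists (- a rho + a (tau alpha)).
apply: (br3_eq (br3_Dl Hu (br3_Dr (Icur_D beta) (br3_dr (I_a beta alpha))))).
- by rewrite E0 (lin_fun0 aL) linear0 !addr0.
- by rewrite linear0 E0 (lin_fun0 aL) !addr0 Eb aB; vmod C; ring.
- by rewrite scaler0 !addr0.
Qed.

Lemma u_I X : (forall z, tau (br X z) = br X (tau z)) ->
  br3 false ucur (Icur X) 0 ((- ip X rho) *: vone) 0.
Proof.
move=> HX; apply: (br3_eq (br3_Dr (u_J X) (u_theta X))); rewrite ?add0r //.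
exact: Ucur0.
Qed.

Lemma Icur0 : Icur 0 = 0.
Proof. by rewrite /Icur (lin_fun0 JL) (lin_fun0 theta_lin) addr0. Qed.

Section Shift.
Context (alpha beta : g) (Eb : beta = rho - tau alpha) (E0 : br beta alpha = 0).
Context (Ha : forall z, tau (br alpha z) = br alpha (tau z)).
Context (Hb : forall z, tau (br beta z) = br beta (tau z)).

Let ip_tau_self : ip (tau alpha) alpha = 0.
Proof.
have E : ip (tau alpha) alpha = - ip (tau alpha) alpha.
  by rewrite {1}(tauC Hpair) (ipC Hpair).
by apply: (linear_comb1 (V := C^o) (c := 1 / 2) E); rewrite /GRing.scale /=; field.
Qed.

(** The double pole is (beta - rho, alpha) = - (tau alpha, alpha), which is zero because [tau] is
    skew-adjoint. *)
Lemma Jcur_Icur : br3 false (Jcur beta) (Icur alpha) 0 0 0.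
Proof.
apply: (br3_eq (br3_Dl (u_I Ha) (I_I beta alpha))); rewrite ?addr0 ?add0r //.
  by rewrite E0 Icur0.
rewrite -scalerDl Eb linearBl /= ip_tau_self (ipC Hpair rho).
by rewrite (_ : _ + _ = 0) ?scale0r //; ring.
Qed.

Lemma Jcur_Tcur : br3 false (Jcur beta) (Tcur alpha) 0 (Jcur beta) 0.
Proof.
apply: (br3_eq (br3_Zr 2^-1 (br3_Dr (br3_Dl u_T0 (I_T0 beta)) (br3_dr Jcur_Icur)))).
- by rewrite linear0 !addr0 scaler0.
- by rewrite linear0 /Jcur; vmod C; field.
- by rewrite scaler0 !addr0 scaler0.
Qed.

Lemma u_Tcur : charge ucur 0 (Tcur alpha).
Proof.
apply/chargeZ/chargeD; first by apply: (charge_br3 u_T0); rewrite scale0r.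
by apply/charge_vd/(charge_br3 (u_I Ha)); rewrite scale0r.
Qed.

Lemma u_u : br3 false ucur ucur 0 (n%:R *: vone) 0.
Proof.
apply: (br3_eq (br3_sumr (fun i : 'I_n => wick_even0 (u_a y`_i) (u_a x`_i) (Baa _ _)))).
- rewrite big1 // => i _; rewrite (tau_x Hpair Hxy) (tau_y Hpair Hxy) aN nopNr.
  by rewrite subrr.
- rewrite (eq_bigr (fun=> vone)) => [|i _].
    by rewrite sumr_const card_ord scaler_nat.
  by rewrite nop0r add0r (tau_y Hpair Hxy) (ip_yx Hpair Hxy) eqxx scale1r.
- by rewrite big1 // => i _; rewrite nop0r addr0.
Qed.

Lemma u_Jcur : charge ucur 0 (Jcur beta).
Proof.
apply: chargeD; first by apply: (charge_br3 u_u); rewrite scale0r.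
by apply: (charge_br3 (u_I Hb)); rewrite scale0r.
Qed.

(** The level is n - 2 (beta, rho) + (beta, beta) with beta = rho - tau alpha, and (tau alpha, tau
    alpha) = - (alpha, alpha). The term n is half the dimension of [g]. *)
Lemma Jcur_Jcur : br3 false (Jcur beta) (Jcur beta) 0
  ((n%:R - ip rho rho - ip alpha alpha) *: vone) 0.
Proof.
apply: (br3_eq (br3_Dl (br3_Dr u_u (u_I Hb))
  (br3_Dr (skew_even (u_I Hb)) (I_I beta beta)))); rewrite ?addr0 ?add0r //.
  by rewrite (brvv Hpair) Icur0 subr0 addr0 vdZ1.
rewrite -!scalerDl; congr (_ *: _).
have T2 : ip (tau alpha) (tau alpha) = - ip alpha alpha.
  by rewrite (tauC Hpair) (tau_tau Hpair Hxy).
have T1 : ip (tau alpha) rho = ip rho (tau alpha) by apply: ipC Hpair _ _.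
rewrite Eb !linearBl !linearBr /= T1 T2.
by ring.
Qed.

Theorem N32_of_charges (Gp Gm Phi F r0 r1 : vfield) :
  Dshift alpha = Gp + Gm + Phi ->
  charge ucur 1 Gp -> charge ucur (-1) Gm -> charge ucur (-3) Phi ->
  br3 true Phi Gp r0 r1 0 -> F = r0 - vd r1 ->
  N32_algebra (n%:R - ip rho rho - ip alpha alpha)
    (vmode (Tcur alpha)) (vmode (Jcur beta)) (vmode F)
    (vmode Gp) (vmode Gm) (vmode Phi).
Proof.
move=> ED cGp cGm cPhi HPG HF.
have [k Hk] := Dshift_Dshift alpha.
have [c [Hc [c1 Hc1]]] := Jcur_Dshift Eb E0.
(* At index 0 the bracket of u with D has only its simple pole c, and the zero mode of u acts on the
   three components by their charges. *)
have Ec : c = Gp - Gm - 3 *: Phi.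
  apply: vfield_eq => m v; have := Hc1 0 m v; rewrite ED sg0.
  rewrite !vmodeE ?vlinE => E.
  apply: (linear_comb4 (c1 := -1) (c2 := 1) (c3 := 1) (c4 := 1)
    E (cGp m v) (cGm m v) (cPhi m v)).
  by rewrite add0r; vmod C; field.
rewrite ED in Hk Hc; rewrite Ec in Hc.
apply: (N32_of_supercurrent Hk Hc Jcur_Tcur Jcur_Jcur HPG HF cGp cGm cPhi u_Jcur).
exact: u_Tcur.
Qed.

End Shift.
End DiracCurrent.

(** * Components of the current in dual bases *)

Section Components.
Context (C : numFieldType) (V : lmodType C) (g : vectType C).
Local Notation vfield := (vfield V).
Context (br : {bilinear g -> g -> g}) (ip : {biscalar g}) (gp gm : {vspace g}).
Context (Hpair : manin_pair br ip gp gm).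
Context (n : nat) (x y : n.-tuple g) (Hxy : dual_bases ip gp gm x y).
Context (J a : g -> vfield).
Context (JL : forall s u v, J (s *: u + v) = s *: J u + J v).
Context (aL : forall s u v, a (s *: u + v) = s *: a u + a v).
Context (Baa : forall u v, br3 true (a u) (a v) (ip u v *: vone) 0 0).
Context (BJa : forall u v, br3 false (J u) (a v) 0 0 0).
Context (BJJ : forall u v, br3 false (J u) (J v) (J (br u v))
  ((ip u v - 2^-1 * killing br u v) *: vone) 0).
Context (c f phi : 'I_n -> 'I_n -> 'I_n -> C).
Context (Hcf : structure_constants br x y c f phi).
Implicit Types (i j k l m : 'I_n) (u v w z : g).

Lemma ip_sum_xy (s t : 'I_n -> C) k :
  ip (\sum_(j < n) (s j *: x`_j + t j *: y`_j)) y`_k = s k.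
Proof.
rewrite linear_sumlz (eq_bigr (fun j => (j == k)%:R *: (s j : C^o))) ?sum_delta // => j _.
rewrite ipL linearZl_LR /= (ip_xy Hxy) (ip_yy Hpair Hxy) mulr0 addr0.
by rewrite mulrC.
Qed.

Lemma cE i j k : c i j k = ip (br x`_i x`_j) y`_k.
Proof.
have [-> _ _] := Hcf i j; rewrite -(ip_sum_xy (c i j) (fun=> 0)).
by congr (ip _ _); apply: eq_bigr => l _; rewrite scale0r addr0.
Qed.

Lemma phiE i j k : phi i j k = - ip (br y`_i y`_j) y`_k.
Proof.
have [_ _ ->] := Hcf i j; rewrite -linearNl /= -(ip_sum_xy (phi i j) (fun k => - f k i j)).
congr (ip _ _); rewrite -sumrN; apply: eq_bigr => l _.
by rewrite opprB scaleNr.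
Qed.

Lemma cC i j k : c j i k = - c i j k.
Proof. by rewrite !cE (brC Hpair) linearNl. Qed.

Lemma phiC i j k : phi j i k = - phi i j k.
Proof. by rewrite !phiE (brC Hpair) linearNl. Qed.

Lemma phi_rot i j k : phi j k i = phi i j k.
Proof. by rewrite !phiE (ipC Hpair) (ip_br Hpair). Qed.

Local Notation al i := (a x`_i).
Local Notation au i := (a y`_i).
Local Notation N3 u v w := (nop false (a u) (nop true (a v) (a w))).

Definition Gplus_v (q : 'I_n -> C) : vfield :=
  \sum_(i < n) nop false (J x`_i) (au i)
  - 2^-1 *: \sum_(i < n) \sum_(j < n) \sum_(k < n) c i j k *: N3 y`_i y`_j x`_k
  + \sum_(i < n) q i *: vd (au i).

Definition Gminus_v (p : 'I_n -> C) : vfield :=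
  \sum_(i < n) nop false (J y`_i) (al i)
  - 2^-1 *: \sum_(i < n) \sum_(j < n) \sum_(k < n) f k i j *: N3 x`_i x`_j y`_k
  + \sum_(i < n) p i *: vd (al i).

Definition Phi_v : vfield :=
  6^-1 *: \sum_(i < n) \sum_(j < n) \sum_(k < n) phi i j k *: N3 x`_i x`_j x`_k.

Definition F_v : vfield :=
  2^-1 *: (\sum_(i < n) \sum_(j < n) \sum_(k < n) phi i j k *:
     (nop false (J x`_i) (nop true (al j) (al k))
      - \sum_(l < n) \sum_(m < n) c i l m *:
          nop true (au l) (nop false (al m) (nop true (al j) (al k)))))
  + 2^-1 *: \sum_(i < n) \sum_(j < n) \sum_(k < n) \sum_l
      (c k l i * phi j k l) *: nop true (vd (al i)) (al j).

Lemma N3_swap12 u v w : N3 v u w = - N3 u v w.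
Proof. by rewrite (aa_swap_odd Baa). Qed.
Lemma N3_swap23 u v w : N3 u w v = - N3 u v w.
Proof. by rewrite (aa_anti Baa) nopNr. Qed.

Let theta' := theta br x y a.

Lemma a_sumZ (s : 'I_n -> C) (w : 'I_n -> g) : a (\sum_(k < n) s k *: w k) = \sum_(k < n) s k *: a (w k).
Proof. exact: lin_sum. Qed.

Lemma a_brxx i j : a (br x`_i x`_j) = \sum_(k < n) c i j k *: al k.
Proof. by have [-> _ _] := Hcf i j; rewrite a_sumZ. Qed.
Lemma a_brxy i j : a (br x`_i y`_j) = \sum_(k < n) (f i j k *: al k + c k i j *: au k).
Proof.
have [_ -> _] := Hcf i j; rewrite a_sum //; apply: eq_bigr => k _.
by rewrite aL -[c _ _ _ *: y`_k]addr0 aL (lin_fun0 aL) addr0.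
Qed.
Lemma a_bryy i j : a (br y`_i y`_j) = \sum_(k < n) (f k i j *: au k - phi i j k *: al k).
Proof.
have [_ _ ->] := Hcf i j; rewrite a_sum //; apply: eq_bigr => k _.
by rewrite aB // -[f _ _ _ *: y`_k]addr0 -[phi _ _ _ *: x`_k]addr0 !aL (lin_fun0 aL) !addr0.
Qed.
Lemma a_bryx i j : a (br y`_i x`_j) = - \sum_(k < n) (f j i k *: al k + c k j i *: au k).
Proof. by rewrite (brC Hpair) aN // a_brxy. Qed.

Lemma theta_x i : theta' x`_i =
  - (\sum_(j < n) \sum_(k < n) c i j k *: nop true (au j) (al k))
  - 2^-1 *: \sum_(j < n) \sum_(k < n) f i j k *: nop true (al j) (al k).
Proof.
rewrite /theta' thetaE (sum_dual x y (fun u v => nop true (a (br x`_i u)) (a v))).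
pose P := \sum_(j < n) \sum_(k < n) c i j k *: nop true (au j) (al k).
pose Q := \sum_(j < n) \sum_(k < n) f i j k *: nop true (al j) (al k).
have -> : \sum_(j < n) (nop true (a (br x`_i x`_j)) (au j) + nop true (a (br x`_i y`_j)) (al j)) =
    - P - Q - P; last by rewrite -/P -/Q; vmod C; field.
rewrite /P [in X in _ = _ - _ - X]exchange_big -!sumrN -!big_split /=.
apply: eq_bigr => j _.
rewrite a_brxx a_brxy !nop_suml -!sumrN -!big_split /=; apply: eq_bigr => k _.
rewrite nopDl !nopZl (aa_anti Baa x`_k y`_j) (aa_anti Baa x`_k x`_j) (cC i).
by vmod C; ring.
Qed.

Lemma theta_y i : theta' y`_i =
  - (\sum_(j < n) \sum_(k < n) f k i j *: nop true (al j) (au k))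
  - 2^-1 *: (\sum_(j < n) \sum_(k < n) c j k i *: nop true (au j) (au k))
  + 2^-1 *: \sum_(j < n) \sum_(k < n) phi i j k *: nop true (al j) (al k).
Proof.
rewrite /theta' thetaE (sum_dual x y (fun u v => nop true (a (br y`_i u)) (a v))).
pose P := \sum_(j < n) \sum_(k < n) f k i j *: nop true (al j) (au k).
pose Q := \sum_(j < n) \sum_(k < n) c j k i *: nop true (au j) (au k).
pose S := \sum_(j < n) \sum_(k < n) phi i j k *: nop true (al j) (al k).
have EP : \sum_(j < n) \sum_(k < n) f j i k *: nop true (al k) (au j) = P by exact: exchange_big.
have EQ : \sum_(j < n) \sum_(k < n) c k j i *: nop true (au k) (au j) = Q by exact: exchange_big.
have -> : \sum_(j < n) (nop true (a (br y`_i x`_j)) (au j) + nop true (a (br y`_i y`_j)) (al j)) =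
    - P - Q + S - P; last by rewrite -/P -/Q -/S; vmod C; field.
rewrite -{1}EP -EQ -!sumrN -!big_split /=.
apply: eq_bigr => j _.
rewrite a_bryx a_bryy !(nopNl, nop_suml) -!sumrN -!big_split /=; apply: eq_bigr => k _.
rewrite !nopDl nopNl !nopZl (aa_anti Baa y`_k x`_j) (aa_anti Baa x`_k x`_j).
by vmod C; ring.
Qed.

Lemma sum3_cyc (M : zmodType) (F : 'I_n -> 'I_n -> 'I_n -> M) :
  \sum_(i < n) \sum_(j < n) \sum_(k < n) F i j k =
  \sum_(i < n) \sum_(j < n) \sum_(k < n) F j k i.
Proof.
rewrite [RHS]exchange_big; apply: eq_bigr => i _.
by rewrite [RHS]exchange_big.
Qed.
Let N3_rot u v w : N3 u v w = N3 v w u.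
Proof. by rewrite N3_swap12 (N3_swap23 v w) opprK. Qed.

Lemma cubic_components : cubic br x y a =
  - 2^-1 *: (\sum_(i < n) \sum_(j < n) \sum_(k < n) c i j k *: N3 y`_i y`_j x`_k)
  - 2^-1 *: (\sum_(i < n) \sum_(j < n) \sum_(k < n) f k i j *: N3 x`_i x`_j y`_k)
  + Phi_v.
Proof.
rewrite /cubic (sum_dual x y (fun u v => nop false (a v) (theta br x y a u))).
rewrite /Phi_v -/theta'.
set Sc := \sum_(i < n) \sum_(j < n) \sum_(k < n) c i j k *: _.
set Sf := \sum_(i < n) \sum_(j < n) \sum_(k < n) f k i j *: _.
set Sp := \sum_(i < n) \sum_(j < n) \sum_(k < n) _.
have E1 : \sum_(i < n) nop false (au i) (theta' x`_i) =
    - Sc - 2^-1 *: Sf.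
  have -> : Sf = \sum_(i < n) \sum_(j < n) \sum_(k < n) f i j k *: N3 x`_j x`_k y`_i.
    exact: sum3_cyc.
  rewrite scaler_sumr -!sumrN -big_split; apply: eq_bigr => i _ /=.
  rewrite theta_x nopDr !nopNr nopZr !nop_sumr; congr (- _ - _ *: _).
    by apply: eq_bigr => j _; rewrite nop_sumr; apply: eq_bigr => k _; rewrite nopZr.
  apply: eq_bigr => j _; rewrite nop_sumr; apply: eq_bigr => k _; rewrite nopZr.
  by rewrite N3_rot.
have E2 : \sum_(i < n) nop false (al i) (theta' y`_i) =
    - Sf - 2^-1 *: Sc + 2^-1 *: Sp.
  have -> : Sc = \sum_(i < n) \sum_(j < n) \sum_(k < n) c j k i *: N3 y`_j y`_k x`_i.
    exact: sum3_cyc.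
  rewrite !scaler_sumr -!sumrN -!big_split; apply: eq_bigr => i _ /=.
  rewrite theta_y !nopDr !nopNr !nopZr !nop_sumr; congr (- _ - _ *: _ + _ *: _).
  - by apply: eq_bigr => j _; rewrite nop_sumr; apply: eq_bigr => k _; rewrite nopZr.
  - apply: eq_bigr => j _; rewrite nop_sumr; apply: eq_bigr => k _; rewrite nopZr.
    by rewrite N3_rot.
  - by apply: eq_bigr => j _; rewrite nop_sumr; apply: eq_bigr => k _; rewrite nopZr.
by rewrite big_split /= E1 E2; vmod C; field.
Qed.

Lemma Dshift_components (alpha : g) (p q : 'I_n -> C) :
  alpha = \sum_(i < n) (p i *: x`_i + q i *: y`_i) ->
  Dshift br x y J a alpha = Gplus_v q + Gminus_v p + Phi_v.
Proof.
move=> ->; rewrite /Dshift /Dcur cubic_components /Scur.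
rewrite (sum_dual x y (fun u v => nop false (a v) (J u))) big_split /=.
rewrite /Gplus_v /Gminus_v.
have EJ u v : nop false (a u) (J v) = nop false (J v) (a u).
  by rewrite (nop_comm (a_J BJa u v)) !linear0 !addr0 [sg _]expr0 scale1r.
rewrite (eq_bigr _ (fun i _ => EJ y`_i x`_i)) (eq_bigr _ (fun i _ => EJ x`_i y`_i)).
have -> : a (\sum_(i < n) (p i *: x`_i + q i *: y`_i)) =
    \sum_(i < n) p i *: al i + \sum_(i < n) q i *: au i.
  rewrite a_sum // -big_split; apply: eq_bigr => i _ /=.
  by rewrite aL -[q i *: _]addr0 aL (lin_fun0 aL) addr0.
have vs (s : 'I_n -> C) (w : 'I_n -> vfield) :
    vd (\sum_i s i *: w i) = \sum_i s i *: vd (w i).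
  by rewrite linear_sum; apply: eq_bigr => i _; rewrite linearZ.
rewrite linearD /= !vs.
by vmod C; field.
Qed.

Lemma charge_al i : charge (ucur x y a) (-1) (al i).
Proof.
apply: (charge_br3 (u_a x y aL Baa x`_i)).
by rewrite (tau_x Hpair Hxy) aN // scaleN1r.
Qed.
Lemma charge_au i : charge (ucur x y a) 1 (au i).
Proof.
apply: (charge_br3 (u_a x y aL Baa y`_i)).
by rewrite (tau_y Hpair Hxy) scale1r.
Qed.
Lemma charge_J u : charge (ucur x y a) 0 (J u).
Proof. by apply: (charge_br3 (u_J x y BJa u)); rewrite scale0r. Qed.

Lemma charge_eq (A B : vfield) r s : charge A r B -> r = s -> charge A s B.
Proof. by move=> H <-. Qed.

Lemma charge_Gplus q : charge (ucur x y a) 1 (Gplus_v q).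
Proof.
rewrite /Gplus_v; apply: chargeD; last first.
  by apply: charge_sum => i; apply/chargeZ/charge_vd/charge_au.
rewrite -scaleNr; apply: chargeD.
  apply: charge_sum => i; apply: (charge_eq (charge_nop _ (charge_J _) (charge_au i))).
  by rewrite add0r.
apply: chargeZ; apply: charge_sum => i; apply: charge_sum => j; apply: charge_sum => k.
apply: chargeZ; apply: (charge_eq (charge_nop _ (charge_au i)
  (charge_nop _ (charge_au j) (charge_al k)))).
by ring.
Qed.

Lemma charge_Gminus p : charge (ucur x y a) (-1) (Gminus_v p).
Proof.
rewrite /Gminus_v; apply: chargeD; last first.
  by apply: charge_sum => i; apply/chargeZ/charge_vd/charge_al.
rewrite -scaleNr; apply: chargeD.
  apply: charge_sum => i; apply: (charge_eq (charge_nop _ (charge_J _) (charge_al i))).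
  by rewrite add0r.
apply: chargeZ; apply: charge_sum => i; apply: charge_sum => j; apply: charge_sum => k.
apply: chargeZ; apply: (charge_eq (charge_nop _ (charge_al i)
  (charge_nop _ (charge_al j) (charge_au k)))).
by ring.
Qed.

Lemma charge_Phi : charge (ucur x y a) (-3) Phi_v.
Proof.
apply: chargeZ; apply: charge_sum => i; apply: charge_sum => j; apply: charge_sum => k.
apply: chargeZ; apply: (charge_eq (charge_nop _ (charge_al i)
  (charge_nop _ (charge_al j) (charge_al k)))).
by ring.
Qed.

Let vdD (A B : vfield) : vd (A + B) = vd A + vd B. Proof. exact: linearD. Qed.
Let vdZ b (A : vfield) : vd (b *: A) = b *: vd A. Proof. exact: linearZ. Qed.
Let vd_sum (A : 'I_n -> vfield) : vd (\sum_(i < n) A i) = \sum_(i < n) vd (A i).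
Proof. exact: linear_sum. Qed.

(** The contraction of Phi with a^i, a fermionic derivative of the cubic form; [Rho] is the second
    derivative. *)
Definition Psi i : vfield :=
  locked (2^-1 *: \sum_(j < n) \sum_(k < n) phi i j k *: nop true (al j) (al k)).
Lemma PsiE i :
  Psi i = 2^-1 *: \sum_(j < n) \sum_(k < n) phi i j k *: nop true (al j) (al k).
Proof. by rewrite /Psi -lock. Qed.
Definition Rho i j : vfield := locked (\sum_(m < n) phi i j m *: al m).
Lemma RhoE i j : Rho i j = \sum_(m < n) phi i j m *: al m.
Proof. by rewrite /Rho -lock. Qed.

Let ysum (s : 'I_n -> vfield) j : \sum_(i < n) ip y`_j x`_i *: s i = s j.
Proof.
rewrite -[RHS](sum_delta s); apply: eq_bigr => i _.
by rewrite (ip_yx Hpair Hxy) eq_sym.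
Qed.

Lemma au_Psi i j : br3 false (au j) (Psi i) (Rho i j) 0 0.
Proof.
rewrite PsiE; apply: (br3_eq (br3_Zr 2^-1 (br3_sumr (fun l : 'I_n => br3_sumr (fun m : 'I_n =>
  br3_Zr (phi i l m) (wick_const (Baa y`_j x`_l) (Baa y`_j x`_m))))))).
- have E : \sum_(l < n) \sum_(m < n) phi i l m *: (ip y`_j x`_l *: al m -
      nop false (al l) (ip y`_j x`_m *: vone)) = Rho i j + Rho i j.
    transitivity (\sum_(l < n) (ip y`_j x`_l *: Rho i l) +
        \sum_(m < n) (ip y`_j x`_m *: Rho i m)); last by rewrite !ysum.
    have EB : \sum_(m < n) (ip y`_j x`_m *: Rho i m) =
        \sum_(l < n) \sum_(m < n) - (ip y`_j x`_m * phi i l m) *: al l.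
      rewrite exchange_big; apply: eq_bigr => m _ /=; rewrite RhoE scaler_sumr.
      apply: eq_bigr => l _; rewrite scalerA -mulrN.
      by rewrite -!(phi_rot i) phiC.
    rewrite [X in _ = _ + X]EB -big_split; apply: eq_bigr => l _ /=.
    rewrite RhoE scaler_sumr -big_split.
    by apply: eq_bigr => m _ /=; rewrite nopZr nop1r; vmod C; ring.
  by rewrite E; vmod C; field.
- by rewrite big1 ?scaler0 // => l _; rewrite big1 // => m _; rewrite nop0r oppr0 scaler0.
- by rewrite big1 ?scaler0 // => l _; rewrite big1 // => m _; rewrite nop0r oppr0 scaler0.
Qed.

Lemma al_al i j : br3 true (al i) (al j) 0 0 0.
Proof. by have := Baa x`_i x`_j; rewrite (ip_xx Hpair Hxy) scale0r. Qed.

Lemma al_Psi i j : br3 false (al j) (Psi i) 0 0 0.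
Proof.
rewrite PsiE; apply: (br3_eq (br3_Zr 2^-1 (br3_sumr (fun l : 'I_n => br3_sumr (fun m : 'I_n =>
  br3_Zr (phi i l m) (wick_const (Baa x`_j x`_l) (Baa x`_j x`_m))))))).
- rewrite big1 ?scaler0 // => l _; rewrite big1 // => m _.
  by rewrite !(ip_xx Hpair Hxy) !scale0r nop0r subrr scaler0.
- by rewrite big1 ?scaler0 // => l _; rewrite big1 // => m _; rewrite nop0r oppr0 scaler0.
- by rewrite big1 ?scaler0 // => l _; rewrite big1 // => m _; rewrite nop0r oppr0 scaler0.
Qed.

Lemma Phi_vE : Phi_v = 3^-1 *: \sum_(i < n) nop false (al i) (Psi i).
Proof.
rewrite /Phi_v !scaler_sumr; apply: eq_bigr => i _.
rewrite PsiE nopZr scalerA (_ : 3^-1 * 2^-1 = 6^-1); last by field.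
congr (_ *: _); rewrite nop_sumr; apply: eq_bigr => j _; rewrite nop_sumr.
by apply: eq_bigr => k _; rewrite nopZr.
Qed.

Lemma Phi_au j : br3 true Phi_v (au j) (Psi j) 0 0.
Proof.
apply: skew_odd; rewrite Phi_vE.
apply: (br3_eq (br3_Zr 3^-1 (br3_sumr (fun i : 'I_n =>
  wick_const (Baa y`_j x`_i) (au_Psi i j))))).
- rewrite sumrB ysum.
  rewrite (_ : \sum_(i < n) _ = - 2 *: Psi j).
    by vmod C; field.
  rewrite PsiE scalerA mulNr divff ?pnatr_eq0 // scaleN1r -sumrN; apply: eq_bigr => i _.
  rewrite RhoE nop_sumr -sumrN; apply: eq_bigr => m _; rewrite nopZr /=.
  by rewrite phiC scaleNr.
- by rewrite big1 ?scaler0 // => i _; rewrite nop0r oppr0.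
- by rewrite big1 ?scaler0 // => i _; rewrite nop0r oppr0.
Qed.

Lemma Phi_al j : br3 true Phi_v (al j) 0 0 0.
Proof.
apply: skew_odd; rewrite Phi_vE.
apply: (br3_eq (br3_Zr 3^-1 (br3_sumr (fun i : 'I_n =>
  wick_const (Baa x`_j x`_i) (al_Psi i j))))).
- rewrite big1 ?scaler0 // => i _.
  by rewrite (ip_xx Hpair Hxy) scale0r nop0r subrr.
- by rewrite big1 ?scaler0 // => i _; rewrite nop0r oppr0.
- by rewrite big1 ?scaler0 // => i _; rewrite nop0r oppr0.
Qed.

Lemma J_Psi u i : br3 false (J u) (Psi i) 0 0 0.
Proof.
rewrite PsiE; apply: (br3_eq (br3_Zr 2^-1 (br3_sumr (fun l : 'I_n => br3_sumr (fun m : 'I_n =>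
  br3_Zr (phi i l m) (wick_even0 (BJa u x`_l) (BJa u x`_m) (br30l true _))))))).
- rewrite big1 ?scaler0 // => l _; rewrite big1 // => m _.
  by rewrite nop0l nop0r addr0 scaler0.
- by rewrite big1 ?scaler0 // => l _; rewrite big1 // => m _; rewrite nop0r addr0 scaler0.
- by rewrite big1 ?scaler0 // => l _; rewrite big1 // => m _; rewrite nop0r addr0 scaler0.
Qed.

Lemma Phi_J u : br3 false Phi_v (J u) 0 0 0.
Proof.
have H : br3 false (J u) Phi_v 0 0 0.
  rewrite Phi_vE; apply: (br3_eq (br3_Zr 3^-1 (br3_sumr (fun i : 'I_n =>
    wick_even0 (BJa u x`_i) (J_Psi u i) (br30l false _))))).
  - by rewrite big1 ?scaler0 // => i _; rewrite nop0l nop0r addr0.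
  - by rewrite big1 ?scaler0 // => i _; rewrite nop0r addr0.
  - by rewrite big1 ?scaler0 // => i _; rewrite nop0r addr0.
by apply: (br3_eq (skew_even H)); rewrite // linear0 subr0.
Qed.

Lemma Psi_au i j : br3 false (Psi i) (au j) (- Rho i j) 0 0.
Proof. by apply: (br3_eq (skew_even (au_Psi i j))); rewrite // linear0 sub0r. Qed.
Lemma Psi_al i j : br3 false (Psi i) (al j) 0 0 0.
Proof. by apply: (br3_eq (skew_even (al_Psi i j))); rewrite // linear0 subr0. Qed.

Lemma Rho_al i j k : br3 true (Rho i j) (al k) 0 0 0.
Proof.
rewrite RhoE; apply: (br3_eq (br3_suml (fun m : 'I_n => br3_Zl (phi i j m) (al_al m k))));
  by rewrite big1 // => m _; rewrite scaler0.
Qed.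

Lemma Phi_auaual i j k : br3 true Phi_v (N3 y`_i y`_j x`_k)
  (nop false (Psi i) (nop true (au j) (al k)) -
     nop true (au i) (nop false (Psi j) (al k)))
  (- nop true (Rho i j) (al k)) 0.
Proof.
have H1 : br3 false Phi_v (nop true (au j) (al k)) (nop false (Psi j) (al k)) 0 0.
  apply: (br3_eq (wick (ebd := true) (Phi_au j) (Phi_al k) (Psi_al j k) (br30l _ _))).
  - by rewrite nop0r scaler0 addr0.
  - by rewrite nop0l nop0r scaler0 !addr0.
  - by rewrite nop0r !scaler0 !addr0.
have H2 : br3 false (Psi i) (nop true (au j) (al k)) (- nop true (Rho i j) (al k)) 0 0.
  have H0 : br3 true (- Rho i j) (al k) 0 0 0.
    rewrite -scaleN1r; apply: (br3_eq (br3_Zl (-1) (Rho_al i j k))); exact: scaler0.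
  apply: (br3_eq (wick_even0 (Psi_au i j) (Psi_al i k) H0)).
  - by rewrite nop0r addr0 nopNl.
  - by rewrite nop0r addr0.
  - by rewrite nop0r addr0.
apply: (br3_eq (wick (Phi_au i) H1 H2 (br30l _ _))).
- by rewrite [sg _]expr1 scaleN1r.
- by rewrite nop0l nop0r scaler0 !add0r.
- by rewrite nop0r !scaler0 !addr0.
Qed.

(** The double pole of Phi.G^+. It is carried along unsimplified; once beta lies in g_0, the general
    argument on modes shows that it vanishes. *)
Definition PhiGplus1 (q : 'I_n -> C) : vfield :=
  2^-1 *: (\sum_(i < n) \sum_(j < n) \sum_(k < n) c i j k *: nop true (Rho i j) (al k))
  + \sum_(i < n) q i *: Psi i.

Lemma Phi_Gplus (q : 'I_n -> C) : exists r0,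
  br3 true Phi_v (Gplus_v q) r0 (PhiGplus1 q) 0 /\ F_v = r0 - vd (PhiGplus1 q).
Proof.
have H1 : br3 true Phi_v (\sum_(i < n) nop false (J x`_i) (au i))
    (\sum_(i < n) nop false (J x`_i) (Psi i)) 0 0.
  apply: (br3_eq (br3_sumr (fun i : 'I_n =>
    wick (ebd := false) (Phi_J x`_i) (Phi_au i) (br30l _ _) (br30l _ _)))).
  - by apply: eq_bigr => i _; rewrite nop0l add0r [sg _]expr0 scale1r.
  - by rewrite big1 // => i _; rewrite nop0l nop0r scaler0 !addr0.
  - by rewrite big1 // => i _; rewrite nop0r !scaler0 !addr0.
have H2 := br3_sumr (fun i : 'I_n => br3_sumr (fun j : 'I_n => br3_sumr (fun k : 'I_n =>
  br3_Zr (c i j k) (Phi_auaual i j k)))).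
have H3 := br3_sumr (fun i : 'I_n => br3_Zr (q i) (br3_dr (Phi_au i))).
have H := br3_Dr (br3_Dr H1 (br3_Nr (br3_Zr 2^-1 H2))) H3.
eexists; split.
  apply: (br3_eq H) => //.
  - rewrite /PhiGplus1 add0r -scalerN -sumrN; congr (_ *: _ + _).
      apply: eq_bigr => i _; rewrite -sumrN; apply: eq_bigr => j _; rewrite -sumrN.
      by apply: eq_bigr => k _; rewrite scalerN opprK.
    by apply: eq_bigr => i _; rewrite linear0 add0r.
  - rewrite add0r big1 ?scaler0 ?oppr0 ?add0r => [|i _]; last first.
      by rewrite big1 // => j _; rewrite big1 // => k _; rewrite scaler0.
    by rewrite big1 // => i _; rewrite !scaler0.
pose S := \sum_(i < n) \sum_(j < n) \sum_(k < n) c i j k *: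
  nop true (au j) (nop false (al k) (Psi i)).
(* [U] and [W] are the parts of the derivative of the double pole with [vd] on either factor. [U]
   also arises when Psi is moved past a^j, and there it cancels; the remaining - W / 2 is the
   quadratic term of F. *)
pose U := \sum_(i < n) \sum_(j < n) \sum_(k < n) c i j k *: nop true (vd (Rho i j)) (al k).
pose W := \sum_(i < n) \sum_(j < n) \sum_(k < n) c i j k *: nop true (Rho i j) (vd (al k)).
have EW : vd (\sum_(i < n) \sum_(j < n) \sum_(k < n) c i j k *: nop true (Rho i j) (al k)) = U + W.
  rewrite /U /W linear_sum -big_split; apply: eq_bigr => i _ /=.
  rewrite linear_sum -big_split; apply: eq_bigr => j _ /=.
  rewrite linear_sum -big_split; apply: eq_bigr => k _ /=.
  by rewrite linearZ /= vd_nop scalerDr.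
have ES : \sum_(i < n) \sum_(j < n) \sum_(k < n) c i j k *:
    (nop false (Psi i) (nop true (au j) (al k)) -
     nop true (au i) (nop false (Psi j) (al k))) = 2 *: S - U.
  have PA i k : nop false (Psi i) (al k) = nop false (al k) (Psi i).
    by rewrite (nop_comm (Psi_al i k)) !linear0 !addr0 [sg _]expr0 scale1r.
  have -> : 2 *: S = S - \sum_(i < n) \sum_(j < n) \sum_(k < n) c i j k *:
      nop true (au i) (nop false (al k) (Psi j)).
    rewrite scaler_nat mulr2n; congr (_ + _); rewrite /S -sumrN exchange_big.
    apply: eq_bigr => i _; rewrite -sumrN; apply: eq_bigr => j _ /=; rewrite -sumrN.
    by apply: eq_bigr => k _; rewrite cC scaleNr.
  rewrite /S /U -!sumrB; apply: eq_bigr => i _; rewrite -!sumrB; apply: eq_bigr => j _.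
  rewrite -!sumrB; apply: eq_bigr => k _; rewrite -!scalerBr; congr (_ *: _).
  have -> := nop_swap (eab := false) false true (al k) (Psi_au i j).
  rewrite [sg _]expr0 scale1r !PA linearN nopNl /=.
  by vmod C; ring.
have EF1 : 2^-1 *: \sum_(i < n) \sum_(j < n) \sum_(k < n) phi i j k *:
     (nop false (J x`_i) (nop true (al j) (al k))
      - \sum_(l < n) \sum_(m < n) c i l m *:
          nop true (au l) (nop false (al m) (nop true (al j) (al k)))) =
    \sum_(i < n) nop false (J x`_i) (Psi i) - S.
  rewrite /S -sumrB scaler_sumr; apply: eq_bigr => i _.
  pose G (A : vfield) := \sum_(l < n) \sum_(m < n) c i l m *:
    nop true (au l) (nop false (al m) A).
  have GZ b A : G (b *: A) = b *: G A.
    rewrite /G scaler_sumr; apply: eq_bigr => l _; rewrite scaler_sumr.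
    by apply: eq_bigr => m _; rewrite !nopZr !scalerA mulrC.
  have Gsum (A : 'I_n -> vfield) : G (\sum_(j < n) A j) = \sum_(j < n) G (A j).
    rewrite /G [RHS]exchange_big; apply: eq_bigr => l _ /=.
    rewrite [RHS]exchange_big; apply: eq_bigr => m _ /=.
    by rewrite !nop_sumr scaler_sumr.
  rewrite -/(G (Psi i)) PsiE GZ nopZr -scalerBr; congr (_ *: _).
  rewrite Gsum nop_sumr -sumrB; apply: eq_bigr => j _.
  rewrite Gsum nop_sumr -sumrB; apply: eq_bigr => k _.
  by rewrite GZ nopZr -scalerBr.
have EF2 : 2^-1 *: \sum_(i < n) \sum_(j < n) \sum_(k < n) \sum_(l < n)
      (c k l i * phi j k l) *: nop true (vd (al i)) (al j) = - 2^-1 *: W.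
  rewrite scaleNr -scalerN; congr (_ *: _).
  have -> : - W = \sum_(i < n) \sum_(j < n) \sum_(k < n) \sum_(m < n)
      (c i j k * phi i j m) *: nop true (vd (al k)) (al m).
    rewrite /W -sumrN; apply: eq_bigr => i _; rewrite -sumrN; apply: eq_bigr => j _.
    rewrite -sumrN; apply: eq_bigr => k _; rewrite RhoE nop_suml scaler_sumr -sumrN.
    by apply: eq_bigr => m _; rewrite nopZl (vda_anti Baa) -scalerA !scalerN.
  rewrite [RHS]sum3_cyc; apply: eq_bigr => i _ /=.
  rewrite [LHS]sum3_cyc [LHS]sum3_cyc.
  apply: eq_bigr => j _ /=; apply: eq_bigr => k _.
  by apply: eq_bigr => l _; rewrite -phi_rot.
rewrite /F_v EF1 EF2 /PhiGplus1 vdD vdZ EW ES vd_sum.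
have -> : \sum_(i < n) vd (q i *: Psi i) = \sum_(i < n) q i *: vd (Psi i).
  by apply: eq_bigr => i _; rewrite vdZ.
by vmod C; field.
Qed.

End Components.

(** * The subspace g_0 and the vectors rho and alpha *)

Section ManinPairG0.
Context (C : numFieldType) (g : vectType C).
Context (br : {bilinear g -> g -> g}) (ip : {biscalar g}) (gp gm : {vspace g}).
Context (Hpair : manin_pair br ip gp gm).
Context (n : nat) (x y : n.-tuple g) (Hxy : dual_bases ip gp gm x y).
Implicit Types (u v w z alpha : g).
Local Notation tau := (tau ip x y).
Local Notation rho := (rho br x y).

Lemma mem_bracketv (U W : {vspace g}) u w :
  u \in U -> w \in W -> br u w \in bracketv br U W.
Proof.
move=> uU wW; rewrite (coord_vbasis uU) (coord_vbasis wW).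
rewrite linear_sumlz rpred_sum // => i _; rewrite linear_sumr rpred_sum // => j _.
rewrite linearZl_LR linearZr_LR /= !rpredZ // memv_span //.
by apply: allpairs_f; apply: mem_nth; rewrite size_tuple.
Qed.

Lemma bracketv_orth (U : {vspace g}) alpha :
  (forall u v, u \in U -> v \in U -> ip alpha (br u v) = 0) ->
  forall z, z \in bracketv br U U -> ip alpha z = 0.
Proof.
move=> H z; rewrite /bracketv; set s := (X in (<<X>>)%VS) => zs.
rewrite (coord_span (X := in_tuple s) zs) linear_sumr big1 // => i _.
rewrite linearZr_LR /=.
have : (in_tuple s)`_i \in s by apply: mem_nth; rewrite /= ltn_ord.
case/allpairsP=> -[u v] [/= uU vU ->].
by rewrite H ?mulr0 //; apply: vbasis_mem.
Qed.

Lemma tau_gp z : z \in gp -> tau z = - z.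
Proof.
move=> zp; rewrite [in RHS](expand_xy Hpair Hxy z) -sumrN; apply: eq_bigr => i _.
by rewrite (mp_isoP Hpair zp (x_in Hxy (ltn_ord i))) !scale0r !addr0 scaleNr.
Qed.
Lemma tau_gm z : z \in gm -> tau z = z.
Proof.
move=> zp; rewrite [in RHS](expand_xy Hpair Hxy z); apply: eq_bigr => i _.
by rewrite (mp_isoM Hpair zp (y_in Hxy (ltn_ord i))) oppr0 !scale0r.
Qed.

Lemma barv_tau z : barv gp gm z = - tau z.
Proof.
have capM : (gm :&: gp)%VS = 0%VS by rewrite capvC (mp_cap Hpair).
have Ez : daddv_pi gp gm z + daddv_pi gm gp z = z.
  by apply: daddv_pi_add (mp_cap Hpair) _; rewrite (mp_sum Hpair) memvf.
rewrite /barv -[in RHS]Ez -[daddv_pi gp gm z in RHS]scale1r tau_lin scale1r.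
by rewrite tau_gp ?memv_pi // tau_gm ?memv_pi // opprD opprK.
Qed.

Lemma tau_sum (I : finType) (s : I -> C) (w : I -> g) :
  tau (\sum_i s i *: w i) = \sum_i s i *: tau (w i).
Proof. by apply: lin_sum; apply: tau_lin. Qed.

(* For alpha in g_0, ad alpha preserves both halves of the pair. *)
Lemma g0_tau alpha : in_g0 br ip gp gm alpha ->
  forall z, tau (br alpha z) = br alpha (tau z).
Proof.
case=> Hp Hm z.
have Ex i : (i < n)%N -> tau (br alpha x`_i) = br alpha (tau x`_i).
  move=> iN; rewrite (tau_gp (x_in Hxy iN)) linearNr.
  rewrite [in RHS](expand_xy Hpair Hxy (br alpha _)) -sumrN; apply: eq_bigr => j _.
  have -> : ip (br alpha x`_i) x`_j = 0.
    by rewrite (ip_br Hpair) Hp // mem_bracketv // (x_in Hxy).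
  by rewrite !scale0r !addr0 scaleNr.
have Ey i : (i < n)%N -> tau (br alpha y`_i) = br alpha (tau y`_i).
  move=> iN; rewrite (tau_gm (y_in Hxy iN)).
  rewrite [in RHS](expand_xy Hpair Hxy (br alpha _)); apply: eq_bigr => j _.
  have -> : ip (br alpha y`_i) y`_j = 0.
    by rewrite (ip_br Hpair) Hm // mem_bracketv // (y_in Hxy).
  by rewrite oppr0 !scale0r.
rewrite (expand_be Hpair Hxy z) linear_sumr.
rewrite (eq_bigr (fun A => ip z (bd x y A) *: br alpha (be x y A))) => [|A _]; last first.
  exact: linearZr_LR.
rewrite !tau_sum linear_sumr; apply: eq_bigr => A _.
rewrite linearZr_LR; congr (_ *: _).
by case: A => -[] i; rewrite /be /= ?Ex ?Ey.
Qed.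

(** ad alpha commutes with [tau], so [alpha, tau alpha] = tau [alpha, alpha] = 0. It also kills
    [rho], the bracket of an invariant tensor contracted through [tau]. *)
Lemma g0_comm alpha : in_g0 br ip gp gm alpha -> br (rho - tau alpha) alpha = 0.
Proof.
move=> /g0_tau Ha; have E1 : br (tau alpha) alpha = 0.
  rewrite (brC Hpair) -Ha (brvv Hpair) (lin_fun0 (F := tau)) ?oppr0 //.
  exact: tau_lin.
rewrite linearBl E1 subr0 (brC Hpair).
have E2 : br alpha (- 2 *: rho) = 0.
  rewrite -(rho_tau Hpair Hxy) linear_sumr.
  have Hb : blin (fun u v => br (tau u) v).
    by split=> s u v w; rewrite ?tau_lin ?brL ?brR.
  have := dual_invariant Hpair Hxy alpha Hb => /eqP; rewrite -addr_eq0 -big_split /= => /eqP E.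
  rewrite -[RHS]E; apply: eq_bigr => A _.
  by rewrite Ha (br_br Hpair) subrK.
rewrite linearZr_LR /= in E2.
have := E2 => /(congr1 (fun z => (2^-1 : C) *: z)); rewrite scaler0 scalerA => E3.
by rewrite -scaleN1r -[RHS]E3; congr (_ *: _); field.
Qed.

(** The sum is the trace of ad [u, v] on the subalgebra [U], with [ys] as coordinate functionals; a
    trace of a commutator vanishes. *)
Lemma trace_commutator (U : {vspace g}) (xs ys : n.-tuple g) u v :
  lie_subalgebra br U -> (forall i, (i < n)%N -> xs`_i \in U) ->
  (forall z, z \in U -> z = \sum_(j < n) ip z ys`_j *: xs`_j) ->
  u \in U -> v \in U -> \sum_(i < n) ip (br (br u v) xs`_i) ys`_i = 0.
Proof.
move=> sU xU ex uU vU.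
have E w w' : w \in U -> w' \in U -> \sum_(i < n) ip (br w (br w' xs`_i)) ys`_i =
    \sum_(i < n) \sum_(j < n) ip (br w' xs`_i) ys`_j * ip (br w xs`_j) ys`_i.
  move=> wU w'U; apply: eq_bigr => i _.
  rewrite {1}[br w' _](ex _ (sU _ _ w'U (xU _ (ltn_ord i)))) linear_sumr linear_sumlz.
  by apply: eq_bigr => j _; rewrite linearZr_LR linearZl_LR.
under eq_bigr do rewrite (br_br Hpair) linearBl /=.
rewrite sumrB !E // [X in _ - X]exchange_big -sumrB big1 // => i _.
by rewrite -sumrB big1 // => j _; rewrite mulrC subrr.
Qed.

(** When both halves are subalgebras, (rho, [u, v]) is plus or minus the trace of ad [u, v] on the
    half containing u and v, hence zero. The bar map only changes the sign of alpha paired with such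
    a bracket. *)
Lemma g0_beta alpha : lie_subalgebra br gm -> in_g0 br ip gp gm alpha ->
  in_g0 br ip gp gm (rho + barv gp gm alpha).
Proof.
move=> sm [Hp Hm]; have sp := mp_sub Hpair; rewrite barv_tau.
split; apply: bracketv_orth => u v uU vU.
  rewrite linearBl /= (tauC Hpair) tau_gp ?sp // linearNr opprK Hp ?mem_bracketv // subr0.
  rewrite /Defs.rho linear_sumlz.
  transitivity (\sum_(i < n) ip (br (br u v) x`_i) y`_i).
    by apply: eq_bigr => i _; rewrite (ipC Hpair) -(ip_br Hpair).
  rewrite (trace_commutator sp) //.
    by move=> i iN; apply: (x_in Hxy).
  move=> z zp; rewrite [LHS](expand_xy Hpair Hxy); apply: eq_bigr => i _.
  by rewrite (mp_isoP Hpair zp (x_in Hxy (ltn_ord i))) scale0r addr0.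
rewrite linearBl /= (tauC Hpair) tau_gm ?sm // Hm ?mem_bracketv // oppr0 subr0.
rewrite /Defs.rho linear_sumlz.
transitivity (- \sum_(i < n) ip (br (br u v) y`_i) x`_i).
  rewrite -sumrN; apply: eq_bigr => i _.
  by rewrite (brC Hpair x`_i) linearNl /= (ipC Hpair) -(ip_br Hpair).
rewrite (trace_commutator sm) ?oppr0 //.
  by move=> i iN; apply: (y_in Hxy).
move=> z zp; rewrite [LHS](expand_xy Hpair Hxy); apply: eq_bigr => i _.
by rewrite (mp_isoM Hpair zp (y_in Hxy (ltn_ord i))) scale0r add0r.
Qed.

Lemma dim_pair : \dim {:g} = (2 * n)%N.
Proof.
have [bx by_ _] := Hxy.
rewrite -(mp_sum Hpair) dimv_disjoint_sum ?(mp_cap Hpair) //.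
have := size_basis bx; have := size_basis by_; move=> <- <-.
by rewrite mul2n addnn.
Qed.

End ManinPairG0.

(** * Fields on the tensor product *)

Section TensorInduction.
Context (C : fieldType) (E W V : lmodType C) (t : {bilinear E -> W -> V}).
Context (HV : is_tensor_product t).
Context (P : V -> Prop) (P0 : P 0) (PL : forall a u v, P u -> P v -> P (a *: u + v)).
Context (Pt : forall e w, P (t e w)).

Let pP : pred V := fun v => `[< P v >].
Fact pP_submod : submod_closed pP.
Proof.
split=> [|a u v /asboolP Pu /asboolP Pv]; apply/asboolP => //.
exact: PL.
Qed.
HB.instance Definition _ := GRing.isSubmodClosed.Build C V pP pP_submod.

Record tensor_sub := TensorSub { tensor_val : V; tensor_valP : pP tensor_val }.
HB.instance Definition _ := [isSub for tensor_val].
HB.instance Definition _ := [Choice of tensor_sub by <:].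
HB.instance Definition _ := [SubChoice_isSubLmodule of tensor_sub by <:].

Let st e w : tensor_sub := TensorSub (asboolT (Pt e w)).
Fact st_bilinear : bilinear_for *:%R *:%R st.
Proof.
by split=> z a u v; apply: val_inj; rewrite /= ?linearPl ?linearPr.
Qed.
HB.instance Definition _ := bilinear_isBilinear.Build C E W tensor_sub *:%R *:%R st st_bilinear.

(* The universal property, applied to the submodule P, splits its inclusion. *)
Lemma tensor_ind v : P v.
Proof.
have [[L HL] _] := HV st.
have [_ /(_ (val \o L) idfun)] := HV t.
move=> /(_ (fun e w => congr1 val (HL e w)) v) /= <-.
exact: asboolW (tensor_valP (L v)).
Qed.

End TensorInduction.

Section TensorFields.
Context (C : numFieldType) (E W V : lmodType C) (t : {bilinear E -> W -> V}).
Context (HV : is_tensor_product t).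
Implicit Types (A B D : vfield V) (p q : bool).

Lemma tensor_vfield (A' : int -> V -> V) : (forall m, linear (A' m)) ->
  (forall e w, exists N : nat, forall m : int, N%:Z <= m -> A' m (t e w) = 0) ->
  is_vfield A'.
Proof.
move=> lA HA; apply/is_vfieldP; split=> //.
have A0 m : A' m 0 = 0.
  by have := lA m (-1) 0 0; rewrite !scaleN1r oppr0 addr0 addNr.
apply: (tensor_ind HV) => [|a u v [N HN] [M HM]|//]; first by exists 0%N.
by exists (N + M)%N => m Hm; rewrite lA HN ?HM ?scaler0 ?addr0 //; lia.
Qed.

Lemma acts_left_vfield p (A : field E p) (A' : field V p) :
  is_field A -> acts_left t A A' -> is_vfield A'.
Proof.
move=> [_ At] HA; apply: tensor_vfield => [m|e w]; first by case: (HA m).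
have [N HN] := At e; exists `|N|%N => m Hm.
by rewrite (HA m).2 HN ?linear0l //; lia.
Qed.

Lemma acts_right_vfield p (A : field W p) (A' : field V p) :
  is_field A -> acts_right t A A' -> is_vfield A'.
Proof.
move=> [_ At] HA; apply: tensor_vfield => [m|e w]; first by case: (HA m).
have [N HN] := At w; exists `|N|%N => m Hm.
by rewrite (HA m).2 HN ?linear0r //; lia.
Qed.

Lemma vfield_eq_tensor A B :
  (forall m e w, A m (t e w) = B m (t e w)) -> A = B.
Proof.
move=> H; apply: vfield_eq => m; apply: (tensor_ind HV) => [|a u v Hu Hv|e w].
- by rewrite !vlin0.
- by rewrite !vmode_lin Hu Hv.
- exact: H.
Qed.

Lemma br3_tensor e A B (c0 c1 c2 : vfield V) :
  (forall m k x w, A m (B k (t x w)) - sg e *: B k (A m (t x w)) =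
     c0 (m + k) (t x w) + m%:~R *: c1 (m + k - 1) (t x w)
     + (m%:~R * (m%:~R - 1) / 2) *: c2 (m + k - 2) (t x w)) ->
  br3 e A B c0 c1 c2.
Proof.
move=> H m k; apply: (tensor_ind HV) => [|a u v Hu Hv|x w]; last exact: H.
  by rewrite !vlin0 !scaler0 !addr0 subr0.
rewrite !vlinE; apply: (linear_comb2 (c := a) (c' := 1) Hu Hv).
by vcoefs C V; ring.
Qed.

Lemma br3_left p q (A B c0 : int -> E -> E) (b : C) (A' B' c0' : vfield V) :
  @ope C E p q A B [:: c0; b *: @one_field C E] ->
  @acts_left C E W V t p A A' -> @acts_left C E W V t q B B' ->
  @acts_left C E W V t (p (+) q) c0 c0' ->
  br3 (p && q) A' B' c0' (b *: vone) 0.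
Proof.
move=> [_ _ _ H] HA HB H0; apply: br3_tensor => m k e w.
have {}H := congr1 (t ^~ w) (H m k e).
rewrite !big_ord_recr big_ord0 /= add0r binz0 binz1 subr0 scale1r in H.
rewrite linearBl linearDl !linearZl_LR /= in H.
rewrite !vmodeE voneE scaler0 addr0 (HA m).2 !(HB k).2 (HA m).2 (H0 _).2 H.
congr (_ + _ *: _).
congr (_ *: _).
by rewrite /one_field; case: ifP; rewrite ?linear0l.
Qed.

Lemma br3_right p q (A B : int -> W -> W) (b : C) (A' B' : vfield V) :
  (forall m k w, A m (B k w) - sg (p && q) *: B k (A m w) =
     b *: @one_field C W (m + k) w) ->
  @acts_right C E W V t p A A' -> @acts_right C E W V t q B B' ->
  br3 (p && q) A' B' (b *: vone) 0 0.
Proof.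
move=> H HA HB; apply: br3_tensor => m k e w.
have {}H := congr1 (t e) (H m k w).
rewrite linearBr !linearZr_LR /= in H.
rewrite !vmodeE voneE !scaler0 !addr0 (HA m).2 !(HB k).2 (HA m).2 H.
by rewrite /one_field; case: ifP; rewrite ?linear0r.
Qed.

Lemma br3_left_right q (A : int -> E -> E) (B : int -> W -> W) (A' B' : vfield V) :
  @acts_left C E W V t false A A' -> @acts_right C E W V t q B B' ->
  br3 false A' B' 0 0 0.
Proof.
move=> HA HB; apply: br3_tensor => m k e w.
by rewrite !vmodeE !scaler0 !addr0 (HB k).2 !(HA m).2 (HB k).2 [sg _]expr0 scale1r subrr.
Qed.

End TensorFields.

(** * The fields of the theorem as normally ordered products of fields *)

Section UnbundledFields.
Context (C : numFieldType) (V : lmodType C).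
Implicit Types (A B : vfield V) (p q : bool).

(** Restores the parity tag, to compare with the fields of the statement. *)
Definition vf p A : field V p := vmode A.
Fact vf_linear p : linear (vf p). Proof. by []. Qed.
HB.instance Definition _ p :=
  GRing.isLinear.Build C (vfield V) (field V p) *:%R (vf p) (vf_linear p).

Lemma nprod_vf p q A B : nprod (vf p A) (vf q B) = vf (p (+) q) (nop (p && q) A B).
Proof. exact: nprodE. Qed.

Lemma dfield_vf p A : dfield (vf p A) = vf p (vd A).
Proof.
by apply/funext => m; apply/funext => v; rewrite /dfield /vf vdE.
Qed.

Lemma nprod3_vf p A B D :
  nprod (vf p A) (nprod (vf true B) (vf true D)) = vf p (nop false A (nop true B D)).
Proof.
rewrite nprod_vf.
have := nprod_vf p false A (nop true B D); rewrite andbF.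
by case: p.
Qed.

Lemma nprod4_vf A B D D' :
  nprod (vf true A) (nprod (vf true B) (nprod (vf true D) (vf true D'))) =
  vf false (nop true A (nop false B (nop true D D'))).
Proof. by rewrite nprod3_vf nprod_vf. Qed.

End UnbundledFields.

Section PairFields.
Context (C : numFieldType) (V : lmodType C) (g : vectType C).
Local Notation vfield := (vfield V).
Context (br : {bilinear g -> g -> g}) (ip : {biscalar g}) (gp gm : {vspace g}).
Context (Hpair : manin_pair br ip gp gm).
Context (n : nat) (x y : n.-tuple g) (Hxy : dual_bases ip gp gm x y).
Context (J a : g -> vfield).
Context (JL : forall s u v, J (s *: u + v) = s *: J u + J v).
Context (aL : forall s u v, a (s *: u + v) = s *: a u + a v).
Context (Baa : forall u v, br3 true (a u) (a v) (ip u v *: vone) 0 0).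
Context (BJa : forall u v, br3 false (J u) (a v) 0 0 0).
Context (BJJ : forall u v, br3 false (J u) (J v) (J (br u v))
  ((ip u v - 2^-1 * killing br u v) *: vone) 0).
Context (c f phi : 'I_n -> 'I_n -> 'I_n -> C).
Context (Hcf : structure_constants br x y c f phi).
Implicit Types (i j k l m : 'I_n) (u v w z : g).

Let cur (X : g) : field V false := vf false (J X).
Let al i : field V true := vf true (a x`_i).
Let au i : field V true := vf true (a y`_i).

Let vfD p (A B : vfield) : vf p (A + B) = vf p A + vf p B. Proof. by []. Qed.
Let vfB p (A B : vfield) : vf p (A - B) = vf p A - vf p B. Proof. by []. Qed.
Let vfZ p b (A : vfield) : vf p (b *: A) = b *: vf p A. Proof. by []. Qed.
Let vf_sum p (I : finType) (A : I -> vfield) : vf p (\sum_i A i) = \sum_i vf p (A i).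
Proof. exact: linear_sum. Qed.
Let vf_sumZ p (I : finType) (s : I -> C) (A : I -> vfield) :
  vf p (\sum_i s i *: A i) = \sum_i s i *: vf p (A i).
Proof. by rewrite linear_sum; apply: eq_bigr => i _; rewrite linearZ. Qed.

Lemma Il_vf i : Il x c f cur al au i = vf false (Icur br x y J a x`_i).
Proof.
rewrite /Il /Icur (theta_x Hpair Hxy aL Baa Hcf) addrA !vfB vfZ !vf_sum; congr (_ - _ - _ *: _); apply: eq_bigr => j _;
  by rewrite vf_sumZ; apply: eq_bigr => k _; rewrite nprod_vf.
Qed.

Lemma Iu_vf i : Iu y c f phi cur al au i = vf false (Icur br x y J a y`_i).
Proof.
rewrite /Iu /Icur (theta_y Hpair aL Baa Hcf) !addrA vfD !vfB !vfZ !vf_sum; congr (_ - _ - _ *: _ + _ *: _); apply: eq_bigr => j _;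
  by rewrite vf_sumZ; apply: eq_bigr => k _; rewrite nprod_vf.
Qed.

Lemma curI_vf z : curI ip x y c f phi cur al au z = vf false (Icur br x y J a z).
Proof.
have IL s u v : Icur br x y J a (s *: u + v) = s *: Icur br x y J a u + Icur br x y J a v.
  by rewrite /Icur JL (theta_lin br x y aL); vmod C; ring.
rewrite [in RHS](expand_xy Hpair Hxy z) /curI.
transitivity (\sum_(i < n) vf false (Icur br x y J a (ip z y`_i *: x`_i + ip z x`_i *: y`_i))).
  apply: eq_bigr => i _; rewrite Il_vf Iu_vf IL -[_ *: y`_i]addr0 IL (lin_fun0 IL) addr0.
  by [].

rewrite -vf_sum; congr (vf _ _).
rewrite -[in RHS](eq_bigr _ (fun i _ => scale1r _)) lin_sum //.
by apply: eq_bigr => i _; rewrite scale1r.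
Qed.

Lemma Gplus_vf (q : 'I_n -> C) : Gplus x c cur al au q = vf true (Gplus_v x y J a c q).
Proof.
rewrite /Gplus /Gplus_v vfD vfB vfZ /= !vf_sum; congr (_ - _ *: _ + _).
- by apply: eq_bigr => i _; rewrite nprod_vf.
- apply: eq_bigr => i _; rewrite vf_sum; apply: eq_bigr => j _; rewrite vf_sumZ.
  by apply: eq_bigr => k _; rewrite nprod3_vf.
- by apply: eq_bigr => i _; rewrite vfZ dfield_vf.
Qed.

Lemma Gminus_vf (p : 'I_n -> C) : Gminus y f cur al au p = vf true (Gminus_v x y J a f p).
Proof.
rewrite /Gminus /Gminus_v vfD vfB vfZ /= !vf_sum; congr (_ - _ *: _ + _).
- by apply: eq_bigr => i _; rewrite nprod_vf.
- apply: eq_bigr => i _; rewrite vf_sum; apply: eq_bigr => j _; rewrite vf_sumZ.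
  by apply: eq_bigr => k _; rewrite nprod3_vf.
- by apply: eq_bigr => i _; rewrite vfZ dfield_vf.
Qed.

Lemma Phi_vf : Phifield phi al = vf true (Phi_v x a phi).
Proof.
rewrite /Phifield /Phi_v vfZ /= vf_sum; congr (_ *: _).
apply: eq_bigr => i _; rewrite vf_sum; apply: eq_bigr => j _; rewrite vf_sumZ.
by apply: eq_bigr => k _; rewrite nprod3_vf.
Qed.

Lemma F_vf : Ffield x c phi cur al au = vf false (F_v x y J a c phi).
Proof.
rewrite /Ffield /F_v vfD !vfZ /= !vf_sum; congr (_ *: _ + _ *: _).
  apply: eq_bigr => i _; rewrite vf_sum; apply: eq_bigr => j _; rewrite vf_sumZ.
  apply: eq_bigr => k _; rewrite nprod3_vf vfB vf_sum; congr (_ *: (_ - _)).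
  apply: eq_bigr => l _; rewrite vf_sumZ; apply: eq_bigr => m _.
  by rewrite nprod4_vf.
apply: eq_bigr => i _; rewrite vf_sum; apply: eq_bigr => j _.
rewrite vf_sum; apply: eq_bigr => k _; rewrite vf_sumZ.
by apply: eq_bigr => l _; rewrite dfield_vf nprod_vf.
Qed.

Lemma J_vf beta :
  Jfield ip x y c f phi cur al au beta = vf false (Jcur br x y J a beta).
Proof.
rewrite /Jfield /Jcur curI_vf vfD vf_sum; congr (_ + _).
by apply: eq_bigr => i _; rewrite nprod_vf.
Qed.

Lemma T_vf alpha :
  Tfield ip x y c f phi cur al au alpha = vf false (Tcur br x y J a alpha).
Proof.
rewrite /Tfield /Tcur curI_vf dfield_vf /T0cur vfZ vfD; congr (_ *: (_ + _)).
rewrite (sum_dual x y (fun u v => nop false (J v) (J u))).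
rewrite (sum_dual x y (fun u v => nop true (a v) (vd (a u)))).
rewrite vfB !vf_sum -sumrB; apply: eq_bigr => i _.
rewrite -vfB; transitivity (vf false (nop false (J x`_i) (J y`_i) + nop false (J y`_i) (J x`_i)
  + nop true (vd (a y`_i)) (a x`_i) - nop true (a y`_i) (vd (a x`_i)))).
  by rewrite !dfield_vf !nprod_vf.
by congr (vf _ _); rewrite (vda_anti Baa); vmod C; ring.
Qed.

Lemma N32_of_manin_pair alpha (p q : 'I_n -> C) :
  let beta := rho br x y + barv gp gm alpha in
  alpha = \sum_(i < n) (p i *: x`_i + q i *: y`_i) ->
  in_g0 br ip gp gm alpha -> in_g0 br ip gp gm beta ->
  N32_algebra (central_charge br ip x y alpha)
    (Tfield ip x y c f phi cur al au alpha) (Jfield ip x y c f phi cur al au beta)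
    (Ffield x c phi cur al au)
    (Gplus x c cur al au q) (Gminus y f cur al au p) (Phifield phi al).
Proof.
move=> beta Ea Ha Hb.
have Eb : beta = rho br x y - tau ip x y alpha by rewrite /beta (barv_tau Hpair Hxy).
rewrite T_vf J_vf F_vf Gplus_vf Gminus_vf Phi_vf.
have -> : central_charge br ip x y alpha =
    n%:R - ip (rho br x y) (rho br x y) - ip alpha alpha.
  rewrite /central_charge (dim_pair Hpair Hxy) natrM mulrC mulrA mulVf ?pnatr_eq0 //.
  by rewrite mul1r.
have [r0 [HPG EF]] := Phi_Gplus Hpair Hxy Baa BJa Hcf q.
apply: (N32_of_charges Hpair Hxy JL aL Baa BJa BJJ Eb _ _ _ _ _ _ _ HPG EF).
- by rewrite Eb; apply: (g0_comm Hpair Hxy).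
- exact: (g0_tau Hpair Hxy).
- exact: (g0_tau Hpair Hxy).
- exact: (Dshift_components Hpair Hxy).
- exact: (charge_Gplus Hpair Hxy).
- exact: (charge_Gminus Hpair Hxy).
- exact: (charge_Phi Hpair Hxy).
Qed.

End PairFields.

(** * The currents and fermions on the tensor product *)

Section TensorPair.
Context (C : numFieldType) (g : vectType C).
Context (br : {bilinear g -> g -> g}) (ip : {biscalar g}) (gp gm : {vspace g}).
Context (Hpair : manin_pair br ip gp gm).
Context (n : nat) (x y : n.-tuple g) (Hxy : dual_bases ip gp gm x y).
Context (c f phi : 'I_n -> 'I_n -> 'I_n -> C).
Context (Hcf : structure_constants br x y c f phi).
Context (E : lmodType C) (curE : g -> field E false).
Context (HE : affine_currents br (fun X Y => ip X Y - 2^-1 * killing br X Y) curE).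
Context (W : lmodType C) (alW auW : 'I_n -> field W true) (HW : free_fermions alW auW).
Context (V : lmodType C) (t : {bilinear E -> W -> V}) (HV : is_tensor_product t).
Context (cur : g -> field V false) (al au : 'I_n -> field V true).
Context (Hcur : forall X, acts_left t (curE X) (cur X)).
Context (Hal : forall i, acts_right t (alW i) (al i)).
Context (Hau : forall i, acts_right t (auW i) (au i)).
Local Notation vfield := (vfield V).
Implicit Types (u v w : g) (A B : bool * 'I_n).

Fact cur_vfield X : is_vfield (cur X).
Proof.
by have [_ /(_ X X)[HX _ _ _]] := HE; apply: (acts_left_vfield HV HX).
Qed.
Fact al_vfield i : is_vfield (al i).
Proof. by have [_ H _] := HW i i; case: H => H _ _ _; apply: (acts_right_vfield HV H). Qed.
Fact au_vfield i : is_vfield (au i).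
Proof. by have [_ _ H] := HW i i; case: H => H _ _ _; apply: (acts_right_vfield HV H). Qed.

Definition tcur X : vfield := VField (cur_vfield X).
Definition tfermion A : vfield :=
  if A.1 then VField (au_vfield A.2) else VField (al_vfield A.2).
(** Linear extension of the fermions to all of [g], sending x_i to a_i and x^i to a^i; their
    brackets then become the inner product. *)
Definition tferm u : vfield := \sum_A ip u (bd x y A) *: tfermion A.

Lemma tcur_lin s u v : tcur (s *: u + v) = s *: tcur u + tcur v.
Proof.
apply: (vfield_eq_tensor HV) => m e w; rewrite !vmodeE /= !(Hcur _ m).2.
have [-> _] := HE; rewrite -[(_ + _) m e]/(s *: curE u m e + curE v m e).
by rewrite linearDl linearZl_LR.
Qed.

Lemma tferm_lin s u v : tferm (s *: u + v) = s *: tferm u + tferm v.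
Proof.
rewrite /tferm scaler_sumr -big_split; apply: eq_bigr => A _ /=.
by rewrite ipL scalerDl scalerA.
Qed.

Let sum_bool_ord (F : bool * 'I_n -> vfield) :
  \sum_A F A = \sum_(i < n) F (true, i) + \sum_(i < n) F (false, i).
Proof.
rewrite (eq_bigr (fun A => F (A.1, A.2))) => [|[]//].
by rewrite -(pair_big xpredT xpredT (fun s i => F (s, i))) big_bool.
Qed.

Lemma tferm_x (i : 'I_n) : tferm x`_i = VField (al_vfield i).
Proof.
rewrite /tferm sum_bool_ord /bd /=.
rewrite big1 ?add0r => [|j _]; last by rewrite (ip_xx Hpair Hxy) scale0r.
rewrite -[RHS](sum_delta (fun i => VField (al_vfield i))).
by apply: eq_bigr => j _; rewrite (ip_xy Hxy) eq_sym.
Qed.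

Lemma tferm_y (i : 'I_n) : tferm y`_i = VField (au_vfield i).
Proof.
rewrite /tferm sum_bool_ord /bd /= addrC.
rewrite big1 ?add0r => [|j _]; last by rewrite (ip_yy Hpair Hxy) scale0r.
rewrite -[RHS](sum_delta (fun i => VField (au_vfield i))).
by apply: eq_bigr => j _; rewrite (ip_yx Hpair Hxy) eq_sym.
Qed.

Lemma cur_cur u v : br3 false (tcur u) (tcur v) (tcur (br u v))
  ((ip u v - 2^-1 * killing br u v) *: vone) 0.
Proof.
by have [_ /(_ u v) H] := HE; exact: (br3_left HV (p := false) (q := false) (A' := tcur u) (B' := tcur v) (c0' := tcur (br u v)) H (Hcur u) (Hcur v) (Hcur _)).
Qed.

Lemma tfermion_bracket A B :
  br3 true (tfermion A) (tfermion B) (ip (be x y A) (be x y B) *: vone) 0 0.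
Proof.
have au_al i j : br3 true (VField (au_vfield i)) (VField (al_vfield j))
    ((i == j)%:R *: vone) 0 0.
  apply: skew_odd; apply: (br3_right HV (p := true) (q := true)
    (A' := VField (al_vfield j)) (B' := VField (au_vfield i)) _ (Hal j) (Hau i)) => m k w.
  have [[_ _ _ H] _ _] := HW j i; rewrite [LHS]H big_ord1 binz0 scale1r subr0.
  by rewrite eq_sym.
have E0 (D D' : 'I_n -> field W true) i j :
    ope (D i) (D' j) [::] -> forall m k (w : W),
    D i m (D' j k w) - sg true *: D' j k (D i m w) = 0 *: @one_field C W (m + k) w.
  by case=> _ _ _ H m k w; rewrite [LHS]H big_ord0 scale0r.
case: A B => [[] i] [[] j]; rewrite /be /tfermion /=.
- rewrite (ip_yy Hpair Hxy); have [_ _ H] := HW i j.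
  exact: (br3_right HV (p := true) (q := true) (A' := VField (au_vfield i))
    (B' := VField (au_vfield j)) (E0 _ _ _ _ H) (Hau i) (Hau j)).
- by rewrite (ip_yx Hpair Hxy).
- by rewrite (ip_xy Hxy) eq_sym; apply: skew_odd.
- rewrite (ip_xx Hpair Hxy); have [_ H _] := HW i j.
  exact: (br3_right HV (p := true) (q := true) (A' := VField (al_vfield i))
    (B' := VField (al_vfield j)) (E0 _ _ _ _ H) (Hal i) (Hal j)).
Qed.

Lemma tferm_bracket u v : br3 true (tferm u) (tferm v) (ip u v *: vone) 0 0.
Proof.
apply: (br3_eq (br3_suml (fun A => br3_Zl (ip u (bd x y A)) (br3_sumr (fun B =>
  br3_Zr (ip v (bd x y B)) (tfermion_bracket A B)))))).
- rewrite [in RHS](expand_be Hpair Hxy u) linear_sumlz scaler_suml.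
  apply: eq_bigr => A _; rewrite linearZl_LR /= -scalerA; congr (_ *: _).
  rewrite [in RHS](expand_be Hpair Hxy v) linear_sumr scaler_suml.
  by apply: eq_bigr => B _; rewrite linearZr_LR /= -scalerA.
- by rewrite big1 // => A _; rewrite big1 ?scaler0 // => B _; rewrite scaler0.
- by rewrite big1 // => A _; rewrite big1 ?scaler0 // => B _; rewrite scaler0.
Qed.

Lemma cur_ferm u v : br3 false (tcur u) (tferm v) 0 0 0.
Proof.
have H A : br3 false (tcur u) (tfermion A) 0 0 0.
  by case: A => [[] i];
    [apply: (br3_left_right HV (A' := tcur u) (B' := VField (au_vfield i)) (Hcur u) (Hau i))
    |apply: (br3_left_right HV (A' := tcur u) (B' := VField (al_vfield i)) (Hcur u) (Hal i))].
by apply: (br3_eq (br3_sumr (fun A => br3_Zr (ip v (bd x y A)) (H A))));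
  rewrite big1 // => A _; rewrite scaler0.
Qed.

Lemma N32_of_tensor alpha (p q : 'I_n -> C) :
  let beta := rho br x y + barv gp gm alpha in
  alpha = \sum_(i < n) (p i *: x`_i + q i *: y`_i) ->
  in_g0 br ip gp gm alpha -> in_g0 br ip gp gm beta ->
  N32_algebra (central_charge br ip x y alpha)
    (Tfield ip x y c f phi cur al au alpha) (Jfield ip x y c f phi cur al au beta)
    (Ffield x c phi cur al au)
    (Gplus x c cur al au q) (Gminus y f cur al au p) (Phifield phi al).
Proof.
move=> beta Ea Ha Hb.
have := N32_of_manin_pair Hpair Hxy tcur_lin tferm_lin tferm_bracket cur_ferm cur_cur Hcf
  Ea Ha Hb.
have -> : (fun X => vf false (tcur X)) = cur by [].
have -> : (fun i : 'I_n => vf true (tferm x`_i)) = al.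
  by apply/funext => i; rewrite tferm_x.
have -> : (fun i : 'I_n => vf true (tferm y`_i)) = au.
  by apply/funext => i; rewrite tferm_y.
by [].
Qed.

End TensorPair.

(* Modulo the remaining hypotheses, the only second order pole of G^+(z).Phi(w)
   is -1/4 (rho + bar alpha, [x^j, x^k]) a_j a_k, which does not vanish for all
   Manin pairs; hence the condition in_g0 beta on the first conclusion.  When gm
   is a subalgebra it follows from in_g0 alpha. *)
Theorem mainTheorem1
  (R : realType) (g : vectType R[i])
  (br : {bilinear g -> g -> g}) (ip : {biscalar g}) (gp gm : {vspace g})
  (Hpair : manin_pair br ip gp gm)
  (n : nat) (x y : n.-tuple g) (Hxy : dual_bases ip gp gm x y)
  (c f phi : 'I_n -> 'I_n -> 'I_n -> R[i])
  (Hcfphi : structure_constants br x y c f phi)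
  (E : lmodType R[i]) (curE : g -> field E false)
  (HE : highest_weight_representation br
          (fun X Y => ip X Y - 2^-1 * killing br X Y) curE)
  (W : lmodType R[i]) (alW auW : 'I_n -> field W true)
  (HW : fock_space alW auW)
  (V : lmodType R[i]) (t : {bilinear E -> W -> V})
  (HV : is_tensor_product t)
  (cur : g -> field V false) (al au : 'I_n -> field V true)
  (Hcur : forall X, acts_left t (curE X) (cur X))
  (Hal : forall i, acts_right t (alW i) (al i))
  (Hau : forall i, acts_right t (auW i) (au i))
  (alpha : g) (p q : 'I_n -> R[i])
  (Halpha : alpha = \sum_(i < n) (p i *: x`_i + q i *: y`_i))
  (Hg0 : in_g0 br ip gp gm alpha) :
  let d := central_charge br ip x y alpha in
  let beta := rho br x y + barv gp gm alpha in
  let Gp := Gplus x c cur al au q in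
  let Gm := Gminus y f cur al au p in
  let Phi := Phifield phi al in
  let J := Jfield ip x y c f phi cur al au beta in
  let T := Tfield ip x y c f phi cur al au alpha in
  let F := Ffield x c phi cur al au in
  (in_g0 br ip gp gm beta -> N32_algebra d T J F Gp Gm Phi) /\
  (lie_subalgebra br gm ->
    [/\ Phi = 0, F = 0 & N2_algebra d T J Gp Gm]).
Proof.
move=> d beta Gp Gm Phi J T F.
have [HcurE _] := HE; have [Hferm _] := HW.
have main : in_g0 br ip gp gm beta -> N32_algebra d T J F Gp Gm Phi.
  exact: (N32_of_tensor Hpair Hxy Hcfphi HcurE Hferm HV Hcur Hal Hau Halpha Hg0).
(* phi^{ijk} = - ([x^i, x^j], x^k), a pairing of two vectors of the isotropic [gm] once the bracket
   stays there. *)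
split=> // sm; have phi0 i j k : phi i j k = 0.
  rewrite (phiE Hpair Hxy Hcfphi) (mp_isoM Hpair) ?oppr0 ?(y_in Hxy) //.
  by apply: sm; apply: (y_in Hxy).
have Phi0 : Phi = 0.
  rewrite /Phi /Phifield big1 ?scaler0 // => i _; rewrite big1 // => j _.
  by rewrite big1 // => k _; rewrite phi0 scale0r.
have F0 : F = 0.
  rewrite /F /Ffield !big1 ?scaler0 ?addr0 // => i _; rewrite big1 // => j _.
    by rewrite big1 // => k _; rewrite big1 // => l _; rewrite phi0 mulr0 scale0r.
  by rewrite big1 // => k _; rewrite phi0 scale0r.
(* The zeros in the N = 2 relations are folded back into F and Phi, which turns them into the first
   conclusion. *)
split=> //; rewrite /N2_algebra -{1}F0 -Phi0; apply: main.
exact: (g0_beta Hpair Hxy sm Hg0).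
Qed.
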